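(* Let $n\ge 2$. Fix a point $o\in\mathbb{H}^{n+1}$ (the origin) and let $V(x)=\cosh r(x)$, where $r(x)=d(o,x)$. Let $\chi:\mathbb{R}^{+}\to\mathbb{R}$ be a smooth, positive and monotone non-decreasing function. Let $\Omega$ be a smooth bounded and uniformly $h$-convex domain in $\mathbb{H}^{n+1}$, with boundary $\Sigma=\partial\Omega$ and unit outward normal $\nu$. Let $k\in\{1,\dots,n\}$. If $\Sigma$ satisfies $$E_k(\tilde\kappa)=\chi(V-V_{,\nu})\quad\text{on }\Sigma,$$ where $V_{,\nu}=\langle\overline\nabla V,\nu\rangle$, then $\Sigma$ is a geodesic sphere. Moreover, if $\chi$ is strictly increasing, then $\Sigma$ is a geodesic sphere centered at the origin $o$.
   Context: $\mathbb{H}^{n+1}$ is hyperbolic space of constant sectional curvature $-1$, with Levi-Civita connection $\overline\nabla$; $\mathbb{R}^+=(0,\infty)$. For a local orthonormal tangent frame $e_1,\dots,e_n$ of $\Sigma$, the second fundamental form is $h_{ij}=\langle\overline\nabla_{e_i}\nu,e_j\rangle$, and the principal curvatures $\kappa_1,\dots,\kappa_n$ are the eigenvalues of the Weingarten map $(h_i^j)$ (so a geodesic sphere of radius $\rho$ has all $\kappa_i=\coth\rho$). A smooth bounded domain is uniformly $h$-convex if there is a constant $\varepsilon>0$ such that the principal curvatures of its boundary satisfy $\kappa_i\ge 1+\varepsilon$ for all $i$ at every boundary point. The shifted principal curvatures are $\tilde\kappa=(\kappa_1-1,\dots,\kappa_n-1)$, and $$E_k(\tilde\kappa)=\binom{n}{k}^{-1}\sum_{1\le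 i_1<\dots<i_k\le n}\tilde\kappa_{i_1}\cdots\tilde\kappa_{i_k}.$$ One always has $V-V_{,\nu}\ge\cosh r-\sinh r>0$, so $\chi(V-V_{,\nu})$ is well defined. *)

(* Defs.v *)
From HB Require Import structures.
From mathcomp Require Import all_boot all_order all_algebra.
From mathcomp Require Import all_classical all_reals all_analysis.

Set Implicit Arguments.
Unset Strict Implicit.
Unset Printing Implicit Defensive.

Import Order.TTheory GRing.Theory Num.Theory.
Import numFieldNormedType.Exports.

Local Open Scope classical_set_scope.
Local Open Scope ring_scope.

(* C^k on an open set U, through iterated directional derivatives; the values
   of f outside U play no role when U is open. *)
Fixpoint Ck_on (R : realType) (E F : normedModType R) (k : nat)
    (U : set E) (f : E -> F) : Prop :=
  (forall x, U x -> {for x, continuous f}) /\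
  if k is k'.+1 then
    forall v : E, (forall x, U x -> derivable f x v) /\
      Ck_on k' U (fun x => 'D_v f x)
  else True.

Definition smooth_on (R : realType) (E F : normedModType R)
    (U : set E) (f : E -> F) : Prop := forall k, Ck_on k U f.

(* H^{n+1} is the hyperboloid { <x,x> = -1, x_0 > 0 } in Minkowski space
   R^{n+2}, with the Riemannian metric induced by the Lorentzian product. *)
Definition lor (R : realType) (n : nat) (x y : 'rV[R]_n.+2) : R :=
  - (x 0 0 * y 0 0) + \sum_(i < n.+1) x 0 (lift ord0 i) * y 0 (lift ord0 i).

Definition hyp (R : realType) (n : nat) : set 'rV[R]_n.+2 :=
  [set x | lor x x = -1 /\ 0 < x 0 0].

Definition cosh (R : realType) (t : R) : R := (expR t + expR (- t)) / 2.

(* inverse of cosh on nonnegative reals, for arguments t >= 1 *)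
Definition arcosh (R : realType) (t : R) : R := ln (t + Num.sqrt (t ^+ 2 - 1)).

Definition hdist (R : realType) (n : nat) (x y : 'rV[R]_n.+2) : R :=
  arcosh (- lor x y).

Definition htangent (R : realType) (n : nat) (x : 'rV[R]_n.+2) :
    set 'rV[R]_n.+2 := [set v | lor x v = 0].

(* The Levi-Civita connection is the tangential part of the flat derivative:
   w + <w,x> x is the orthogonal projection of w on T_x H, as <x,x> = -1.  It
   is applied to fields on R^{n+2} and depends, for X tangent to a
   submanifold of H, only on the values of Y along that submanifold. *)
Definition nabla (R : realType) (n : nat) (X : 'rV[R]_n.+2)
    (Y : 'rV[R]_n.+2 -> 'rV[R]_n.+2) (x : 'rV[R]_n.+2) : 'rV[R]_n.+2 :=
  'D_X Y x + lor ('D_X Y x) x *: x.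

(* The boundary in H of a subset that is open in H (H is closed in R^{n+2}). *)
Definition bnd (R : realType) (n : nat) (Omega : set 'rV[R]_n.+2) :
  set 'rV[R]_n.+2 := closure Omega `\` Omega.

Definition bounded_domain (R : realType) (n : nat)
    (Omega : set 'rV[R]_n.+2) : Prop :=
  [/\ Omega !=set0,
      exists2 U : set 'rV[R]_n.+2, open U & Omega = U `&` @hyp R n,
      connected Omega
    & exists2 c, hyp c & exists M : R, forall x, Omega x -> hdist c x <= M].

(* Near its boundary point p, Omega is the sublevel set { f < 0 } of a smooth
   function whose differential on T_p H does not vanish. *)
Definition local_defining (R : realType) (n : nat) (Omega : set 'rV[R]_n.+2)
    (p : 'rV[R]_n.+2) (f : 'rV[R]_n.+2 -> R) : Prop :=
  exists U : set 'rV[R]_n.+2,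
    [/\ open U, U p, @smooth_on R 'rV[R]_n.+2 R^o U f,
        forall x, U x -> hyp x -> (Omega x <-> f x < 0)
      & exists2 v, htangent p v & 'D_v (f : _ -> R^o) p != 0].

Definition smooth_boundary (R : realType) (n : nat)
    (Omega : set 'rV[R]_n.+2) : Prop :=
  forall p, bnd Omega p -> exists f, local_defining Omega p f.

(* nu is given on a neighborhood of the boundary so that it can be
   differentiated in R^{n+2}; only its values on the boundary matter. *)
Definition unit_outward_normal (R : realType) (n : nat)
    (Omega : set 'rV[R]_n.+2) (nu : 'rV[R]_n.+2 -> 'rV[R]_n.+2) : Prop :=
  (exists U : set 'rV[R]_n.+2, [/\ open U, bnd Omega `<=` U & smooth_on U nu]) /\
  forall p, bnd Omega p ->
    [/\ htangent p (nu p), lor (nu p) (nu p) = 1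
      & forall f, local_defining Omega p f ->
          0 < 'D_(nu p) (f : _ -> R^o) p /\
          forall v, htangent p v -> 'D_v (f : _ -> R^o) p = 0 ->
            lor v (nu p) = 0].

Definition orthonormal_frame (R : realType) (n : nat)
    (nu : 'rV[R]_n.+2 -> 'rV[R]_n.+2) (p : 'rV[R]_n.+2)
    (e : 'I_n -> 'rV[R]_n.+2) : Prop :=
  (forall i, htangent p (e i) /\ lor (e i) (nu p) = 0) /\
  (forall i j, lor (e i) (e j) = (i == j)%:R).

Definition second_ff (R : realType) (n : nat)
    (nu : 'rV[R]_n.+2 -> 'rV[R]_n.+2) (p : 'rV[R]_n.+2)
    (e : 'I_n -> 'rV[R]_n.+2) : 'M[R]_n :=
  \matrix_(i, j) lor (nabla (e i) nu p) (e j).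

(* In an orthonormal frame the Weingarten map has matrix (h_ij); kappa lists
   its eigenvalues with multiplicity. *)
Definition principal_curvatures (R : realType) (n : nat)
    (nu : 'rV[R]_n.+2 -> 'rV[R]_n.+2) (p : 'rV[R]_n.+2)
    (kappa : 'I_n -> R) : Prop :=
  exists2 e, orthonormal_frame nu p e
    & char_poly (second_ff nu p e) = \prod_(i < n) ('X - (kappa i)%:P).

Definition uniformly_hconvex (R : realType) (n : nat)
    (Omega : set 'rV[R]_n.+2) (nu : 'rV[R]_n.+2 -> 'rV[R]_n.+2) : Prop :=
  exists2 eps : R, 0 < eps &
    forall p (kappa : 'I_n -> R), bnd Omega p ->
      principal_curvatures nu p kappa -> forall i, 1 + eps <= kappa i.

Definition shifted (R : realType) (n : nat) (kappa : 'I_n -> R) : 'I_n -> R :=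
  fun i => kappa i - 1.

Definition Ek (R : realType) (n k : nat) (x : 'I_n -> R) : R :=
  ('C(n, k)%:R)^-1 * \sum_(S : {set 'I_n} | #|S| == k) \prod_(i in S) x i.

Definition V (R : realType) (n : nat) (o x : 'rV[R]_n.+2) : R :=
  cosh (hdist o x).

(* <grad V, nu> = dV(nu).  The formula for V o extends it to R^{n+2}; the
   extension is smooth near every point of H other than o, and at o it is
   constant along o + s v for v tangent to H, in accordance with dV(o) = 0. *)
Definition Vnu (R : realType) (n : nat) (o : 'rV[R]_n.+2)
    (nu : 'rV[R]_n.+2 -> 'rV[R]_n.+2) (p : 'rV[R]_n.+2) : R :=
  'D_(nu p) (V o : _ -> R^o) p.

Definition geodesic_sphere (R : realType) (n : nat) (c : 'rV[R]_n.+2)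
    (S : set 'rV[R]_n.+2) : Prop :=
  exists2 rho : R, 0 < rho & S = [set x | hyp x /\ hdist c x = rho].

(* Main.v *)
(* In the hyperboloid model put horo p = p - nu p, a future null vector with <p, horo p> = -1; then
   V - V_,nu = - <o, horo p>.  A sweeping argument along geodesics (Omega is connected and locally
   strictly convex) shows that Omega is geodesically convex, and a minimum argument upgrades this to
   - <q, horo p> < 1 for all q <> p in the closure.  Hence the horospherical support function
   supp z = max - <., z>, defined on the future null cone, is attained at a single boundary point
   touch z, where z = supp z * horo (touch z).  Along null curves z + t v + t^2 u its second
   derivative is - 2 <touch z, u> + (1 / supp z) * sum_i <e_i, v>^2 / (kappa_i - 1) in an eigenframe,
   so the curvature equation becomes a fully nonlinear elliptic equation for supp.

   Reflections in hyperplanes m act on the null cone.  For m = e + t o, 0 <= t < 1, monotonicity of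
   chi makes supp - supp o R_m a supersolution on { <m, .> >= 0 }, so that the maximum principle and
   Hopf's lemma hold; both are proved by comparing supp with an explicit barrier, the eigenvalues of
   the quadratic forms being compared by Weyl's inequality and the trace.  Moving t from 1 down to 0
   (Alexandrov reflection) yields a symmetry in every direction e.  All mirrors contain the
   circumcentre of the boundary, so every reflection through it is a symmetry, which forces a sphere.
   If chi is strictly increasing, a symmetry with t > 0 contradicts the equation, so all mirrors
   contain o. *)

Require Import Defs.
From HB Require Import structures.
From mathcomp Require Import all_boot all_order all_algebra.
From mathcomp Require Import all_classical all_reals all_analysis.
From mathcomp Require Import ring lra.

Import Order.TTheory GRing.Theory Num.Theory.
Import numFieldNormedType.Exports.

Local Open Scope classical_set_scope.
Local Open Scope ring_scope.

Set Implicit Arguments.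
Unset Strict Implicit.
Unset Printing Implicit Defensive.


(** * Directional derivatives *)

(** [supp] is only known as a maximum of linear functions, and no second derivative of it is ever
    taken. Its second-order behaviour enters through two one-sided expansions as t -> 0+ along z + t
    v + t^2 u: an upper one, because the touching points converge at rate O(t), and a lower one,
    tested at boundary points that follow the optimal displacement. Barriers are played against
    these bounds. The boundary is likewise never parametrised: tangent vectors are limits of chords.

    [supp] is homogeneous of degree one on the null cone, so it may be studied on any slice <a, .> =
    -1 with a in H; taking a on the mirror turns the mirror into an equator.

    The argument of [chi] at [touch z] is - <o, z> / supp z. If <m, o> <= 0 and <m, z> >= 0,
    reflection in m does not increase - <o, z>, so the quotient can grow only because the
    denominator shrinks, hence by at most a multiple of [diff]. The barrier absorbs this
    zeroth-order term. For m = e + t o one has <m, o> = -t and <m, m> = 1 - t^2: this is why t is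
    kept in [0, 1). *)

Lemma is_derive_line {R : realType} {E F : normedModType R} (f : E -> F) (y v : E) (s : R) :
  derivable f (s *: v + y) v ->
  is_derive s 1 (fun t : R => f (t *: v + y)) ('D_v f (s *: v + y)).
Proof.
have H : (fun h : R => h^-1 *: (f ((h *: (1:R^o) + s) *: v + y) - f (s *: v + y))) =
   (fun h : R => h^-1 *: (f (h *: v + (s *: v + y)) - f (s *: v + y))).
  by apply/funext => h; rewrite [_ *: 1]mulr1 scalerDl addrA.
move=> d; apply: DeriveDef; first by rewrite /derivable /= H.
by rewrite /derive /= H.
Qed.

Lemma mean_value_line {R : realType} {E : normedModType R} (f : E -> R^o) (y v : E) (c A e : R) :
  (forall s, `|s| <= `|c| -> derivable f (s *: v + y) v /\ `|'D_v f (s *: v + y) - A| <= e) ->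
  `|f (c *: v + y) - f y - c * A| <= e * `|c|.
Proof.
move=> H.
have cont a b : `|a| <= `|c| -> `|b| <= `|c| ->
  {within `[a, b], continuous (fun t : R => f (t *: v + y))}.
  move=> ha hb; apply: derivable_within_continuous => x; rewrite in_itv /= => /andP[ax xb].
  have xc : `|x| <= `|c|.
    rewrite ler_norml (le_trans _ ax) /= ?(le_trans xb) //.
      by move: hb; rewrite ler_norml => /andP[].
    by move: ha; rewrite ler_norml => /andP[].
  by have [/is_derive_line h _] := H x xc; apply: ex_derive.
have f0 : f y = f (0 *: v + y) by rewrite scale0r add0r.
case: (ltgtP c 0) => c0.
- have [||x xc eq] := @MVT R (fun t : R => f (t *: v + y)) (fun t => 'D_v f (t *: v + y)) c 0 c0.
  + move=> x; rewrite in_itv /= => /andP[cx x0]; apply: is_derive_line.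
    by apply: (H x _).1; rewrite !ltr0_norm // lerN2 ltW.
  + by apply: cont => //; rewrite normr0.
  move: (xc); rewrite in_itv /= => /andP[cx x0].
  have h2 : `|'D_v f (x *: v + y) - A| <= e.
    by apply: (H x _).2; rewrite !ltr0_norm // ?lerN2 ltW.
  have -> : f (c *: v + y) - f y - c * A = c * ('D_v f (x *: v + y) - A).
    suff -> : f (c *: v + y) - f y = c * 'D_v f (x *: v + y) by ring.
    by apply: oppr_inj; rewrite opprB f0 eq; ring.
  by rewrite normrM mulrC ler_wpM2r.
- have [||x xc eq] := @MVT R (fun t : R => f (t *: v + y)) (fun t => 'D_v f (t *: v + y)) 0 c c0.
  + move=> x; rewrite in_itv /= => /andP[cx x0]; apply: is_derive_line.
    by apply: (H x _).1; rewrite !gtr0_norm // ltW.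
  + by apply: cont => //; rewrite normr0.
  move: (xc); rewrite in_itv /= => /andP[cx x0].
  have h2 : `|'D_v f (x *: v + y) - A| <= e.
    by apply: (H x _).2; rewrite !gtr0_norm // ?lerN2 ltW.
  have -> : f (c *: v + y) - f y - c * A = c * ('D_v f (x *: v + y) - A).
    by rewrite f0 eq subr0; ring.
  by rewrite normrM mulrC ler_wpM2r.
- by rewrite c0 f0 !subrr mul0r subrr normr0 mulr0.
Qed.

(* Moving the base point along with the increment is what makes the induction work. *)
Lemma increment_approx {R : realType} {E : normedModType R} (f : E -> R^o) (U : set E) (x : E)
    (I : Type) (r : seq I) (v : I -> E) (e : R) :
  open U -> U x ->
  (forall i y, U y -> derivable f y (v i)) ->
  (forall i, {for x, continuous ('D_(v i) f)}) -> 0 < e ->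
  exists2 d, 0 < d & forall y (c : I -> R), `|y - x| < d -> (forall i, `|c i| < d) ->
    `|f (\sum_(i <- r) c i *: v i + y) - f y - \sum_(i <- r) c i * 'D_(v i) f x|
      <= e * \sum_(i <- r) `|c i|.
Proof.
move=> oU Ux dU cD e0; elim: r => [|i r [d d0 IH]].
  exists 1 => // y c _ _; by rewrite !big_nil add0r !subrr normr0 mulr0.
have nU : nbhs x U by apply: open_nbhs_nbhs.
have nD : \forall y \near x, `|'D_(v i) f y - 'D_(v i) f x| <= e.
  by move/(_ i): cD => /cvgrPdist_le /(_ e e0); under eq_near do rewrite distrC.
have /nbhs_ballP [d1 /= d10 H1] : \forall y \near x, U y /\ `|'D_(v i) f y - 'D_(v i) f x| <= e.
  exact: filterI.
have v1 : 0 < `|v i| + 1 by rewrite ltr_wpDl.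
pose m := Num.min d d1.
have m0 : 0 < m by rewrite lt_min d0.
(* One half of [m] is reserved for the base point and one half for the step along [v i], so that the
   shifted base point is still admissible for the induction hypothesis; the summand 1 covers
   [v i = 0]. *)
pose d2 := Num.min (m / 2) (m / 2 / (`|v i| + 1)).
have d20 : 0 < d2 by rewrite lt_min !divr_gt0.
have d2m : d2 <= m / 2 by rewrite ge_min lexx.
have mb z s : `|z - x| < d2 -> `|s| < d2 -> `|s *: v i + z - x| < m.
  move=> zx sd; rewrite -addrA (le_lt_trans (ler_normD _ _)) // (splitr m).
  apply: ltr_leD; last by rewrite (le_trans (ltW zx)).
  rewrite normrZ.
  have sd' : `|s| < m / 2 / (`|v i| + 1) by rewrite (lt_le_trans sd) // ge_min lexx orbT.
  apply: (@le_lt_trans _ _ (`|s| * (`|v i| + 1))).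
    by rewrite ler_wpM2l // lerDl.
  by rewrite -ltr_pdivlMr.
exists d2 => // y c yx cd.
have m2 : m / 2 <= m by rewrite ler_pdivrMr // ler_peMr ?(ltW m0) // ler1n.
have yx' : `|y - x| < m by rewrite (lt_le_trans yx) // (le_trans d2m).
rewrite !big_cons.
have := IH (c i *: v i + y) c.
have -> : \sum_(j <- r) c j *: v j + (c i *: v i + y) =
          c i *: v i + \sum_(j <- r) c j *: v j + y by rewrite addrA [X in X + y]addrC.
have md : m <= d by rewrite ge_min lexx.
have md1 : m <= d1 by rewrite ge_min lexx orbT.
move=> /(_ (lt_le_trans (mb _ _ yx (cd i)) md)).
have cd' j : `|c j| < d.
  by rewrite (lt_le_trans (cd j)) // (le_trans d2m) // (le_trans _ md).
move=> /(_ cd') h1.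
have h2 : `|f (c i *: v i + y) - f y - c i * 'D_(v i) f x| <= e * `|c i|.
  apply: mean_value_line => s sc.
  have : ball x d1 (s *: v i + y).
    rewrite -ball_normE /= distrC (lt_le_trans _ md1) // mb // (le_lt_trans sc) //.
  by move=> /H1 [Uy ?]; split => //; apply: dU.
rewrite mulrDr (le_trans _ (lerD h2 h1)) // (le_trans _ (ler_normD _ _)) //.
rewrite le_eqVlt; apply/orP; left; apply/eqP; congr (`| _ |); ring.
Qed.

Lemma rV_expand {R : realType} {m : nat} (h : 'rV[R]_m) :
  h = \sum_(i <- enum 'I_m) h 0 i *: 'e_i.
Proof. by rewrite {1}[h]row_sum_delta big_enum. Qed.

Lemma rV_norm_coord {R : realType} {m : nat} (h : 'rV[R]_m.+1) i : `|h 0 i| <= `|h|.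
Proof.
rewrite [leRHS]/Num.norm /= mx_normrE.
by apply: le_trans (le_bigmax _ _ (0, i)).
Qed.

Lemma rV_norm_le {R : realType} {m : nat} (h : 'rV[R]_m.+1) (e : R) :
  (forall i, `|h 0 i| <= e) -> `|h| <= e.
Proof.
move=> H; rewrite /Num.norm /= mx_normrE; apply: bigmax_le => [|[i j] _].
  exact: le_trans (H 0).
by rewrite /= (ord1 i).
Qed.

Definition frechet {R : realType} {E F : normedModType R} (f : E -> F) (x : E) (D : E -> F) :=
  forall e, 0 < e -> exists2 d, 0 < d &
    forall h, `|h| < d -> `|f (h + x) - f x - D h| <= e * `|h|.

Lemma frechet_is_derive {R : realType} {E F : normedModType R} (f : E -> F) x D v :
  (forall c, D (c *: v) = c *: D v) -> frechet f x D -> is_derive x v f (D v).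
Proof.
move=> DZ fr.
suff H : (fun h : R => h^-1 *: (f (h *: v + x) - f x)) @ 0^' --> D v.
  by apply: DeriveDef; [apply/cvg_ex; exists (D v)|apply: cvg_lim].
apply/cvgrPdist_le => e e0.
have v0 : 0 < `|v| + 1 by rewrite ltr_wpDl.
have [d d0 H] := fr (e / (`|v| + 1)) (divr_gt0 e0 v0).
have : 0 < d / (`|v| + 1) by rewrite divr_gt0.
move=> dv; exists (d / (`|v| + 1)) => //= h /=; rewrite sub0r normrN => hd h0.
have hv : `|h *: v| < d.
  rewrite normrZ (@le_lt_trans _ _ (`|h| * (`|v| + 1))) ?ler_wpM2l ?lerDl //.
  by rewrite -ltr_pdivlMr.
have -> : D v - h^-1 *: (f (h *: v + x) - f x) =
          - (h^-1 *: (f (h *: v + x) - f x - D (h *: v))).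
  by rewrite DZ [in RHS]scalerBr [h^-1 *: (h *: _)]scalerA mulVf // scale1r opprB.
rewrite normrN normrZ normfV ler_pdivrMl ?normr_gt0 // (le_trans (H _ hv)) //.
by rewrite normrZ mulrCA ler_wpM2l // mulrAC ler_pdivrMr // ler_wpM2l ?(ltW e0) // lerDl.
Qed.

(** The linear map [L] assembled from the coordinate derivatives is a differential by
    [increment_approx]. It therefore computes every directional derivative, and linearity in the
    direction is inherited from [L]. *)
Lemma C1_frechet {R : realType} {m : nat} (f : 'rV[R]_m.+1 -> R^o) (U : set 'rV[R]_m.+1) x :
  open U -> U x ->
  (forall v y, U y -> derivable f y v) ->
  (forall v, {for x, continuous ('D_v f)}) ->
  frechet f x (fun h => 'D_h f x) /\
  (forall a u v, 'D_(a *: u + v) f x = a * 'D_u f x + 'D_v f x).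
Proof.
move=> oU Ux dU cD.
pose L (h : 'rV[R]_m.+1) : R := \sum_(i <- enum 'I_m.+1) h 0 i * 'D_('e_i) f x.
have Llin a u v : L (a *: u + v) = a * L u + L v.
  rewrite /L mulr_sumr -big_split /=; apply: eq_bigr => i _.
  by rewrite !mxE mulrDl mulrA.
have fr : frechet f x L.
  move=> e e0.
  have e1 : 0 < e / m.+1%:R by rewrite divr_gt0 // ltr0n.
  have [d d0 H] := @increment_approx R _ f U x _ (enum 'I_m.+1) (fun i => 'e_i) _ oU Ux
     (fun i y => dU _ y) (fun i => cD _) e1.
  exists d => // h hd; have := H x (fun i => h 0 i).
  rewrite subrr normr0 -rV_expand => /(_ d0 (fun i => le_lt_trans (rV_norm_coord h i) hd)).
  move=> /le_trans; apply; rewrite -mulrA ler_wpM2l ?(ltW e0) //.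
  rewrite ler_pdivrMl ?ltr0n // big_enum /=.
  apply: (@le_trans _ _ (\sum_(i < m.+1) `|h|)).
    by apply: ler_sum => i _; apply: rV_norm_coord.
  by rewrite sumr_const card_ord mulr_natl.
have L0 : L 0 = 0 by rewrite /L big1 // => i _; rewrite mxE mul0r.
have LZ v c : L (c *: v) = c *: L v.
  by have := Llin c v 0; rewrite addr0 L0 addr0.
have DL v : 'D_v f x = L v by apply: derive_val; apply: frechet_is_derive.
split; last by move=> a u v; rewrite !DL Llin.
by move=> e /fr [d d0 H]; exists d => // h /H; rewrite DL.
Qed.

(* Locked: unifying two unfolded directional derivatives is prohibitively slow. *)
HB.lock Definition ddir {R : realType} {m : nat} (f : 'rV[R]_m.+1 -> R) (v x : 'rV[R]_m.+1) : R :=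
  'D_v (f : _ -> R^o) x.

Section SmoothScalar.
Context {R : realType} {m : nat}.
Local Notation E := 'rV[R]_m.+1.
Implicit Types (f : E -> R^o) (U : set E).

Lemma smooth_onD U f v : smooth_on U f -> smooth_on U ('D_v f : E -> R^o).
Proof. by move=> s k; have [_ /(_ v) [_ h]] := s k.+1. Qed.

Lemma smooth_derivable U f v x : smooth_on U f -> U x -> derivable f x v.
Proof. by move=> s Ux; have [_ /(_ v) [h _]] := s 1%N; apply: h. Qed.

Lemma smooth_continuous U f x : smooth_on U f -> U x -> {for x, continuous f}.
Proof. by move=> s Ux; have [h _] := s 0%N; apply: h. Qed.

Lemma smooth_ddir U f v : smooth_on U f -> @smooth_on R E R^o U (ddir f v).
Proof.
move=> s; have -> : ddir f v = 'D_v f :> (E -> R) by apply/funext => x; rewrite unlock.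
exact: smooth_onD.
Qed.

Lemma smooth_C1 U f x : open U -> smooth_on U f -> U x ->
  frechet f x (fun h => ddir f h x : R^o) /\ (forall a u v, ddir f (a *: u + v) x = a * ddir f u x + ddir f v x).
Proof.
move=> oU s Ux; rewrite unlock; apply: (C1_frechet oU Ux).
- by move=> v y Uy; apply: smooth_derivable s Uy.
- by move=> v; apply: smooth_continuous (smooth_onD v s) Ux.
Qed.

Lemma smooth_frechet U f x : open U -> smooth_on U f -> U x ->
  frechet f x (fun h => ddir f h x : R^o).
Proof. by move=> oU s Ux; case: (smooth_C1 oU s Ux). Qed.

Lemma ddir_linear U f x : open U -> smooth_on U f -> U x ->
  forall a u v, ddir f (a *: u + v) x = a * ddir f u x + ddir f v x.
Proof. by move=> oU s Ux; case: (smooth_C1 oU s Ux). Qed.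

Lemma ddir0 f x : ddir f 0 x = 0.
Proof. by rewrite unlock; exact: derive0. Qed.

Lemma ddirD U f x u v : open U -> smooth_on U f -> U x ->
  ddir f (u + v) x = ddir f u x + ddir f v x.
Proof. by move=> oU s Ux; have := ddir_linear oU s Ux 1 u v; rewrite scale1r mul1r. Qed.

Lemma ddirZ U f x c v : open U -> smooth_on U f -> U x ->
  ddir f (c *: v) x = c * ddir f v x.
Proof. by move=> oU s Ux; have := ddir_linear oU s Ux c v 0; rewrite ddir0 !addr0. Qed.

Lemma ddir_is_derive U f x v : smooth_on U f -> U x ->
  is_derive x v f (ddir f v x : R^o).
Proof. by move=> s Ux; rewrite unlock; apply: derivableP; apply: smooth_derivable s Ux. Qed.

(** The mean value estimate is applied along [u] to y -> f (y + t v) - f y, whose derivative is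
    controlled by differentiability of [ddir f u] at [x]. The second difference itself is symmetric
    in [u] and [v], so exchanging them makes the mixed derivatives agree in [ddir_sym]. *)
Lemma second_difference U f x u v e : open U -> smooth_on U f -> U x -> 0 < e ->
  exists2 d, 0 < d & forall t : R, `|t| < d ->
   `|f (t *: u + x + t *: v) - f (t *: u + x) - (f (x + t *: v) - f x)
      - t * (t * ddir (ddir f u) v x)| <= e * `|t| * `|t|.
Proof.
move=> oU s Ux e0.
pose g : E -> R^o := ddir f u.
have sg : smooth_on U g by apply: smooth_ddir.
have C0 : 0 < `|u| + `|v| + 1 by rewrite ltr_wpDl // addr_ge0.
have e1 : 0 < e / (2 * (`|u| + `|v| + 1)) by rewrite divr_gt0 // mulr_gt0.
have [d d0 Hd] := smooth_frechet oU sg Ux e1.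
have /nbhs_ballP [d1 /= d10 H1] : nbhs x U by apply: open_nbhs_nbhs.
pose d2 := Num.min d d1 / (`|u| + `|v| + 1).
have d20 : 0 < d2 by rewrite divr_gt0 // lt_min d0.
exists d2 => // t td.
have small (a b : R) : `|a| <= `|t| -> `|b| <= `|t| ->
    [/\ `|a *: u + b *: v| <= `|t| * (`|u| + `|v| + 1),
    `|a *: u + b *: v| < d & U (a *: u + b *: v + x)].
  move=> ha hb.
  have h : `|a *: u + b *: v| <= `|t| * (`|u| + `|v| + 1).
    rewrite (le_trans (ler_normD _ _)) // !normrZ mulrDr mulr1 mulrDr ler_wpDr //.
    by rewrite lerD // ler_wpM2r.
  have h' : `|a *: u + b *: v| < Num.min d d1.
    by rewrite (le_lt_trans h) // -ltr_pdivlMr.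
  split => //; first by rewrite (lt_le_trans h') // ge_min lexx.
  apply: H1; rewrite -ball_normE /= distrC addrK (lt_le_trans h') // ge_min lexx orbT //.
pose F : E -> R^o := fun y => f (y + t *: v) - f y.
have /mean_value_line : forall a, `|a| <= `|t| -> derivable F (a *: u + x) u /\
    `|'D_u F (a *: u + x) - t * ddir g v x| <= e * `|t|.
  move=> a ha.
  have [h1 h2 h3] := small a 0 ha ltac:(by rewrite normr0).
  have [k1 k2 k3] := small a t ha (lexx _).
  rewrite scale0r addr0 in h1 h2 h3.
  have dshift : is_derive (a *: u + x) u (fun y => f (y + t *: v)) (g (a *: u + t *: v + x)).
    have E1 : (fun h : R => h^-1 *: (f (h *: u + (a *: u + x) + t *: v) - f (a *: u + x + t *: v))) =
              (fun h : R => h^-1 *: (f (h *: u + (a *: u + t *: v + x)) - f (a *: u + t *: v + x))).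
      apply/funext => h; rewrite -!addrA [x + t *: v]addrC //.
    have [dk dv] := ddir_is_derive u s k3.
    by apply: DeriveDef; [rewrite /derivable /= E1|rewrite /g -dv /derive /= E1].
  have dF : is_derive (a *: u + x) u F (g (a *: u + t *: v + x) - g (a *: u + x)).
    apply: is_deriveB; exact: ddir_is_derive s h3.
  split; first exact: ex_derive.
  rewrite derive_val.
  have A1 := Hd _ k2; have A2 := Hd _ h2.
  move: A1 A2; rewrite (ddir_linear oU sg Ux a u) !(ddirZ _ _ oU sg Ux) => A1 A2.
  have -> : g (a *: u + t *: v + x) - g (a *: u + x) - t * ddir g v x =
     (g (a *: u + t *: v + x) - g x - (a * ddir g u x + t * ddir g v x)) -
     (g (a *: u + x) - g x - a * ddir g u x).
    have alg (A B C D F' : R) : A - B - D = (A - C - (F' + D)) - (B - C - F') by ring.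
    exact: alg.
  rewrite (le_trans (ler_normB _ _)) // (le_trans (lerD A1 A2)) // -mulrDr.
  have bb := lerD k1 h1.
  rewrite (le_trans (ler_wpM2l (ltW e1) bb)) // le_eqVlt; apply/orP; left; apply/eqP.
  by field; rewrite gt_eqF.
by rewrite /F.
Qed.

Lemma ddir_sym U f x u v : open U -> smooth_on U f -> U x ->
  ddir (ddir f v) u x = ddir (ddir f u) v x.
Proof.
move=> oU s Ux; apply/eqP; rewrite -subr_eq0 -normr_le0; apply/ler_addgt0Pr => e e0.
rewrite add0r; have e2 : 0 < e / 2 by rewrite divr_gt0.
have [d1 d10 A] := second_difference u v oU s Ux e2.
have [d2 d20 B] := second_difference v u oU s Ux e2.
pose t := Num.min d1 d2 / 2.
have m0 : 0 < Num.min d1 d2 by rewrite lt_min d10.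
have t0 : 0 < t by rewrite divr_gt0.
have tm : `|t| < Num.min d1 d2 by rewrite gtr0_norm // /t; move: m0; lra.
have := A t (lt_le_trans tm _); have := B t (lt_le_trans tm _).
rewrite !ge_min !lexx orbT => /(_ isT) + /(_ isT).
rewrite (gtr0_norm t0); set a := ddir _ v x; set b := ddir _ u x.
rewrite [t *: u + x]addrC [t *: v + x]addrC [x + t *: v + t *: u]addrAC.
set P := f _; set Q := f (x + t *: u); set S := f (x + t *: v).
move=> h2 h1.
have tt : 0 < t * t by rewrite mulr_gt0.
rewrite -(ler_pM2r tt) -[X in _ * X](gtr0_norm tt) -normrM.
have -> : (b - a) * (t * t) = (P - Q - (S - f x) - t * (t * a)) - (P - S - (Q - f x) - t * (t * b)).
  have alg (A' B' P' Q' S' X T : R) : (B' - A') * (T * T) =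
    (P' - Q' - (S' - X) - T * (T * A')) - (P' - S' - (Q' - X) - T * (T * B')) by ring.
  exact: alg.
rewrite (le_trans (ler_normB _ _)) // (le_trans (lerD h1 h2)) //.
by rewrite le_eqVlt; apply/orP; left; apply/eqP; field.
Qed.

Lemma ddir2D U f x u v w : open U -> smooth_on U f -> U x ->
  ddir (ddir f (u + v)) w x = ddir (ddir f u) w x + ddir (ddir f v) w x.
Proof.
move=> oU s Ux; rewrite (ddir_sym w (u + v) oU s Ux) (ddir_sym w u oU s Ux) (ddir_sym w v oU s Ux).
exact: (ddirD _ _ oU (smooth_ddir w s) Ux).
Qed.

Lemma ddir2Z U f x c v w : open U -> smooth_on U f -> U x ->
  ddir (ddir f (c *: v)) w x = c * ddir (ddir f v) w x.
Proof.
move=> oU s Ux; rewrite (ddir_sym w (c *: v) oU s Ux) (ddir_sym w v oU s Ux).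
exact: (ddirZ _ _ oU (smooth_ddir w s) Ux).
Qed.

Lemma ddir_sum U f x (I : Type) (r : seq I) (c : I -> R) (v : I -> E) :
  open U -> smooth_on U f -> U x ->
  ddir f (\sum_(i <- r) c i *: v i) x = \sum_(i <- r) c i * ddir f (v i) x.
Proof.
move=> oU s Ux; elim: r => [|i r IH]; first by rewrite !big_nil ddir0.
by rewrite !big_cons (ddir_linear oU s Ux (c i)) IH.
Qed.

Lemma finite_delta (I : finType) (P : I -> E -> Prop) :
  (forall i, exists2 d : R, 0 < d & forall h, `|h| < d -> P i h) ->
  exists2 d : R, 0 < d & forall h, `|h| < d -> forall i, P i h.
Proof.
move=> H.
have /boolp.choice [d dP] : forall i, exists d : R, 0 < d /\ forall h, `|h| < d -> P i h.
  by move=> i; have [d d0 hd] := H i; exists d.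
exists (\big[Num.min/1]_i d i).
  by elim/big_ind: _ => // [a b a0 b0|i _]; [rewrite lt_min a0|case: (dP i)].
move=> h hd i; apply: (dP i).2; apply: (lt_le_trans hd).
by rewrite (bigD1 i) //= ge_min lexx.
Qed.

(** One use of the mean value theorem on f (t h + x) minus its quadratic polynomial leaves the
    first-order error of [ddir f h]. Expanding [h] in coordinates reduces this to finitely many
    functions, which makes the error uniform in the direction of [h]. *)
Lemma taylor2 U f x e : open U -> smooth_on U f -> U x -> 0 < e ->
  exists2 d, 0 < d & forall h, `|h| < d ->
    `|f (h + x) - f x - ddir f h x - ddir (ddir f h) h x / 2| <= e * `|h| ^+ 2.
Proof.
move=> oU s Ux e0.
have e1 : 0 < e / m.+1%:R by rewrite divr_gt0 // ltr0n.
pose P (i : 'I_m.+1) (h : E) := `|ddir f 'e_i (h + x) - ddir f 'e_i x -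
  ddir (ddir f 'e_i) h x| <= e / m.+1%:R * `|h|.
have [i|d d0 Hd] := @finite_delta 'I_m.+1 P.
  by have [d d0 H] := smooth_frechet oU (smooth_ddir 'e_i s) Ux e1; exists d.
have /nbhs_ballP [d1 /= d10 H1] : nbhs x U by apply: open_nbhs_nbhs.
exists (Num.min d d1) => [|h hd]; first by rewrite lt_min d0.
have small (t : R) : 0 <= t <= 1 -> `|t *: h| < d /\ U (t *: h + x).
  move=> /andP[t0 t1].
  have th : `|t *: h| < Num.min d d1.
    by rewrite normrZ ger0_norm // (le_lt_trans _ hd) // ler_piMl.
  split; first by rewrite (lt_le_trans th) // ge_min lexx.
  by apply: H1; rewrite -ball_normE /= distrC addrK (lt_le_trans th) // ge_min lexx orbT.
pose B := ddir (ddir f h) h x; pose D := ddir f h x.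
pose F : R -> R := fun t => f (t *: h + x) - t * D - t ^+ 2 * (B / 2).
pose F' t := ddir f h (t *: h + x) - D - t * B.
have dF (t : R) : 0 <= t <= 1 -> is_derive t 1 F (F' t).
  move=> t01; have [_ Ut] := small t t01.
  have d1' := is_derive_line (@ex_derive _ _ _ _ _ _ _ (ddir_is_derive h s Ut)).
  have Ed : ddir f h (t *: h + x) = 'D_h (f : E -> R^o) (t *: h + x) by rewrite ddir.unlock.
  have -> : F' t = 'D_h (f : E -> R^o) (t *: h + x) - D - t * B by rewrite /F' Ed.
  apply: is_derive_eq.
  have alg (X D' B' : R) : X - (t * 0 + D' * 1) - (t ^+ 2 * 0 + (B' / 2) * (t * 1 + t * 1)) = X - D' - t * B'.
    by field.
  exact: alg.
have [||t t01 FE] := @MVT R F F' 0 1 ltr01.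
- by move=> t; rewrite in_itv /= => /andP[/ltW t0 /ltW t1]; apply: dF; rewrite t0.
- apply: derivable_within_continuous => t; rewrite in_itv /= => t01.
  by apply: (@ex_derive _ _ _ _ _ _ _ (dF t t01)).
have {}t01 : 0 <= t <= 1.
  by move: t01; rewrite in_itv /= => /andP[/ltW -> /ltW ->].
have -> : f (h + x) - f x - D - B / 2 = F' t.
  move: FE; rewrite /F scale0r scale1r subr0 mulr1 add0r => <-.
  have alg (p q r b : R) : p - q - r - b = p - 1 * r - 1 ^+ 2 * b - (q - 0 * r - 0 ^+ 2 * b) by ring.
  exact: alg.
have [th Ut] := small t t01; have {}Hd := Hd _ th.
have Eh y : U y -> ddir f h y = \sum_(i <- enum 'I_m.+1) h 0 i * ddir f 'e_i y.
  by move=> Uy; rewrite {1}(rV_expand h) (ddir_sum _ _ _ oU s Uy).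
have EB : B = \sum_(i <- enum 'I_m.+1) h 0 i * ddir (ddir f 'e_i) h x.
  rewrite /B {1}(rV_expand h) (ddir_sym h _ oU s Ux) (ddir_sum _ _ _ oU (smooth_ddir h s) Ux).
  by apply: eq_bigr => i _; rewrite (ddir_sym h _ oU s Ux).
rewrite /F' /D !Eh // EB mulr_sumr -!sumrB (le_trans (ler_norm_sum _ _ _)) //.
rewrite (@le_trans _ _ (\sum_(i <- enum 'I_m.+1) `|h| * (e / m.+1%:R * `|h|))) //.
  apply: ler_sum => i _.
  have -> : h 0 i * ddir f 'e_i (t *: h + x) - h 0 i * ddir f 'e_i x - t * (h 0 i * ddir (ddir f 'e_i) h x)
    = h 0 i * (ddir f 'e_i (t *: h + x) - ddir f 'e_i x - ddir (ddir f 'e_i) (t *: h) x).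
    by rewrite (ddirZ t h oU (smooth_ddir _ s) Ux); ring.
  rewrite normrM ler_pM // ?rV_norm_coord // (le_trans (Hd i)) // ler_wpM2l ?(ltW e1) //.
  by rewrite normrZ; case/andP: t01 => t0 t1; rewrite ger0_norm // ler_piMl.
rewrite big_enum /= sumr_const card_ord -(mulr_natl (`|h| * _)) le_eqVlt; apply/orP; left; apply/eqP.
have kn : m.+1%:R != 0 :> R by rewrite pnatr_eq0.
by move: (m.+1%:R : R) kn => k kn; field.
Qed.

End SmoothScalar.

Lemma continuous_eq_on {R : realType} {E F : normedModType R} (f g : E -> F) (U : set E) x :
  open U -> U x -> (forall y, U y -> f y = g y) ->
  {for x, continuous g} -> {for x, continuous f}.
Proof.
move=> oU Ux fg /cvgrPdist_lt cg; apply/cvgrPdist_lt => e e0; rewrite (fg x Ux).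
have : \forall y \near x, U y by apply: open_nbhs_nbhs.
by move/(_ e e0): cg; apply: filterS2 => y h Uy; rewrite (fg y Uy).
Qed.

Section SmoothVector.
Context {R : realType} {m k : nat}.
Local Notation E := 'rV[R]_m.+1.
Local Notation F := 'rV[R]_k.+1.
Implicit Types (f : E -> F) (U : set E).

Lemma is_derive_coord f x v i : derivable f x v ->
  is_derive x v (fun y => f y 0 i : R^o) ('D_v f x 0 i).
Proof.
move=> df; apply: DeriveDef; first exact: (derivable_mxP f x v).1 df 0 i.
by rewrite derive_mx // mxE.
Qed.

Lemma smooth_vec_frechet U f x : open U -> smooth_on U f -> U x ->
  frechet f x (fun h => 'D_h f x) /\
  (forall a u v, 'D_(a *: u + v) f x = a *: 'D_u f x + 'D_v f x).
Proof.
move=> oU s Ux.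
have [_ dU] := s 1%N.
have dfi y v i : U y -> is_derive y v (fun y => f y 0 i : R^o) ('D_v f y 0 i).
  by move=> Uy; apply: is_derive_coord; apply: (dU v).1.
have C1 i : frechet (fun y => f y 0 i : R^o) x (fun h => 'D_h (fun y => f y 0 i : R^o) x) /\
  (forall a u v, 'D_(a *: u + v) (fun y => f y 0 i : R^o) x =
      a * 'D_u (fun y => f y 0 i : R^o) x + 'D_v (fun y => f y 0 i : R^o) x).
  apply: (C1_frechet oU Ux) => [v y Uy|v]; first by have [] := dfi y v i Uy.
  have Ec y : U y -> 'D_v (fun y => f y 0 i : R^o) y = 'D_v f y 0 i.
    by move=> Uy; have [] := dfi y v i Uy.
  have cD : {for x, continuous (fun y => 'D_v f y 0 i : R^o)}.
    apply: (@continuous_comp _ _ _ ('D_v f) (fun M : F => M 0 i)); last exact: coord_continuous.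
    by apply: (dU v).2.1.
  exact: continuous_eq_on oU Ux Ec cD.
have Dc v i : 'D_v f x 0 i = 'D_v (fun y => f y 0 i : R^o) x.
  by have [] := dfi x v i Ux.
split.
  move=> e e0.
  pose P (i : 'I_k.+1) (h : E) :=
    `|(f (h + x) 0 i : R^o) - f x 0 i - 'D_h (fun y => f y 0 i : R^o) x| <= e * `|h|.
  have [i|d d0 Hd] := @finite_delta R m 'I_k.+1 P.
    by have [d d0 H] := (C1 i).1 e e0; exists d.
  exists d => // h hd; apply: rV_norm_le => i.
  by rewrite !mxE Dc; apply: Hd.
move=> a u v; apply/rowP => i; have := (C1 i).2 a u v.
by rewrite -(Dc (a *: u + v)) -(Dc u) -(Dc v) => ->; rewrite !mxE.
Qed.

End SmoothVector.

HB.lock Definition vdir {R : realType} {m k : nat} (f : 'rV[R]_m.+1 -> 'rV[R]_k.+1) (v x : 'rV[R]_m.+1) :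
  'rV[R]_k.+1 := 'D_v f x.

Section VectorDerivative.
Context {R : realType} {m k : nat}.
Local Notation E := 'rV[R]_m.+1.
Variables (U : set E) (f : E -> 'rV[R]_k.+1) (x : E).
Hypotheses (oU : open U) (sf : smooth_on U f) (Ux : U x).

Lemma vdir_frechet : frechet f x (fun h => vdir f h x).
Proof. by rewrite vdir.unlock; case: (smooth_vec_frechet oU sf Ux). Qed.

Lemma vdir_linear a u v : vdir f (a *: u + v) x = a *: vdir f u x + vdir f v x.
Proof. by rewrite vdir.unlock; case: (smooth_vec_frechet oU sf Ux) => _; apply. Qed.

Lemma vdir0 : vdir f 0 x = 0.
Proof. by rewrite vdir.unlock; exact: derive0. Qed.

Lemma vdirZ a u : vdir f (a *: u) x = a *: vdir f u x.
Proof. by have := vdir_linear a u 0; rewrite vdir0 !addr0. Qed.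

Lemma vdir_sum (I : Type) (r : seq I) (c : I -> R) (v : I -> E) :
  vdir f (\sum_(i <- r) c i *: v i) x = \sum_(i <- r) c i *: vdir f (v i) x.
Proof.
elim: r => [|i r IH]; first by rewrite !big_nil vdir0.
by rewrite !big_cons vdir_linear IH.
Qed.

End VectorDerivative.

Lemma cvg_sum {R : realType} {T : Type} {F : set_system T} {FF : Filter F}
    (I : Type) (r : seq I) (f : I -> T -> R) (l : I -> R) :
  (forall i, f i x @[x --> F] --> l i) ->
  (\sum_(i <- r) f i x) @[x --> F] --> \sum_(i <- r) l i.
Proof.
move=> h; elim: r => [|i r IH].
  by rewrite big_nil; under eq_fun do rewrite big_nil; exact: cvg_cst.
rewrite big_cons; under eq_fun do rewrite big_cons.
by apply: cvgD; [exact: h|exact: IH].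
Qed.

(** * Level sets and extrema on compact sets *)

Section LevelSets.
Context {R : realType} {T : topologicalType} (g : T -> R).
Hypothesis cg : continuous g.

Lemma closed_level_eq c : closed [set x | g x = c].
Proof. by apply: (preimage_closed (D := [set c])); [move=> x _; exact: cg|exact: closed_eq]. Qed.

Lemma closed_level_le c : closed [set x | g x <= c].
Proof. by apply: (preimage_closed (D := [set t | t <= c])); [move=> x _; exact: cg|exact: closed_le]. Qed.

Lemma closed_level_ge c : closed [set x | c <= g x].
Proof. by apply: (preimage_closed (D := [set t | c <= t])); [move=> x _; exact: cg|exact: closed_ge]. Qed.

End LevelSets.

Lemma compact_max {R : realType} (T : topologicalType) (K : set T) (f : T -> R) : K !=set0 -> compact K ->
  (forall x, K x -> {for x, continuous f}) -> exists2 c, K c & forall x, K x -> f x <= f c.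
Proof.
move=> K0 cK cf; have [|c] := compact_EVT_max K0 cK (f := f).
  by apply: continuous_in_subspaceT => x; rewrite inE; exact: cf.
by rewrite inE => Kc cmax; exists c => // x Kx; apply: cmax; rewrite inE.
Qed.

(** Continuity is asked within [K] only, for the sake of functions such as [diff], which are
    meaningful on the null cone alone. *)
Lemma compact_min_within {R : realType} (T : topologicalType) (K : set T) (f : T -> R) : K !=set0 -> compact K ->
  (forall x, K x -> f y @[y --> within K (nbhs x)] --> f x) ->
  exists2 c, K c & forall x, K x -> f c <= f x.
Proof.
move=> K0 cK cf; have [|c] := compact_EVT_min K0 cK (f := f); first exact/subspace_continuousP.
by rewrite inE => Kc cmin; exists c => // x Kx; apply: cmin; rewrite inE.
Qed.

(** * Numerical estimates for the boundary expansion and for the barrier *)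

Section Arithmetic.
Context {R : realType}.
Implicit Types (c L x y : R).

Lemma twice_half_le c L : 0 < c -> L < 1 / 2 -> 2 * c * L <= c.
Proof. by move=> c0 L2; rewrite (mulrC 2) -mulrA ger_pMr //; move: L2; lra. Qed.

Lemma taylor_combine (T c1 c2 q1 q2 q3 q4 q5 M1 M2 k1 k2 k3 d Z X : R) :
  `|T| <= X / 2 -> `|c1| <= M2 * Z -> `|c2| <= M1 * Z ->
  `|q1| <= Z * k1 -> `|q2| <= Z * k2 -> `|q3| <= Z * k3 -> `|q4| <= Z * d -> `|q5| <= Z * d ->
  (2 * (M1 + M2) + (k1 + 2 * k2 + k3) + 2 * d) * Z <= X ->
  `|- T + 2^-1 * (2 * (c1 - c2) - (q1 - 2 * q2 + q3)) + 2^-1 * (q4 - q5)| <= X.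
Proof.
rewrite !ler_norml => /andP[? ?] /andP[? ?] /andP[? ?] /andP[? ?] /andP[? ?] /andP[? ?].
by move=> /andP[? ?] /andP[? ?] ?; apply/andP; split; lra.
Qed.

(** The last step of the second-order comparison: [x] stands for <v, v>, [y] for <b, v>, [L] for <b,
    z>, [f0] for the minimal value, [g] for the gap term, and [Q], [Q'] for the two quadratic forms.
    As S' <= S and Q' >= 0, both forms may be given the common factor 1 / (2 S). *)
Lemma barrier_form (c N CB S S' L x y f0 g Q Q' : R) : 0 < c -> 0 < N -> 0 < S -> 0 < S' ->
  S' <= S -> 0 < L -> L < 1 / 2 -> N * L < 1 -> 0 <= x -> 0 <= Q' ->
  - (c * (L + N * L ^+ 2)) <= f0 -> - (x / 4 * (c * (4 * (CB - 2)))) <= g ->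
  f0 * (x / 4) - c * (x / 4) * L + c * N * (y ^+ 2 - 3 * (x / 4) * L ^+ 2) + g <=
    (2 * S)^-1 * Q - (2 * S')^-1 * Q' ->
  Q' + 2 * S * c * N * y ^+ 2 <= Q + 2 * S * c * CB * x.
Proof.
move=> c0 N0 S0 S'0 SS L0 L2 NL x0 Q'0 f00 gz h.
have S2 : 0 < 2 * S by rewrite mulr_gt0.
have iS : (2 * S)^-1 * Q' <= (2 * S')^-1 * Q'.
  by rewrite ler_wpM2r // lef_pV2 ?posrE ?mulr_gt0 // ler_pM2l.
have h1 := ler_wpM2r x0 f00.
have h2 : N * L ^+ 2 <= L by rewrite expr2 mulrA ler_piMl // ltW.
have cx : 0 <= c * x by rewrite mulr_ge0 // ltW.
have h3 : c * x * (N * L ^+ 2) <= c * x * (1 / 2) by rewrite ler_wpM2l // (le_trans h2) // ltW.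
have h4 : c * x * L <= c * x * (1 / 2) by rewrite ler_wpM2l // ltW.
have : c * N * y ^+ 2 - c * CB * x <= (2 * S)^-1 * (Q - Q').
  by rewrite mulrBr; move: h gz iS h1 h3 h4 cx; lra.
by rewrite ler_pdivlMl //; lra.
Qed.

End Arithmetic.

(** * Lorentzian algebra *)

Section Lorentz.
Context {R : realType} {n : nat}.
Local Notation E := 'rV[R]_n.+2.
Implicit Types (x y z u v w m p a : E) (c : R).

Lemma lorC x y : lor x y = lor y x.
Proof. by rewrite /lor mulrC; congr (_ + _); apply: eq_bigr => i _; rewrite mulrC. Qed.

Lemma lorDl x y z : lor (x + y) z = lor x z + lor y z.
Proof.
rewrite /lor !mxE mulrDl opprD addrACA -big_split /=; congr (_ + _).
by apply: eq_bigr => i _; rewrite !mxE mulrDl.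
Qed.

Lemma lorZl c x z : lor (c *: x) z = c * lor x z.
Proof.
rewrite /lor !mxE mulrDr mulr_sumr mulrN mulrA; congr (_ + _).
by apply: eq_bigr => i _; rewrite !mxE mulrA.
Qed.

Lemma lorNl x z : lor (- x) z = - lor x z.
Proof. by rewrite -scaleN1r lorZl mulN1r. Qed.

Lemma lorDr x y z : lor z (x + y) = lor z x + lor z y.
Proof. by rewrite lorC lorDl !(lorC z). Qed.

Lemma lorZr c x z : lor z (c *: x) = c * lor z x.
Proof. by rewrite lorC lorZl !(lorC z). Qed.

Lemma lorNr x z : lor z (- x) = - lor z x.
Proof. by rewrite lorC lorNl !(lorC z). Qed.

Lemma lor0l x : lor 0 x = 0.
Proof. by rewrite -(scale0r 0) lorZl mul0r. Qed.

Lemma lor0r x : lor x 0 = 0.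
Proof. by rewrite lorC lor0l. Qed.

Definition lorE := (lorDl, lorDr, lorNl, lorNr, lorZl, lorZr, lor0l, lor0r).

Lemma lor_suml (I : Type) (r : seq I) (P : pred I) (f : I -> E) z :
  lor (\sum_(i <- r | P i) f i) z = \sum_(i <- r | P i) lor (f i) z.
Proof. by elim/big_rec2: _ => [|i y x _ <-]; rewrite lorE. Qed.

Lemma lor_sumr (I : Type) (r : seq I) (P : pred I) (f : I -> E) z :
  lor z (\sum_(i <- r | P i) f i) = \sum_(i <- r | P i) lor z (f i).
Proof. by rewrite lorC lor_suml; apply: eq_bigr => i _; rewrite lorC. Qed.

Lemma lor_bound x y : `|lor x y| <= n.+2%:R * `|x| * `|y|.
Proof.
rewrite /lor (le_trans (ler_normD _ _)) // normrN normrM.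
have -> : n.+2%:R = 1 + n.+1%:R :> R by rewrite -natr1 addrC.
rewrite !mulrDl mul1r lerD ?ler_pM ?rV_norm_coord //.
rewrite (le_trans (ler_norm_sum _ _ _)) //.
rewrite (@le_trans _ _ (\sum_(i < n.+1) `|x| * `|y|)) //.
  by apply: ler_sum => i _; rewrite normrM ler_pM ?rV_norm_coord.
by rewrite sumr_const card_ord -mulrA mulr_natl.
Qed.

Definition sp x y : R := \sum_(i < n.+1) x 0 (lift ord0 i) * y 0 (lift ord0 i).

Lemma lor_sp x y : lor x y = - (x 0 0 * y 0 0) + sp x y.
Proof. by []. Qed.

Lemma sp_ge0 x : 0 <= sp x x.
Proof. by apply: sumr_ge0 => i _; rewrite -expr2 sqr_ge0. Qed.

Lemma sp_CS x y : sp x y ^+ 2 <= sp x x * sp y y.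
Proof.
have spl (a b : R) : sp (a *: x + b *: y) (a *: x + b *: y)
   = a ^+ 2 * sp x x + 2 * a * b * sp x y + b ^+ 2 * sp y y.
  rewrite /sp !mulr_sumr -!big_split /=; apply: eq_bigr => i _; rewrite !mxE; ring.
have := sp_ge0 y; rewrite le_eqVlt => /orP[/eqP y0|y0]; last first.
  have := sp_ge0 (sp y y *: x + (- sp x y) *: y); rewrite spl => h.
  have : 0 <= sp y y * (sp x x * sp y y - sp x y ^+ 2) by move: h; nra.
  by rewrite pmulr_rge0 // subr_ge0.
have yi i : y 0 (lift ord0 i) = 0.
  have := y0; rewrite /sp => /esym/eqP.
  rewrite psumr_eq0 => [/allP /(_ i)|j _]; last by rewrite -expr2 sqr_ge0.
  by rewrite mem_index_enum mulf_eq0 orbb => /(_ isT) /eqP.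
by rewrite -y0 mulr0 /sp big1 ?expr0n // => i _; rewrite yi mulr0.
Qed.

Lemma coord_sp x i : x 0 (lift ord0 i) ^+ 2 <= sp x x.
Proof.
rewrite /sp (bigD1 i) //= expr2 lerDl; apply: sumr_ge0 => j _.
by rewrite -expr2 sqr_ge0.
Qed.

Lemma norm_sp x (c : R) : 0 <= c -> x 0 0 ^+ 2 <= c ^+ 2 -> sp x x <= c ^+ 2 -> `|x| <= c.
Proof.
move=> c0 h0 h1; apply: rV_norm_le => i.
rewrite -(@ler_pXn2r _ 2) ?nnegrE // real_normK ?num_real //.
by case: (unliftP ord0 i) => [j|] -> //; apply: le_trans (coord_sp _ _) h1.
Qed.

Lemma hyp_ge1 p : hyp p -> 1 <= p 0 0.
Proof.
case; rewrite lor_sp => h p0; have := sp_ge0 p => s0.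
by rewrite leNgt; apply/negP => h1; move: h s0; nra.
Qed.

(** Tangency says that p_0 v_0 equals the space product of [p] and [v], so Cauchy-Schwarz bounds v_0
    by the space part of [v]. The Lorentz product is thus definite on the tangent space, with a
    constant that depends on p_0 only. *)
Lemma tangent_norm p v : hyp p -> lor p v = 0 -> `|v| ^+ 2 <= p 0 0 ^+ 2 * lor v v.
Proof.
move=> hp pv; have p1 := hyp_ge1 hp; case: hp => pp p0.
have CS := sp_CS p v; have sv := sp_ge0 v.
move: pp pv; rewrite !lor_sp => pp pv.
have h1 : v 0 0 ^+ 2 * p 0 0 ^+ 2 <= (p 0 0 ^+ 2 - 1) * sp v v.
  have -> : v 0 0 ^+ 2 * p 0 0 ^+ 2 = sp p v ^+ 2.
    have -> : sp p v = p 0 0 * v 0 0 by move: pv; lra.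
    ring.
  have -> : p 0 0 ^+ 2 - 1 = sp p p by move: pp; lra.
  exact: CS.
have p2 : 0 < p 0 0 ^+ 2 by rewrite exprn_gt0.
have h2 : sp v v <= p 0 0 ^+ 2 * (- (v 0 0 * v 0 0) + sp v v) by move: h1; lra.
have h3 : v 0 0 ^+ 2 <= sp v v.
  rewrite -(ler_pM2r p2) (le_trans h1) // mulrC ler_wpM2l //; lra.
apply: le_trans h2.
rewrite -[leRHS]sqr_sqrtr // ler_pXn2r ?nnegrE ?sqrtr_ge0 //.
by apply: norm_sp; rewrite ?sqrtr_ge0 // sqr_sqrtr.
Qed.

Lemma tangent_ge0 p v : hyp p -> lor p v = 0 -> 0 <= lor v v.
Proof.
move=> hp pv; have := tangent_norm hp pv; have p1 := hyp_ge1 hp.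
have p2 : 0 < p 0 0 ^+ 2 by rewrite exprn_gt0 // (lt_le_trans _ p1).
by move=> h; rewrite -(pmulr_rge0 _ p2) (le_trans _ h) // sqr_ge0.
Qed.

Lemma tangent_eq0 p v : hyp p -> lor p v = 0 -> lor v v <= 0 -> v = 0.
Proof.
move=> hp pv v0; have := tangent_norm hp pv; have p1 := hyp_ge1 hp.
have p2 : 0 < p 0 0 ^+ 2 by rewrite exprn_gt0 // (lt_le_trans _ p1).
move=> h; apply/eqP; rewrite -normr_eq0 -sqrf_eq0 eq_le sqr_ge0 andbT (le_trans h) //.
by rewrite pmulr_rle0.
Qed.

Lemma tangent_CS p u v : hyp p -> lor p u = 0 -> lor p v = 0 ->
  lor u v ^+ 2 <= lor u u * lor v v.
Proof.
move=> hp pu pv; have v0 := tangent_ge0 hp pv.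
have [vz|vn] := eqVneq (lor v v) 0.
  have -> : v = 0 by apply: (tangent_eq0 hp pv); rewrite vz.
  by rewrite !lorE expr0n mulr0.
have vp : 0 < lor v v by rewrite lt_def vn.
have : lor p (lor v v *: u - lor u v *: v) = 0 by rewrite !lorE pu pv; ring.
move/(tangent_ge0 hp); rewrite !lorE (lorC v u) => h.
have : 0 <= lor v v * (lor u u * lor v v - lor u v ^+ 2) by move: h; lra.
by rewrite pmulr_rge0 // subr_ge0.
Qed.

(** The closed future cone without its apex, containing both the hyperboloid and the future null
    cone. *)
Definition causal x := lor x x <= 0 /\ 0 < x 0 0.

Definition null x := lor x x = 0 /\ 0 < x 0 0.

Lemma hyp_causal p : hyp p -> causal p.
Proof. by case=> pp p0; split; rewrite // pp lerN10. Qed.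

Lemma null_causal x : null x -> causal x.
Proof. by case=> xx x0; split; rewrite // xx. Qed.

(** Cauchy-Schwarz for the space parts, rewritten in terms of x_0 and <p, x>. No sign of x_0 is
    assumed, so the same inequality yields the sign of <p, x>, the norm bound, and the test for
    being future directed. *)
Lemma hyp_causal_ineq p x : hyp p -> lor x x <= 0 ->
  x 0 0 ^+ 2 + lor p x ^+ 2 <= 2 * p 0 0 * x 0 0 * - lor p x.
Proof.
move=> [pp p0] xx; have CS := sp_CS p x.
have [sx sy] : sp p p = p 0 0 ^+ 2 - 1 /\ sp x x <= x 0 0 ^+ 2.
  by split; [move: pp|move: xx]; rewrite lor_sp; nra.
have h : sp p x ^+ 2 <= (p 0 0 ^+ 2 - 1) * x 0 0 ^+ 2.
  apply: le_trans CS _; rewrite sx ler_wpM2l // -sx; exact: sp_ge0.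
have -> : lor p x = sp p x - p 0 0 * x 0 0 by rewrite lor_sp; ring.
move: h; nra.
Qed.

Lemma causal_lt0 p x : hyp p -> causal x -> lor p x < 0.
Proof.
move=> hp [xx x0]; have := hyp_causal_ineq hp xx; have [_ p0] := hp.
have : 0 < p 0 0 * x 0 0 by rewrite mulr_gt0.
have : 0 < x 0 0 ^+ 2 by rewrite exprn_gt0.
have := sqr_ge0 (lor p x); nra.
Qed.

Lemma causal_norm p x : hyp p -> causal x -> `|x| <= 2 * p 0 0 * - lor p x.
Proof.
move=> hp cx; have [xx x0] := cx; have [_ p0] := hp.
apply: (@le_trans _ _ (x 0 0)).
  by apply: norm_sp => //; [exact: ltW|move: xx; rewrite lor_sp; lra].
rewrite -(ler_pM2l x0); have := hyp_causal_ineq hp xx; have := sqr_ge0 (lor p x); lra.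
Qed.

Lemma causal_future p x : hyp p -> lor x x <= 0 -> lor p x < 0 -> causal x.
Proof.
move=> hp xx px; split => //; have := hyp_causal_ineq hp xx; have [_ p0] := hp.
have p2 : 0 < lor p x ^+ 2 by rewrite exprn_even_gt0 //= lt_eqF.
move=> h; rewrite ltNge; apply/negP => x0.
have : 2 * p 0 0 * x 0 0 * - lor p x <= 0.
  by rewrite -mulrA mulr_ge0_le0 // ?mulr_ge0 // ?(ltW p0) // mulr_le0_ge0 // oppr_ge0 ltW.
have := sqr_ge0 (x 0 0); lra.
Qed.

Lemma hyp_le p x : hyp p -> hyp x -> lor p x <= -1.
Proof.
move=> hp hx; have l0 := causal_lt0 hp (hyp_causal hx).
have [pp _] := hp; have [xx _] := hx.
have : lor p (x + lor p x *: p) = 0 by rewrite !lorE pp; ring.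
move/(tangent_ge0 hp); rewrite !lorE pp xx (lorC x p) => h.
nra.
Qed.

Lemma hyp_eq p x : hyp p -> hyp x -> -1 <= lor p x -> x = p.
Proof.
move=> hp hx l1; have l2 := hyp_le hp hx.
have l : lor p x = -1 by apply/eqP; rewrite eq_le l1 l2.
have [pp _] := hp; have [xx _] := hx.
have pz : lor p (x + lor p x *: p) = 0 by rewrite !lorE pp; ring.
have := tangent_eq0 hp pz.
rewrite !lorE pp xx (lorC x p) l => h.
have : x + -1 *: p = 0 by apply: h; lra.
by rewrite scaleN1r => /eqP; rewrite subr_eq0 => /eqP.
Qed.

Lemma null_normal p x v : hyp p -> null x -> lor p v = 0 -> lor v v = 1 ->
  `|lor x v| <= - lor p x.
Proof.
move=> hp hx pv vv; have l0 := causal_lt0 hp (null_causal hx).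
have [pp _] := hp; have [xx _] := hx.
have pz : lor p (x + lor p x *: p) = 0 by rewrite !lorE pp; ring.
have := tangent_CS hp pz pv; rewrite !lorE pv pp xx vv (lorC x p) => h.
rewrite -(@ler_pXn2r _ 2) ?nnegrE ?oppr_ge0 ?(ltW l0) // real_normK ?num_real // sqrrN.
move: h; lra.
Qed.

(* Since division by 0 gives 0, this is the identity when m = 0. *)
Definition refl m x := x - (2 * lor m x / lor m m) *: m.

Lemma reflD m x y : refl m (x + y) = refl m x + refl m y.
Proof. by rewrite /refl lorDr mulrDr mulrDl scalerDl opprD addrACA. Qed.

Lemma reflZ m c x : refl m (c *: x) = c *: refl m x.
Proof. by rewrite /refl lorZr scalerBr scalerA; congr (_ - _ *: _); ring. Qed.

Lemma refl_lor m x y : lor (refl m x) (refl m y) = lor x y.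
Proof.
rewrite /refl !lorE (lorC x m); have [->|h] := eqVneq (lor m m) 0.
  by rewrite invr0 !mulr0; ring.
by field.
Qed.

Lemma reflK m : involutive (refl m).
Proof.
move=> x; have [mm|mm] := eqVneq (lor m m) 0.
  by rewrite /refl mm invr0 !mulr0 !scale0r !subr0.
have hm : lor m (refl m x) = - lor m x by rewrite /refl !lorE; field.
by rewrite {1}/refl hm mulrN mulNr scaleNr opprK /refl subrK.
Qed.

Lemma refl_lorC m x y : lor (refl m x) y = lor x (refl m y).
Proof. by rewrite -(refl_lor m) reflK. Qed.

Lemma refl_perp m x : lor m x = 0 -> refl m x = x.
Proof. by move=> h; rewrite /refl h mulr0 mul0r scale0r subr0. Qed.

(** The second hypothesis rules out distinct vectors whose difference is null; for [x = y] the
    mirror vector is 0 and the reflection is the identity. *)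
Lemma refl_swap x y : lor x x = lor y y -> (lor (x - y) (x - y) = 0 -> x = y) ->
  refl (x - y) x = y.
Proof.
move=> e h; rewrite /refl; have [z|z] := eqVneq (lor (x - y) (x - y)) 0.
  by rewrite z invr0 mulr0 scale0r subr0 h.
have -> : 2 * lor (x - y) x / lor (x - y) (x - y) = 1.
  have -> : 2 * lor (x - y) x = lor (x - y) (x - y) by rewrite !lorE (lorC y x) e; ring.
  by rewrite divff.
by rewrite scale1r opprB addrC subrK.
Qed.

Definition timevec : E := 'e_0.
Definition spacevec (i : 'I_n.+1) : E := 'e_(lift ord0 i).

Lemma lor_timel x : lor timevec x = - x 0 0.
Proof.
rewrite /lor big1 ?addr0 => [|i _]; first by rewrite !mxE !eqxx mul1r.
by rewrite !mxE mul0r.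
Qed.

Lemma lor_spacel i x : lor (spacevec i) x = x 0 (lift ord0 i).
Proof.
rewrite /lor (bigD1 i) //= big1 ?addr0 => [|j ji]; rewrite !mxE ?eqxx ?mul0r ?oppr0 ?mul1r ?add0r //=.
by rewrite (inj_eq (@lift_inj _ ord0)) (negbTE ji) mul0r.
Qed.

Lemma hyp_time : hyp timevec.
Proof. by split; rewrite ?lor_timel !mxE !eqxx. Qed.

Lemma std_expand x : x = (- lor timevec x) *: timevec + \sum_i lor (spacevec i) x *: spacevec i.
Proof.
rewrite lor_timel opprK {1}[x]row_sum_delta big_ord_recl; congr (_ + _).
by apply: eq_bigr => i _; rewrite lor_spacel.
Qed.

(** Completeness is recorded as an expansion formula; the minus sign comes from <p, p> = -1. *)
Definition is_frame p (nu : E) (e : 'I_n -> E) :=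
  [/\ forall i, lor p (e i) = 0, forall i, lor nu (e i) = 0,
    forall i j, lor (e i) (e j) = (i == j)%:R &
    forall x, x = (- lor p x) *: p + lor nu x *: nu + \sum_i lor (e i) x *: e i].

(** The composite [Q] of two reflections carries the time vector to [p] and the first space vector
    to [v]; the images of the other basis vectors form the frame. *)
Lemma frame_exists p v : hyp p -> lor p v = 0 -> lor v v = 1 -> exists e, is_frame p v e.
Proof.
move=> hp pv vv; have [pp _] := hp.
have tt : lor timevec timevec = -1 := (hyp_time).1.
have R1 : refl (p - timevec) timevec = p.
  rewrite -[in RHS](reflK (p - timevec) p); congr refl; apply/esym/refl_swap; first by rewrite pp tt.
  rewrite !lorE pp tt (lorC timevec) => h; apply/esym/(hyp_eq hp hyp_time); lra.
pose w := refl (p - timevec) v; pose e1 := spacevec ord0.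
have e11 : lor e1 e1 = 1 by rewrite lor_spacel !mxE !eqxx.
have te1 : lor timevec e1 = 0 by rewrite lor_timel !mxE oppr0.
have tw : lor timevec w = 0 by rewrite /w -refl_lorC R1.
have ww : lor w w = 1 by rewrite /w refl_lor.
have R2 : refl (w - e1) w = e1.
  apply: refl_swap; first by rewrite ww e11.
  move=> h; apply/eqP; rewrite -subr_eq0; apply/eqP.
  by apply: (tangent_eq0 hyp_time); [rewrite lorDr lorNr tw te1 subrr|rewrite h].
have R2t : refl (w - e1) timevec = timevec.
  by apply: refl_perp; rewrite lorC lorDr lorNr tw te1 subrr.
pose Q x := refl (p - timevec) (refl (w - e1) x).
have QD x y : Q (x + y) = Q x + Q y by rewrite /Q !reflD.
have QZ c x : Q (c *: x) = c *: Q x by rewrite /Q !reflZ.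
have Q0 : Q 0 = 0 by rewrite -(scale0r 0) QZ !scale0r.
have Ql x y : lor (Q x) (Q y) = lor x y by rewrite /Q !refl_lor.
have Qt : Q timevec = p by rewrite /Q R2t R1.
have R2e : refl (w - e1) e1 = w by rewrite -{2}R2 reflK.
have Qe : Q e1 = v by rewrite /Q R2e /w reflK.
exists (fun i => Q (spacevec (lift ord0 i))); split.
- by move=> i; rewrite -Qt Ql lor_timel !mxE oppr0.
- by move=> i; rewrite -Qe Ql lor_spacel !mxE.
- move=> i j; rewrite Ql lor_spacel !mxE eqxx /=.
  by rewrite !(inj_eq (@lift_inj _ ord0)).
- move=> x; pose y := refl (w - e1) (refl (p - timevec) x).
  have Qy : Q y = x by rewrite /Q /y !reflK.
  have -> : lor p x = lor timevec y by rewrite -Qt -Qy Ql.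
  have -> : lor v x = lor e1 y by rewrite -Qe -Qy Ql.
  under eq_bigr => i _ do rewrite -{1}Qy Ql -QZ.
  have -> : \sum_i Q (lor (spacevec (lift ord0 i)) y *: spacevec (lift ord0 i)) =
    Q (\sum_i lor (spacevec (lift ord0 i)) y *: spacevec (lift ord0 i)).
    by elim/big_rec2: _ => [|i a b _ ->]; rewrite ?Q0 ?QD.
  rewrite -Qt -Qe -!QZ -!QD -addrA; have := std_expand y; rewrite big_ord_recl => <-.
  by rewrite Qy.
Qed.

End Lorentz.

(** * Symmetric matrices *)

Section Spectral.
Context {R : realType}.

Definition dot n (u v : 'rV[R]_n) : R := \sum_i u 0 i * v 0 i.

Lemma dotC n (u v : 'rV[R]_n) : dot u v = dot v u.
Proof. by apply: eq_bigr => i _; rewrite mulrC. Qed.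

Lemma dotDl n (u v w : 'rV[R]_n) : dot (u + v) w = dot u w + dot v w.
Proof. by rewrite /dot -big_split; apply: eq_bigr => i _; rewrite !mxE mulrDl. Qed.

Lemma dotZl n c (u w : 'rV[R]_n) : dot (c *: u) w = c * dot u w.
Proof. by rewrite /dot mulr_sumr; apply: eq_bigr => i _; rewrite !mxE mulrA. Qed.

Lemma dotNl n (u w : 'rV[R]_n) : dot (- u) w = - dot u w.
Proof. by rewrite -scaleN1r dotZl mulN1r. Qed.

Lemma dotDr n (u v w : 'rV[R]_n) : dot w (u + v) = dot w u + dot w v.
Proof. by rewrite dotC dotDl !(dotC w). Qed.

Lemma dotZr n c (u w : 'rV[R]_n) : dot w (c *: u) = c * dot w u.
Proof. by rewrite dotC dotZl !(dotC w). Qed.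

Lemma dotNr n (u w : 'rV[R]_n) : dot w (- u) = - dot w u.
Proof. by rewrite dotC dotNl !(dotC w). Qed.

Definition dotE := (dotDl, dotDr, dotNl, dotNr, dotZl, dotZr).

Lemma dot_mx n (u v : 'rV[R]_n) : dot u v = (u *m v^T) 0 0.
Proof. by rewrite /dot mxE; apply: eq_bigr => i _; rewrite !mxE. Qed.

Lemma dot_row m n (A B : 'M[R]_(m, n)) i j : dot (row i A) (row j B) = (A *m B^T) i j.
Proof. by rewrite /dot mxE; apply: eq_bigr => k _; rewrite !mxE. Qed.

Lemma dot_mulmx m n (u : 'rV[R]_m) (A : 'M[R]_(m, n)) v : dot (u *m A) v = dot u (v *m A^T).
Proof.
rewrite /dot; under eq_bigr => i _ do rewrite mxE mulr_suml.
rewrite exchange_big /=; apply: eq_bigr => i _; rewrite mxE mulr_sumr.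
by apply: eq_bigr => j _; rewrite !mxE -mulrA [A _ _ * _]mulrC.
Qed.

Lemma dot_ge0 n (u : 'rV[R]_n) : 0 <= dot u u.
Proof. by apply: sumr_ge0 => i _; rewrite -expr2 sqr_ge0. Qed.

Lemma dot_eq0 n (u : 'rV[R]_n) : dot u u = 0 -> u = 0.
Proof.
move=> /eqP; rewrite psumr_eq0 => [/allP h|i _]; last by rewrite -expr2 sqr_ge0.
apply/rowP => i; rewrite mxE; apply/eqP; rewrite -sqrf_eq0 expr2.
by apply: (implyP (h i _)); rewrite ?mem_index_enum.
Qed.

Lemma quad_continuous n (A : 'M[R]_n.+1) :
  continuous (fun u : 'rV[R]_n.+1 => dot (u *m A) u : R^o).
Proof.
move=> u.
have -> : (fun u : 'rV[R]_n.+1 => dot (u *m A) u : R^o) =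
   (fun u => \sum_j (\sum_k u 0 k * A k j) * u 0 j).
  by apply/funext => w; apply: eq_bigr => j _; rewrite !mxE.
have cc k : {for u, continuous (fun u : 'rV[R]_n.+1 => u 0 k : R^o)} by exact: coord_continuous.
apply: (@cvg_sum R _ (nbhs u) (nbhs_filter u)) => j; apply: cvgM; last exact: cc.
by apply: (@cvg_sum R _ (nbhs u) (nbhs_filter u)) => k; apply: cvgM; [exact: cc|exact: cvg_cst].
Qed.

Lemma rayleigh_max n (A : 'M[R]_n.+1) : A^T = A ->
  exists u : 'rV[R]_n.+1, exists l : R, [/\ dot u u = 1, u *m A = l *: u &
    forall v, dot (v *m A) v <= l * dot v v].
Proof.
move=> As; pose S := [set u : 'rV[R]_n.+1 | dot u u = 1].
have dotc : continuous (fun u : 'rV[R]_n.+1 => dot u u : R^o).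
  by move=> u; have := @quad_continuous n 1%:M u; under eq_fun do rewrite mulmx1.
have cS : compact S.
  apply: bounded_closed_compact; last exact: closed_level_eq.
  exists 1; split => // M M1 u /= u1; apply: rV_norm_le => i.
  rewrite (le_trans _ (ltW M1)) // -(@ler_pXn2r _ 2) ?nnegrE // expr1n real_normK ?num_real //.
  by rewrite -u1 /dot (bigD1 i) //= expr2 lerDl sumr_ge0 // => j _; rewrite -expr2 sqr_ge0.
have S0 : S !=set0.
  exists 'e_0; rewrite /S /= /dot (bigD1 ord0) //= big1 ?addr0 => [|i i0]; rewrite !mxE ?eqxx ?mulr1 //=.
  by rewrite (negbTE i0) mulr0.
have [u uS umax] := @EVT_max_rV R _ _ _ S0 cS (continuous_subspaceT (@quad_continuous n A)).
move: uS; rewrite inE => u1; pose l := dot (u *m A) u.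
have H v : dot (v *m A) v <= l * dot v v.
  have [v0|v0] := eqVneq (dot v v) 0.
    by rewrite v0 (dot_eq0 v0) mulr0 mul0mx /dot big1 // => i _; rewrite mxE mul0r.
  have vp : 0 < dot v v by rewrite lt_def v0 dot_ge0.
  pose c := (Num.sqrt (dot v v))^-1.
  have c2 : c * c = (dot v v)^-1 by rewrite -expr2 exprVn sqr_sqrtr ?dot_ge0.
  have /umax : c *: v \in S by rewrite inE /S /= dotZl dotZr mulrA c2 mulVf.
  by rewrite -scalemxAl dotZl dotZr mulrA c2 mulrC ler_pdivrMr.
exists u, l; split => //.
have As' v : dot (v *m A) u = dot (u *m A) v by rewrite dot_mulmx As dotC.
(* The form l dot - A is positive semidefinite and vanishes at u, so u lies in its kernel. *)
have B v t : 0 <= t * (2 * (l * dot u v - dot (u *m A) v)) + t ^+ 2 * (l * dot v v - dot (v *m A) v).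
  have := H (u + t *: v).
  rewrite mulmxDl -scalemxAl !dotE (dotC v u) u1 -/l As'; lra.
have eq0 v : dot (u *m A) v = l * dot u v.
  have := B v; set b := 2 * _; set c := _ - _ => h.
  suff : b = 0 by rewrite /b; lra.
  apply/eqP/contraT => b0.
  (* At this value of t the linear term outweighs the quadratic one, whatever the sign of [c], so
     nonnegativity fails unless b = 0. *)
  have := h (- b / (`|c| + 1)); have c1 : 0 < `|c| + 1 by rewrite ltr_wpDl.
  have -> : - b / (`|c| + 1) * b + (- b / (`|c| + 1)) ^+ 2 * c =
     - (b ^+ 2 / (`|c| + 1) ^+ 2) * (`|c| + 1 - c) by field; rewrite gt_eqF.
  have : 0 < b ^+ 2 / (`|c| + 1) ^+ 2 by rewrite divr_gt0 // exprn_even_gt0 // gt_eqF.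
  have := ler_norm c; nra.
apply/eqP; rewrite -subr_eq0; apply/eqP/dot_eq0.
by rewrite dotDl dotNl dotZl eq0 subrr.
Qed.

(** As with [refl], the convention for division by 0 makes this the identity when w = 0. *)
Definition householder n (w : 'rV[R]_n) : 'M[R]_n := 1%:M - (2 / dot w w) *: (w^T *m w).

Lemma mul_householder n (w u : 'rV[R]_n) :
  u *m householder w = u - (2 * dot u w / dot w w) *: w.
Proof.
rewrite /householder mulmxBr mulmx1 -scalemxAr mulmxA; congr (_ - _).
have -> : u *m w^T = (dot u w)%:M.
  by apply/matrixP => i j; rewrite !ord1 dot_mx [RHS]mxE eqxx.
by rewrite mul_scalar_mx scalerA; congr (_ *: _); ring.
Qed.

Lemma householder_sym n (w : 'rV[R]_n) : (householder w)^T = householder w.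
Proof. by rewrite /householder linearB /= trmx1 linearZ /= trmx_mul trmxK. Qed.

Lemma householder_invol n (w : 'rV[R]_n) : householder w *m householder w = 1%:M.
Proof.
apply/row_matrixP => i; rewrite !rowE mulmxA !mul_householder mulmx1.
set u := delta_mx _ _; have [w0|w0] := eqVneq (dot w w) 0.
  by rewrite w0 invr0 !mulr0 !scale0r !subr0.
have -> : dot (u - (2 * dot u w / dot w w) *: w) w = - dot u w by rewrite !dotE; field.
by rewrite mulrN mulNr scaleNr opprK subrK.
Qed.

Lemma householder_swap n (u e : 'rV[R]_n) : dot u u = 1 -> dot e e = 1 ->
  e *m householder (e - u) = u.
Proof.
move=> u1 e1; rewrite mul_householder.
have E : dot (e - u) (e - u) = 2 * dot e (e - u) by rewrite !dotE (dotC u e) u1 e1; ring.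
have [w0|w0] := eqVneq (dot (e - u) (e - u)) 0.
  by rewrite w0 invr0 mulr0 scale0r subr0; have /eqP := dot_eq0 w0; rewrite subr_eq0 => /eqP.
by rewrite -E divff // scale1r opprB addrC subrK.
Qed.

Lemma row_diag_mulmx m n (d : 'rV[R]_m) (A : 'M[R]_(m, n)) i :
  row i (diag_mx d *m A) = d 0 i *: row i A.
Proof. by apply/rowP => j; rewrite mul_diag_mx !mxE. Qed.

(** Induction by deflation: a Householder reflection takes a maximiser of the Rayleigh quotient to
    the first basis vector and splits off a 1 x 1 block. The largest eigenvalue comes first at every
    stage, hence the decreasing order. The rows of [P] are the eigenvectors. *)
Lemma spectral n (A : 'M[R]_n) : A^T = A ->
  exists P : 'M[R]_n, exists d : 'rV[R]_n,
  [/\ P *m P^T = 1%:M, P *m A = diag_mx d *m P &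
      forall i j : 'I_n, (i <= j)%N -> d 0 j <= d 0 i].
Proof.
elim: n A => [|n IH] A As.
  by exists 1%:M, 0; split; [rewrite trmx1 mulmx1|apply/matrixP => -[]|case].
have [u [l [u1 uA umax]]] := rayleigh_max As.
pose e : 'rV[R]_(1 + n) := row_mx 1%:M 0.
have e1 : dot e e = 1.
  rewrite dot_mx /e tr_row_mx mul_row_col trmx1 mulmx1 mul0mx addr0.
  by rewrite mxE eqxx.
pose H := householder (e - u).
have eH : e *m H = u by apply: householder_swap.
have HH : H *m H = 1%:M by apply: householder_invol.
have Ht : H^T = H by apply: householder_sym.
have uH : u *m H = e by rewrite -eH -mulmxA HH mulmx1.
pose B : 'M[R]_(1 + n) := H *m A *m H.
have Bt : B^T = B by rewrite /B !trmx_mul Ht As mulmxA.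
have eB : e *m B = l *: e by rewrite /B !mulmxA eH uA -scalemxAl uH.
have BE : B = block_mx l%:M 0 0 (drsubmx B).
  move: eB; rewrite -{1}(submxK B) /e mul_row_block !mul1mx !mul0mx !addr0.
  rewrite scale_row_mx scaler0 scalemx1 => /eq_row_mx [h1 h2].
  have h3 : dlsubmx B = 0 by rewrite -(trmxK (dlsubmx B)) trmx_dlsub Bt h2 trmx0.
  by rewrite -{1}(submxK B) h1 h2 h3.
have [|P [d [PP Pd ds]]] := IH (drsubmx B); first by rewrite trmx_drsub Bt.
pose P1 : 'M[R]_(1 + n) := block_mx 1%:M 0 0 P.
pose d1 : 'rV[R]_(1 + n) := row_mx l%:M d.
have P1P : P1 *m P1^T = 1%:M.
  rewrite /P1 tr_block_mx mulmx_block !trmx0 !mul0mx !mulmx0 !addr0 add0r trmx1 mulmx1 PP.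
  by rewrite -scalar_mx_block.
have P1B : P1 *m B = diag_mx d1 *m P1.
  rewrite BE /P1 /d1 diag_mx_row !mulmx_block !mul0mx !mulmx0 !mul1mx !addr0 !add0r Pd.
  by rewrite mulmx1; congr (block_mx _ _ _ _); apply/matrixP => i j; rewrite !ord1 !mxE eqxx.
have PH : (P1 *m H) *m (P1 *m H)^T = 1%:M by rewrite trmx_mul Ht mulmxA -(mulmxA P1) HH mulmx1.
have PA : (P1 *m H) *m A = diag_mx d1 *m (P1 *m H).
  by rewrite mulmxA -P1B /B -!mulmxA HH mulmx1.
have dl i : d1 0 i <= l.
  have rA : row i (P1 *m H) *m A = d1 0 i *: row i (P1 *m H).
    by rewrite -row_mul PA row_diag_mulmx.
  have i1 : (1%:M : 'M[R]_(1 + n)) i i = 1 by rewrite mxE eqxx.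
  by have := umax (row i (P1 *m H)); rewrite rA dotZl dot_row PH i1 !mulr1.
have d1s (i j : 'I_(1 + n)) : (i <= j)%N -> d1 0 j <= d1 0 i.
  case: (split_ordP i) => i' ->; case: (split_ordP j) => j' ->; last first.
  - by rewrite !row_mxEr leq_add2l; apply: ds.
  - by rewrite (ord1 j') /= leqn0.
  - move=> _; have -> : d1 0 (lshift n i') = l by rewrite row_mxEl (ord1 i') mxE eqxx.
    exact: dl.
  - by rewrite (ord1 i') (ord1 j').
by exists (P1 *m H), d1; split => // i j; apply: d1s.
Qed.

Lemma dot_parseval n (U : 'M[R]_n) (u : 'rV[R]_n) : U *m U^T = 1%:M ->
  \sum_i dot u (row i U) ^+ 2 = dot u u.
Proof.
move=> UU; have -> : dot u u = dot (u *m U^T) (u *m U^T).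
  by rewrite dot_mulmx trmxK -mulmxA (mulmx1C UU) mulmx1.
apply: eq_bigr => i _; rewrite expr2; congr (_ * _).
  by rewrite mxE; apply: eq_bigr => j _; rewrite !mxE.
by rewrite mxE; apply: eq_bigr => j _; rewrite !mxE.
Qed.

(* Courant-Fischer: the span of the first i + 1 rows of W meets the span of the rows of U
   from i on, because i linear conditions cannot kill an (i + 1)-dimensional space. *)
Lemma weyl n (U W : 'M[R]_n) (a b : 'I_n -> R) :
  U *m U^T = 1%:M -> W *m W^T = 1%:M ->
  (forall i j : 'I_n, (i <= j)%N -> a j <= a i) ->
  (forall i j : 'I_n, (i <= j)%N -> b j <= b i) ->
  (forall u, \sum_i b i * dot u (row i W) ^+ 2 <= \sum_i a i * dot u (row i U) ^+ 2) ->
  forall i, b i <= a i.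
Proof.
move=> UU WW as_ bs H i.
pose wi (k : 'I_i.+1) : 'I_n := widen_ord (ltn_ord i) k.
pose ui (k : 'I_i) : 'I_n := widen_ord (ltnW (ltn_ord i)) k.
pose M : 'M[R]_(i.+1, i) := \matrix_(k, l) dot (row (wi k) W) (row (ui l) U).
have : ~~ row_free M.
  by rewrite /row_free neq_ltn ltnS rank_leq_col.
rewrite -kermx_eq0 => /rowV0Pn [v vM v0].
have vM0 : v *m M = 0 by apply/sub_kermxP.
pose u : 'rV[R]_n := \sum_k v 0 k *: row (wi k) W.
have dW (j : 'I_n) : dot u (row j W) = \sum_k v 0 k * (wi k == j)%:R.
  rewrite /u; elim/big_rec2: _ => [|k x y _ <-]; first by rewrite /dot big1 // => l _; rewrite mxE mul0r.
  by rewrite dotDl dotZl dot_row WW mxE.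
have dWi k : dot u (row (wi k) W) = v 0 k.
  rewrite dW (bigD1 k) //= eqxx mulr1 big1 ?addr0 // => l lk.
  by have -> : (wi l == wi k) = (l == k) by []; rewrite (negbTE lk) mulr0.
have dW0 (j : 'I_n) : (i < j)%N -> dot u (row j W) = 0.
  move=> ij; rewrite dW big1 // => k _; have -> : (wi k == j) = false; last by rewrite mulr0.
  by apply/negbTE; rewrite -val_eqE /= neq_ltn (leq_trans (ltn_ord k)).
have dU0 (j : 'I_n) : (j < i)%N -> dot u (row j U) = 0.
  move=> ji; have := congr1 (fun A : 'rV[R]_i => A 0 (Ordinal ji)) vM0; rewrite !mxE => <-.
  rewrite /u; elim/big_rec2: _ => [|k x y _ <-]; first by rewrite /dot big1 // => l _; rewrite mxE mul0r.
  rewrite dotDl dotZl mxE; congr (_ * dot _ (row _ _) + _); exact: val_inj.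
have u0 : 0 < dot u u.
  rewrite lt_def dot_ge0 andbT; apply: contraNneq v0 => /dot_eq0 uz.
  by apply/eqP/rowP => k; rewrite -dWi uz mxE /dot big1 // => l _; rewrite mxE mul0r.
have h1 : b i * dot u u <= \sum_j b j * dot u (row j W) ^+ 2.
  rewrite -(dot_parseval u WW) mulr_sumr; apply: ler_sum => j _.
  have [ij|ji] := ltnP i j; first by rewrite dW0 // expr0n !mulr0.
  by rewrite ler_wpM2r ?sqr_ge0 // bs.
have h2 : \sum_j a j * dot u (row j U) ^+ 2 <= a i * dot u u.
  rewrite -(dot_parseval u UU) mulr_sumr; apply: ler_sum => j _.
  have [ji|ij] := ltnP j i; first by rewrite dU0 // expr0n !mulr0.
  by rewrite ler_wpM2r ?sqr_ge0 // as_.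
by rewrite -(ler_pM2r u0) (le_trans h1) // (le_trans (H u)).
Qed.

Lemma trace_form n (U : 'M[R]_n) (a : 'I_n -> R) : U *m U^T = 1%:M ->
  \sum_j \sum_i a i * dot 'e_j (row i U) ^+ 2 = \sum_i a i.
Proof.
move=> UU; rewrite exchange_big /=; apply: eq_bigr => i _; rewrite -mulr_sumr.
have -> : \sum_j dot 'e_j (row i U) ^+ 2 = dot (row i U) (row i U).
  apply: eq_bigr => j _; rewrite -expr2; congr (_ ^+ 2).
  rewrite /dot (bigD1 j) //= big1 ?addr0 => [|k kj]; rewrite !mxE ?eqxx ?mul1r //=.
  by rewrite (negbTE kj) mul0r.
by rewrite dot_row UU mxE eqxx mulr1.
Qed.

End Spectral.

(** * Elementary symmetric functions *)

Section ElementarySymmetric.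
Context {R : realType}.

(** The factors are changed one at a time; l <= 1 permits the uniform exponent [size r] instead of
    one less. *)
Lemma prod_diff_ge (T : Type) (r : seq T) (x y : T -> R) (l : R) : 0 < l -> l <= 1 ->
  (forall i, l <= x i) -> (forall i, x i <= y i) ->
  l ^+ size r <= \prod_(i <- r) y i /\
  l ^+ size r * (\sum_(i <- r) (y i - x i)) <= \prod_(i <- r) y i - \prod_(i <- r) x i.
Proof.
move=> l0 l1 lx xy; elim: r => [|a r [IH1 IH2]].
  by rewrite !big_nil /= expr0 subrr mulr0.
rewrite !big_cons /= exprS.
have ly := le_trans (lx a) (xy a).
split; first by rewrite ler_pM // ?exprn_ge0 // ltW.
move: IH1 IH2; set P := \prod_(i <- r) y i; set Q := \prod_(i <- r) x i.
set S := \sum_(i <- r) _; set k := l ^+ size r => IH1 IH2.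
have k0 : 0 < k by rewrite exprn_gt0.
have -> : y a * P - x a * Q = (y a - x a) * P + x a * (P - Q) by ring.
have -> : l * k * (y a - x a + S) = (y a - x a) * (l * k) + l * (k * S) by ring.
have S0 : 0 <= S by apply: sumr_ge0 => i _; rewrite subr_ge0.
apply: lerD.
  by rewrite ler_wpM2l ?subr_ge0 // (le_trans _ IH1) // ler_piMl // ltW.
by rewrite ler_pM // ?mulr_ge0 // ltW.
Qed.

Lemma prod_diff_le (T : Type) (r : seq T) (x y : T -> R) (K : R) : 1 <= K ->
  (forall i, 0 <= x i) -> (forall i, x i <= y i) -> (forall i, y i <= K) ->
  0 <= \prod_(i <- r) y i <= K ^+ size r /\
  \prod_(i <- r) y i - \prod_(i <- r) x i <= K ^+ size r * (\sum_(i <- r) (y i - x i)).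
Proof.
move=> K1 x0 xy yK; have K0 : 0 <= K by apply: le_trans K1.
elim: r => [|a r [/andP[IH0 IH1] IH2]].
  by rewrite !big_nil /= expr0 subrr mulr0 lexx ler01.
rewrite !big_cons /= exprS.
have y0 i : 0 <= y i := le_trans (x0 i) (xy i).
split; first by rewrite mulr_ge0 //= ler_pM.
move: IH0 IH1 IH2; set P := \prod_(i <- r) y i; set Q := \prod_(i <- r) x i.
set S := \sum_(i <- r) _; set k := K ^+ size r => IH0 IH1 IH2.
have k0 : 0 <= k by rewrite exprn_ge0.
have -> : y a * P - x a * Q = (y a - x a) * P + x a * (P - Q) by ring.
have -> : K * k * (y a - x a + S) = (y a - x a) * (K * k) + K * (k * S) by ring.
have S0 : 0 <= S by apply: sumr_ge0 => i _; rewrite subr_ge0.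
apply: lerD.
  by rewrite ler_wpM2l ?subr_ge0 // (le_trans IH1) // ler_peMl.
apply: (@le_trans _ _ (x a * (k * S))); first by rewrite ler_wpM2l.
by rewrite ler_wpM2r ?mulr_ge0 // (le_trans (xy a)).
Qed.

Variables (n k : nat).
Hypothesis hk : (1 <= k <= n)%N.

Let binpos : 0 < ('C(n, k))%:R :> R.
Proof. by rewrite ltr0n bin_gt0; case/andP: hk. Qed.

(** As 1 <= k <= n, each index lies in at least one subset of size k, and at most in all of them. *)
Lemma sum_subsets (d : 'I_n -> R) : (forall i, 0 <= d i) ->
  \sum_i d i <= \sum_(S : {set 'I_n} | #|S| == k) \sum_(i in S) d i <= 'C(n, k)%:R * \sum_i d i.
Proof.
move=> d0; have draws := card_draws 'I_n k; rewrite card_ord in draws.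
apply/andP; split.
  rewrite (exchange_big_dep predT) //=; apply: ler_sum => i _.
  have [A] : exists A, A \in [set A : {set 'I_n} | A \subset ~: [set i] & #|A| == k.-1].
    apply/set0Pn; rewrite -card_gt0 cards_draws cardsC1 card_ord bin_gt0.
    by move: hk; case: (n) (k) => [|n'] [|k'] //= /andP[].
  rewrite inE => /andP[/fintype.subsetP sA /eqP cA].
  have iA : i \notin A by apply/negP => /sA; rewrite !inE eqxx.
  have cS : #|i |: A| == k by rewrite cardsU1 iA cA add1n prednK //; case/andP: hk.
  rewrite (bigD1 (i |: A)) /= ?cS ?setU11 // lerDl.
  by apply: sumr_ge0.
apply: (@le_trans _ _ (\sum_(S : {set 'I_n} | #|S| == k) \sum_i d i)).
  apply: ler_sum => S _; rewrite big_mkcond /=; apply: ler_sum => i _.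
  by case: ifP.
rewrite sumr_const -[leLHS]mulr_natl le_eqVlt; apply/orP; left; apply/eqP.
congr (_%:R * _); rewrite -draws; apply: eq_card => S; by rewrite !inE.
Qed.

Lemma Ek_diff_ge (x y : 'I_n -> R) (l : R) : 0 < l -> l <= 1 ->
  (forall i, l <= x i) -> (forall i, x i <= y i) ->
  l ^+ k / 'C(n, k)%:R * (\sum_i (y i - x i)) <= Ek k y - Ek k x.
Proof.
move=> l0 l1 lx xy; rewrite /Ek -mulrBr -sumrB [X in X * _]mulrC -mulrA ler_pM2l ?invr_gt0 //.
have /andP[h _] := sum_subsets (fun i => eq_rect _ is_true (xy i) _ (esym (subr_ge0 _ _))).
apply: (@le_trans _ _ (l ^+ k * \sum_(S : {set 'I_n} | #|S| == k) \sum_(i in S) (y i - x i))).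
  by rewrite ler_wpM2l // exprn_ge0 // ltW.
rewrite mulr_sumr; apply: ler_sum => S /eqP Sk; rewrite -!big_enum -{1}Sk cardE.
by have [_] := prod_diff_ge (enum S) l0 l1 lx xy.
Qed.

Lemma Ek_diff_le (x y : 'I_n -> R) (K : R) : 1 <= K ->
  (forall i, 0 <= x i) -> (forall i, x i <= y i) -> (forall i, y i <= K) ->
  Ek k y - Ek k x <= K ^+ k * (\sum_i (y i - x i)).
Proof.
move=> K1 x0 xy yK; rewrite /Ek -mulrBr -sumrB ler_pdivrMl //.
have /andP[_ h] := sum_subsets (fun i => eq_rect _ is_true (xy i) _ (esym (subr_ge0 _ _))).
rewrite mulrCA; apply: (@le_trans _ _ (K ^+ k * \sum_(S : {set 'I_n} | #|S| == k) \sum_(i in S) (y i - x i))).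
  rewrite mulr_sumr; apply: ler_sum => S /eqP Sk; rewrite -!big_enum -{1}Sk cardE.
  by have [_] := prod_diff_le (enum S) K1 x0 xy yK.
by rewrite ler_wpM2l // exprn_ge0 // (le_trans _ K1).
Qed.

(* With [mu = 1 / x], the comparison of the quadratic forms bounds the sorted eigenvalues one by
   one (Weyl), and their sum strictly (trace); the gain A must beat the loss B. *)
Lemma Ek_compare (x y : 'I_n -> R) (U W : 'M[R]_n) (b : 'rV[R]_n) (l K A B : R) :
  0 < l -> l <= 1 -> 1 <= K -> 0 <= A -> 0 <= B ->
  (forall i, l <= x i <= K) -> (forall i, l <= y i <= K) ->
  (forall i j : 'I_n, (i <= j)%N -> x i <= x j) ->
  (forall i j : 'I_n, (i <= j)%N -> y i <= y j) ->
  U *m U^T = 1%:M -> W *m W^T = 1%:M -> 1 / 2 <= dot b b ->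
  (forall u, \sum_i dot u (row i W) ^+ 2 / y i + A * dot u b ^+ 2 <=
     \sum_i dot u (row i U) ^+ 2 / x i + B * dot u u) ->
  l ^+ k / 'C(n, k)%:R * (l ^+ 2 * A / 2) - (l ^+ k / 'C(n, k)%:R + K ^+ k) * (n%:R * (B * K ^+ 2))
    <= Ek k y - Ek k x.
Proof.
move=> l0 l1 K1 A0 B0 xr yr xs ys UU WW bb form.
have x0 i : 0 < x i by have /andP[h _] := xr i; apply: lt_le_trans h.
have y0 i : 0 < y i by have /andP[h _] := yr i; apply: lt_le_trans h.
(* The multiple [B] of the identity shifts every eigenvalue 1 / x of the larger form by [B]; Weyl's
   inequality then says that [d] is nonnegative. *)
pose d i := (x i)^-1 + B - (y i)^-1.
have d0 i : 0 <= d i.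
  rewrite subr_ge0; apply: (weyl UU WW (a := fun i => (x i)^-1 + B) (b := fun i => (y i)^-1)) => [{}i j ij|{}i j ij|u].
  - by rewrite lerD2r lef_pV2 ?posrE // xs.
  - by rewrite lef_pV2 ?posrE // ys.
  under eq_bigr => j _ do rewrite mulrC.
  under [leRHS]eq_bigr => j _ do rewrite mulrDl mulrC.
  rewrite big_split /= -mulr_sumr dot_parseval //; apply: le_trans (form u).
  by rewrite lerDl mulr_ge0 ?sqr_ge0.
have dsum : A / 2 <= \sum_i d i.
  have tr : \sum_i (y i)^-1 + A * dot b b <= \sum_i (x i)^-1 + n%:R * B.
    rewrite -(trace_form (fun i => (y i)^-1) WW) -(trace_form (fun i => (x i)^-1) UU).
    have -> : dot b b = \sum_j dot 'e_j b ^+ 2.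
      apply: eq_bigr => j _; rewrite -expr2; congr (_ ^+ 2).
      rewrite /dot (bigD1 j) //= big1 ?addr0 => [|i ij]; rewrite !mxE ?eqxx ?mul1r //=.
      by rewrite (negbTE ij) mul0r.
    have -> : n%:R * B = \sum_(j < n) B by rewrite sumr_const card_ord mulr_natl.
    rewrite mulr_sumr -!big_split /=; apply: ler_sum => j _; have := form 'e_j.
    have -> : dot 'e_j ('e_j : 'rV[R]_n) = 1.
      rewrite /dot (bigD1 j) //= big1 ?addr0 => [|i ij]; rewrite !mxE ?eqxx ?mul1r //=.
      by rewrite (negbTE ij) mul0r.
    by rewrite mulr1; under eq_bigr => i _ do rewrite mulrC;
       under [X in _ <= X + _ -> _]eq_bigr => i _ do rewrite mulrC.
  have -> : \sum_i d i = \sum_i (x i)^-1 + n%:R * B - \sum_i (y i)^-1.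
    by rewrite /d sumrB big_split /= sumr_const card_ord mulr_natl.
  have : A * (1 / 2) <= A * dot b b by rewrite ler_wpM2l.
  by move: tr; lra.
have yx i : y i - x i = (d i - B) * (x i * y i) by rewrite /d; field; rewrite !gt_eqF.
have xyK i : l ^+ 2 <= x i * y i <= K ^+ 2.
  have /andP[a1 a2] := xr i; have /andP[c1 c2] := yr i.
  by rewrite !expr2 !ler_pM // ltW.
(* [y] need not dominate [x] because of the loss [B]. Passing through the maximum separates the
   increase from [x] to [w], estimated from below, from the decrease from [w] to [y], estimated from
   above. *)
pose w i := Num.max (x i) (y i).
have xw i : x i <= w i by rewrite le_max lexx.
have yw i : y i <= w i by rewrite le_max lexx orbT.
have wK i : w i <= K by rewrite ge_max; have /andP[_ ->] := xr i; have /andP[_ ->] := yr i.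
have e1 := Ek_diff_ge l0 l1 (fun i => proj1 (andP (xr i))) xw.
have e2 := Ek_diff_le K1 (fun i => ltW (y0 i)) yw wK.
have s1 : l ^+ 2 * A / 2 - n%:R * (B * K ^+ 2) <= \sum_i (w i - x i).
  apply: (@le_trans _ _ (\sum_i (l ^+ 2 * d i - B * K ^+ 2))).
    have -> : n%:R * (B * K ^+ 2) = \sum_(i < n) (B * K ^+ 2) by rewrite sumr_const card_ord mulr_natl.
    rewrite sumrB lerD2r -mulr_sumr -mulrA.
    by rewrite ler_pM2l // exprn_gt0.
  apply: ler_sum => i _; apply: (@le_trans _ _ (y i - x i)); last by rewrite lerD2r.
  rewrite yx mulrBl; have /andP[a1 a2] := xyK i.
  by rewrite lerB // ?[d i * _]mulrC ?ler_wpM2r ?ler_wpM2l.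
have s2 : \sum_i (w i - y i) <= n%:R * (B * K ^+ 2).
  have -> : n%:R * (B * K ^+ 2) = \sum_(i < n) (B * K ^+ 2) by rewrite sumr_const card_ord mulr_natl.
  apply: ler_sum => i _; have /andP[a1 a2] := xyK i.
  have BK : B * (x i * y i) <= B * K ^+ 2 by rewrite ler_wpM2l.
  rewrite lerBlDr ge_max -!lerBlDr subrr -opprB yx mulrBl opprB.
  have dp : 0 <= d i * (x i * y i) by rewrite !mulr_ge0 // ltW.
  by rewrite mulr_ge0 ?sqr_ge0 // andbT (le_trans _ BK) // lerBlDr lerDl.
set c := l ^+ k / _ in e1 *; have c0 : 0 < c by rewrite divr_gt0 // exprn_gt0.
have K0 : 0 < K ^+ k by rewrite exprn_gt0 // (lt_le_trans _ K1).
have := ler_wpM2l (ltW c0) s1; have := ler_wpM2l (ltW K0) s2.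
by move: e1 e2; lra.
Qed.

End ElementarySymmetric.

(** * One-sided limits along curves *)

Section Limits.
Context {R : realType}.
Local Notation at0 := (0 : R)^'+.

Lemma at0_cvg0 : (fun t : R => t) @ at0 --> (0 : R).
Proof. exact: cvg_at_right_filter cvg_id. Qed.

Lemma lim_near_eq (f g : R -> R) (l l' : R) : f t @[t --> at0] --> l -> g t @[t --> at0] --> l' ->
  (\forall t \near at0, f t = g t) -> l = l'.
Proof.
move=> fl gl fg; apply: (cvg_unique _ (F := g @ at0)) => //.
by apply: cvg_trans fl; apply: near_eq_cvg; apply: filterS fg => t ->.
Qed.

Lemma near_at0 (d : R) : 0 < d -> \forall t \near at0, 0 < t < d.
Proof.
move=> d0; near=> t; apply/andP; split; near: t; first exact: nbhs_right_gt.
exact: nbhs_right_lt.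
Unshelve. all: by end_near. Qed.

Lemma cvg_coord {T : Type} {m : nat} (u : T -> 'rV[R]_m.+1) (l : 'rV[R]_m.+1) (F : set_system T) :
  Filter F -> (forall i, u t 0 i @[t --> F] --> l 0 i) -> u t @[t --> F] --> l.
Proof.
move=> FF h; apply/cvgrPdist_le => e e0.
have H i : \forall t \near F, `|l 0 i - u t 0 i| <= e.
  by have /cvgrPdist_le := h i; apply.
have : \forall t \near F, forall i : 'I_m.+1, `|l 0 i - u t 0 i| <= e.
  exact: filter_forall.
by apply: filterS => t ht; apply: rV_norm_le => i; rewrite !mxE.
Qed.

Lemma coord_cvg {T : Type} {m : nat} (u : T -> 'rV[R]_m.+1) (l : 'rV[R]_m.+1) (F : set_system T) i :
  Filter F -> u t @[t --> F] --> l -> u t 0 i @[t --> F] --> l 0 i.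
Proof.
move=> FF /cvgrPdist_le h; apply/cvgrPdist_le => e /h; apply: filterS => t; apply: le_trans.
by have := rV_norm_coord (l - u t) i; rewrite !mxE.
Qed.

Lemma lor_cvg {T : Type} {n : nat} (u v : T -> 'rV[R]_n.+2) (a b : 'rV[R]_n.+2) (F : set_system T) :
  Filter F -> u t @[t --> F] --> a -> v t @[t --> F] --> b ->
  lor (u t) (v t) @[t --> F] --> lor a b.
Proof.
move=> FF ua vb; rewrite /lor; apply: cvgD.
  by apply: cvgN; apply: cvgM; exact: coord_cvg.
by apply: cvg_sum => i; apply: cvgM; exact: coord_cvg.
Qed.

Lemma linear_cvg {T : Type} {m : nat} (D : 'rV[R]_m.+1 -> R) (u : T -> 'rV[R]_m.+1) l (F : set_system T) :
  Filter F -> (forall a x y, D (a *: x + y) = a * D x + D y) ->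
  u t @[t --> F] --> l -> D (u t) @[t --> F] --> D l.
Proof.
move=> FF Dl ul.
have D0 : D 0 = 0 by have := Dl (-1) 0 0; rewrite scaler0 addr0 mulN1r addNr.
have DE x : D x = \sum_(i <- enum 'I_m.+1) x 0 i * D 'e_i.
  rewrite {1}(rV_expand x); elim: (enum _) => [|i r IH]; first by rewrite !big_nil.
  by rewrite !big_cons Dl IH.
rewrite DE; under eq_fun do rewrite DE.
by apply: cvg_sum => i; apply: cvgM; [exact: coord_cvg|exact: cvg_cst].
Qed.

Lemma quotient_cvg {m : nat} (u : R -> 'rV[R]_m.+1) (p e : 'rV[R]_m.+1) :
  t^-1 *: (u t - p) @[t --> at0] --> e -> u t @[t --> at0] --> p.
Proof.
move=> h.
have h1 : (fun t : R => t *: (t^-1 *: (u t - p)) + p) @ at0 --> (0 : R) *: e + p.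
  by apply: cvgD; [apply: cvgZ => //; exact: at0_cvg0|exact: cvg_cst].
rewrite scale0r add0r in h1; apply: cvg_trans h1; apply: near_eq_cvg.
near=> t; rewrite scalerA divff ?scale1r ?subrK //; near: t; exact: nbhs_right_neq.
Unshelve. all: by end_near. Qed.

Lemma frechet_quotient {m : nat} {F : normedModType R} (f : 'rV[R]_m.+1 -> F) p D u e :
  frechet f p D -> (forall c x, D (c *: x) = c *: D x) ->
  t^-1 *: (u t - p) @[t --> at0] --> e ->
  D (t^-1 *: (u t - p)) @[t --> at0] --> D e ->
  t^-1 *: (f (u t) - f p) @[t --> at0] --> D e.
Proof.
move=> fr DZ ue De.
suff H : (fun t : R => t^-1 *: (f (u t) - f p) - D (t^-1 *: (u t - p))) @ at0 --> (0 : F).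
  have -> : (fun t : R => t^-1 *: (f (u t) - f p)) =
    (fun t => t^-1 *: (f (u t) - f p) - D (t^-1 *: (u t - p)) + D (t^-1 *: (u t - p))).
    by apply/funext => t; rewrite subrK.
  by rewrite -[D e]add0r; apply: cvgD.
have up := quotient_cvg ue.
apply/cvgrPdist_le => eps eps0.
have e1 : 0 < `|e| + 1 by rewrite ltr_wpDl.
have [d d0 Hd] := fr (eps / (`|e| + 1)) (divr_gt0 eps0 e1).
near=> t.
have t0 : 0 < t by near: t; exact: nbhs_right_gt.
have ud : `|u t - p| < d.
  by rewrite distrC; near: t; move/cvgrPdist_lt: up; apply.
have ub : `|t^-1 *: (u t - p)| <= `|e| + 1.
  near: t; have /cvgrPdist_le /(_ 1 ltr01) := ue; apply: filterS => s hs.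
  by rewrite -lerBlDl (le_trans _ hs) // distrC lerB_dist.
have := Hd _ ud; rewrite subrK => h.
rewrite sub0r normrN DZ -scalerBr normrZ (le_trans (ler_wpM2l (normr_ge0 _) h)) //.
rewrite mulrCA -normrZ (le_trans (ler_wpM2l _ ub)) ?divr_ge0 ?(ltW eps0) ?(ltW e1) //.
by rewrite divfK // gt_eqF.
Unshelve. all: by end_near. Qed.

Lemma smooth_quotient {m : nat} (U : set 'rV[R]_m.+1) (f : 'rV[R]_m.+1 -> R^o) p u e :
  open U -> smooth_on U f -> U p ->
  t^-1 *: (u t - p) @[t --> at0] --> e ->
  t^-1 * (f (u t) - f p) @[t --> at0] --> ddir f e p.
Proof.
move=> oU sf Up ue.
apply: (@frechet_quotient m R^o f p (fun h => ddir f h p) u e) => //.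
- exact: smooth_frechet oU sf Up.
- by move=> c x; rewrite (ddirZ c x oU sf Up).
- apply: (@linear_cvg _ m (fun h => ddir f h p) _ _ at0 _ _ ue) => a x y.
  exact: (ddir_linear oU sf Up).
Qed.

Lemma smooth_cvg {T : Type} {m : nat} (U : set 'rV[R]_m.+1) (f : 'rV[R]_m.+1 -> R^o) p (u : T -> 'rV[R]_m.+1) (F : set_system T) :
  Filter F -> smooth_on U f -> U p -> u t @[t --> F] --> p ->
  f (u t) @[t --> F] --> f p.
Proof. by move=> FF sf Up up; apply: continuous_cvg up; exact: smooth_continuous sf Up. Qed.

Lemma ddir_cvg {T : Type} {m : nat} (U : set 'rV[R]_m.+1) (f : 'rV[R]_m.+1 -> R^o) p (u : T -> 'rV[R]_m.+1) v w (F : set_system T) :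
  Filter F -> open U -> smooth_on U f -> U p -> u t @[t --> F] --> p ->
  w t @[t --> F] --> v ->
  ddir f (w t) (u t) @[t --> F] --> ddir f v p.
Proof.
move=> FF oU sf Up up wv.
have Uu : \forall t \near F, U (u t) by apply: up; apply: open_nbhs_nbhs.
have E x y : U y -> ddir f x y = \sum_(i <- enum 'I_m.+1) x 0 i * ddir f 'e_i y.
  by move=> Uy; rewrite {1}(rV_expand x) (ddir_sum _ _ _ oU sf Uy).
have H : (fun t => \sum_(i <- enum 'I_m.+1) w t 0 i * ddir f 'e_i (u t)) t @[t --> F] --> ddir f v p.
  rewrite (E v p Up); apply: cvg_sum => i; apply: cvgM; first exact: coord_cvg.
  exact: smooth_cvg (smooth_ddir 'e_i sf) Up up.
by apply: cvg_trans H; apply: near_eq_cvg; apply: filterS Uu => t Ut; rewrite (E _ _ Ut).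
Qed.

(** A second-order chain rule for curves of which only the initial velocity is known: the linear
    term stays as [ddir f (u t - p) p], and no acceleration of [u] enters. *)
Lemma smooth_quotient2 {m : nat} (U : set 'rV[R]_m.+1) (f : 'rV[R]_m.+1 -> R^o) p u e :
  open U -> smooth_on U f -> U p ->
  t^-1 *: (u t - p) @[t --> at0] --> e ->
  t^-1 ^+ 2 * (f (u t) - f p - ddir f (u t - p) p) @[t --> at0] --> ddir (ddir f e) e p / 2.
Proof.
move=> oU sf Up ue; have up := quotient_cvg ue.
pose B w := ddir (ddir f w) w p.
have EB w : B w = \sum_(i <- enum 'I_m.+1) w 0 i * ddir (ddir f 'e_i) w p.
  rewrite /B {1}(rV_expand w) (ddir_sym w _ oU sf Up) (ddir_sum _ _ _ oU (smooth_ddir w sf) Up).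
  by apply: eq_bigr => i _; rewrite (ddir_sym w _ oU sf Up).
have Bc : B (t^-1 *: (u t - p)) @[t --> at0] --> B e.
  rewrite EB; under eq_fun do rewrite EB.
  apply: cvg_sum => i; apply: cvgM; first exact: coord_cvg ue.
  apply: (@linear_cvg _ m (fun h => ddir (ddir f 'e_i) h p) _ _ at0 _ _ ue) => a x y.
  exact: (ddir_linear oU (smooth_ddir 'e_i sf) Up).
have H0 : t^-1 ^+ 2 * (f (u t) - f p - ddir f (u t - p) p) - B (t^-1 *: (u t - p)) / 2 @[t --> at0] --> (0 : R).
  apply/cvgrPdist_le => eps eps0.
  have e1 : 0 < (`|e| + 1) ^+ 2 by rewrite exprn_gt0 // ltr_wpDl.
  have [d d0 Hd] := taylor2 oU sf Up (divr_gt0 eps0 e1).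
  near=> t.
  have t0 : 0 < t by [].
  have ud : `|u t - p| < d.
    by rewrite distrC; near: t; move/cvgrPdist_lt: up; apply.
  have ub : `|t^-1 *: (u t - p)| <= `|e| + 1.
    near: t; have /cvgrPdist_le /(_ 1 ltr01) := ue; apply: filterS => s hs.
    by rewrite -lerBlDl (le_trans _ hs) // distrC lerB_dist.
  have := Hd _ ud; rewrite subrK => h.
  have -> : B (t^-1 *: (u t - p)) = t^-1 ^+ 2 * ddir (ddir f (u t - p)) (u t - p) p.
    rewrite /B (ddir2Z _ _ _ oU sf Up) (ddirZ _ _ oU (smooth_ddir _ sf) Up); ring.
  rewrite sub0r normrN -[t^-1 ^+ 2 * _ / 2]mulrA -mulrBr normrM.
  rewrite (le_trans (ler_wpM2l (normr_ge0 _) h)) //.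
  rewrite normrX mulrCA -exprMn -normrZ.
  rewrite -[X in _ <= X](divfK (lt0r_neq0 e1)).
  rewrite ler_wpM2l ?divr_ge0 ?(ltW eps0) ?(ltW e1) // ler_pXn2r ?nnegrE //.
have Bh : B (t^-1 *: (u t - p)) / 2 @[t --> at0] --> B e / 2.
  by apply: cvgM => //; exact: cvg_cst.
have H : t^-1 ^+ 2 * (f (u t) - f p - ddir f (u t - p) p) - B (t^-1 *: (u t - p)) / 2 +
   B (t^-1 *: (u t - p)) / 2 @[t --> at0] --> 0 + B e / 2 by apply: cvgD.
rewrite add0r in H; apply: cvg_trans H; apply: near_eq_cvg; near=> t; exact: subrK.
Unshelve. all: by end_near. Qed.

End Limits.

(** * Radial projection onto the hyperboloid *)

Section Normalize.
Context {R : realType} {n : nat}.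
Local Notation E := 'rV[R]_n.+2.
Local Notation at0 := (0 : R)^'+.
Implicit Types (x y z p b c : E).

Definition tlen x : R := Num.sqrt (- lor x x).
Definition nrm x : E := (tlen x)^-1 *: x.

Lemma tlen_gt0 x : lor x x < 0 -> 0 < tlen x.
Proof. by move=> xx; rewrite sqrtr_gt0 oppr_gt0. Qed.

Lemma tlen_sqr x : lor x x < 0 -> tlen x ^+ 2 = - lor x x.
Proof. by move=> xx; rewrite sqr_sqrtr // oppr_ge0 ltW. Qed.

Lemma nrm_hyp x : lor x x < 0 -> 0 < x 0 0 -> hyp (nrm x).
Proof.
move=> xx x0; have t0 := tlen_gt0 xx; have t2 := tlen_sqr xx; split; last by rewrite mxE mulr_gt0 ?invr_gt0.
by rewrite /nrm !lorE (_ : lor x x = - tlen x ^+ 2); [field; rewrite gt_eqF|rewrite t2 opprK].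
Qed.

Lemma nrm_id x : hyp x -> nrm x = x.
Proof. by case=> xx _; rewrite /nrm /tlen xx opprK sqrtr1 invr1 scale1r. Qed.

Lemma nrmZ (k : R) x : 0 < k -> nrm (k *: x) = nrm x.
Proof.
move=> k0; rewrite /nrm /tlen !lorE scalerA.
have -> : - (k * (k * lor x x)) = k ^+ 2 * - lor x x by ring.
rewrite sqrtrM ?sqr_ge0 // sqrtr_sqr gtr0_norm // invfM mulrAC mulVf ?mul1r //.
by rewrite gt_eqF.
Qed.

Lemma tlen_cvg {T : Type} (u : T -> E) x (F : set_system T) : Filter F -> u t @[t --> F] --> x ->
  tlen (u t) @[t --> F] --> tlen x.
Proof.
move=> FF ux; rewrite /tlen.
have h : - lor (u t) (u t) @[t --> F] --> - lor x x by apply: cvgN; exact: lor_cvg.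
exact: (continuous_cvg _ (@sqrt_continuous R _) h).
Qed.

Lemma nrm_cvg {T : Type} (u : T -> E) x (F : set_system T) : Filter F -> lor x x < 0 ->
  u t @[t --> F] --> x -> nrm (u t) @[t --> F] --> nrm x.
Proof.
move=> FF xx ux; apply: cvgZ => //; apply: cvgV; first by rewrite gt_eqF // tlen_gt0.
exact: tlen_cvg.
Qed.

Lemma nrm_lor x y : lor (nrm x) y = lor x y / tlen x.
Proof. by rewrite /nrm lorZl mulrC. Qed.

Section Curve.
Variables (p b c : E).
Hypothesis hp : hyp p.
Let P (t : R) : E := p + t *: b + t ^+ 2 *: c.

Let Pcvg (F : set_system R) : Filter F -> (t @[t --> F] --> (0 : R)) -> P t @[t --> F] --> p.
Proof.
move=> FF h; have -> : p = p + (0 : R) *: b + (0 : R) ^+ 2 *: c by rewrite expr0n !scale0r !addr0.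
apply: cvgD; first apply: cvgD; first exact: cvg_cst.
  by apply: cvgZ => //; exact: cvg_cst.
by apply: cvgZ; [rewrite !expr2; apply: cvgM|exact: cvg_cst].
Qed.

Lemma curve_cvg : P t @[t --> at0] --> p.
Proof. exact: Pcvg at0_cvg0. Qed.

Lemma curve_tlen_cvg : tlen (P t) @[t --> at0] --> (1 : R).
Proof.
have <- : tlen p = 1 by rewrite /tlen hp.1 opprK sqrtr1.
by apply: tlen_cvg; exact: curve_cvg.
Qed.

Lemma curve_timelike : \forall t \near at0, lor (P t) (P t) < 0 /\ 0 < P t 0 0.
Proof.
have h1 : lor (P t) (P t) @[t --> at0] --> (-1 : R).
  have [<- _] := hp; apply: lor_cvg; exact: curve_cvg.
have h2 : P t 0 0 @[t --> at0] --> p 0 0 by apply: coord_cvg; exact: curve_cvg.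
have [_ p0] := hp.
by near=> t; split; near: t; [exact: cvgr_lt h1 _ (ltrN10 R)|exact: cvgr_gt h2 _ p0].
Unshelve. all: by end_near. Qed.

(** Since 1 - tlen (P t)^2 is divisible by t, the quotient has a closed form without negative powers
    of t. The projection merely removes the component of [b] along [p], and the acceleration [c]
    disappears at first order. *)
Lemma curve_quotient : t^-1 *: (nrm (P t) - p) @[t --> at0] --> b + lor b p *: p.
Proof.
have [pp _] := hp.
have q t : 0 < t -> lor (P t) (P t) < 0 -> t^-1 *: (nrm (P t) - p) =
   (tlen (P t))^-1 *: (b + t *: c) +
   ((2 * lor b p + t * (lor b b + 2 * lor c p + 2 * t * lor b c + t ^+ 2 * lor c c)) /
    (tlen (P t) * (1 + tlen (P t)))) *: p.
  move=> t0 Pt; have l0 := tlen_gt0 Pt; have l2 := tlen_sqr Pt.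
  have E1 : 1 - tlen (P t) ^+ 2 =
     t * (2 * lor b p + t * (lor b b + 2 * lor c p + 2 * t * lor b c + t ^+ 2 * lor c c)).
    rewrite l2 /P !lorE pp (lorC p b) (lorC p c) (lorC c b); ring.
  have -> : 2 * lor b p + t * (lor b b + 2 * lor c p + 2 * t * lor b c + t ^+ 2 * lor c c) =
    (1 - tlen (P t) ^+ 2) / t by rewrite E1; field; rewrite gt_eqF.
  rewrite /nrm; move: (tlen (P t)) l0 {l2 E1} => l l0; rewrite /P.
  apply/rowP => i; rewrite !mxE; field.
  by rewrite !gt_eqF // addr_gt0.
have lc := curve_tlen_cvg.
have H : (tlen (P t))^-1 *: (b + t *: c) +
   ((2 * lor b p + t * (lor b b + 2 * lor c p + 2 * t * lor b c + t ^+ 2 * lor c c)) /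
    (tlen (P t) * (1 + tlen (P t)))) *: p @[t --> at0] -->
   (1 : R)^-1 *: (b + (0 : R) *: c) +
   ((2 * lor b p + 0 * (lor b b + 2 * lor c p + 2 * 0 * lor b c + 0 ^+ 2 * lor c c)) /
    (1 * (1 + 1))) *: p.
  have c0 := @at0_cvg0 R; have t2 : t ^+ 2 @[t --> at0] --> (0 : R) ^+ 2.
    by rewrite !expr2; apply: cvgM.
  apply: cvgD.
    apply: cvgZ; first by apply: cvgV => //; rewrite oner_eq0.
    by apply: cvgD; [exact: cvg_cst|apply: cvgZ => //; exact: cvg_cst].
  apply: cvgZ; last exact: cvg_cst.
  apply: cvgM; last first.
    apply: cvgV; first by rewrite mul1r gt_eqF.
    by apply: cvgM => //; apply: cvgD => //; exact: cvg_cst.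
  apply: cvgD; first exact: cvg_cst.
  apply: cvgM => //; apply: cvgD; last by apply: cvgM => //; exact: cvg_cst.
  apply: cvgD; first exact: cvg_cst.
  by apply: cvgM; [apply: cvgM => //; exact: cvg_cst|exact: cvg_cst].
have E : (1 : R)^-1 *: (b + (0 : R) *: c) +
   ((2 * lor b p + 0 * (lor b b + 2 * lor c p + 2 * 0 * lor b c + 0 ^+ 2 * lor c c)) /
    (1 * (1 + 1))) *: p = b + lor b p *: p.
  by apply/rowP => i; rewrite !mxE; field.
rewrite E in H; apply: cvg_trans H; apply: near_eq_cvg.
near=> t; rewrite q //; near: t.
by apply: filterS curve_timelike => t [].
Unshelve. all: by end_near. Qed.

End Curve.
End Normalize.

(** * The boundary of the domain *)

Section HypTopology.
Context {R : realType} {n : nat}.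
Local Notation E := 'rV[R]_n.+2.

Lemma lor_continuous (a : E) : continuous (fun x : E => lor a x).
Proof. by move=> x; apply: (lor_cvg (nbhs_filter x)); [exact: cvg_cst|exact: cvg_id]. Qed.

Lemma lor_sq_continuous : continuous (fun x : E => lor x x).
Proof. by move=> x; apply: (lor_cvg (nbhs_filter x)); exact: cvg_id. Qed.

Lemma hyp_closed : closed (@hyp R n).
Proof.
have -> : @hyp R n = [set x : E | lor x x = -1] `&` [set x | 1 <= x 0 0].
  apply/seteqP; split => x; first by move=> hx; split; [exact: hx.1|exact: hyp_ge1].
  by case=> /= h1 h2; split => //; apply: lt_le_trans h2.
apply: closedI; first exact: (closed_level_eq lor_sq_continuous).
by apply: (@closed_level_ge _ _ (fun x : E => x 0 0)) => x; exact: coord_continuous.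
Qed.

Lemma hdist_le (c x : E) M : hyp c -> hyp x -> hdist c x <= M -> - lor c x <= expR M.
Proof.
move=> hc hx; rewrite /hdist /arcosh; have l := hyp_le hc hx.
have t1 : 1 <= - lor c x by lra.
have s0 := sqrtr_ge0 ((- lor c x) ^+ 2 - 1).
move=> h; apply: (@le_trans _ _ (- lor c x + Num.sqrt ((- lor c x) ^+ 2 - 1))); first by rewrite lerDl.
rewrite -[leLHS]lnK; last by rewrite posrE; move: s0; lra.
by rewrite ler_expR.
Qed.

End HypTopology.

Section Domain.
Context {R : realType} {n : nat}.
Local Notation E := 'rV[R]_n.+2.
Local Notation at0 := (0 : R)^'+.
Variables (Omega : set E) (nu : E -> E).
Hypothesis Hdom : bounded_domain Omega.
Implicit Types (p q x y b c v : E) (f : E -> R^o) (U : set E).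

Lemma Omega_hyp x : Omega x -> hyp x.
Proof. by case: Hdom => _ [W oW ->] _ _ []. Qed.

Lemma Omega_open : exists2 W : set E, open W & forall x, hyp x -> (Omega x <-> W x).
Proof.
case: Hdom => _ [W oW ->] _ _; exists W => // x hx.
by split => [[]//|Wx]; split.
Qed.

Lemma closure_hyp x : closure Omega x -> hyp x.
Proof. by move=> cx; apply: hyp_closed; apply: closure_subset cx; exact: Omega_hyp. Qed.

Lemma bnd_hyp x : bnd Omega x -> hyp x.
Proof. by case=> cx _; apply: closure_hyp. Qed.

Lemma closure_cases x : closure Omega x -> Omega x \/ bnd Omega x.
Proof. by move=> cx; have [Ox|Ox] := pselect (Omega x); [left|right]. Qed.

Lemma Omega_bounded : exists K, 0 < K /\ forall x, closure Omega x -> `|x| <= K.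
Proof.
case: Hdom => _ _ _ [c hc [M HM]].
have cK : 0 < 2 * c 0 0 * expR M by case: hc => _ c0; rewrite !mulr_gt0 // expR_gt0.
exists (2 * c 0 0 * expR M); split => // x cx.
have cl : closed [set y : E | - lor c y <= expR M].
  apply: (@closed_level_le _ _ (fun y : E => - lor c y)) => y.
  by apply: continuousN; exact: lor_continuous.
have hx := closure_hyp cx.
rewrite (le_trans (causal_norm hc (hyp_causal hx))) // ler_wpM2l //.
  by case: hc => _ c0; rewrite mulr_ge0 // ltW.
apply: cl; apply: closure_subset cx => y Oy /=.
by apply: hdist_le (HM y Oy) => //; exact: Omega_hyp.
Qed.

Lemma closure_compact : compact (closure Omega).
Proof.
apply: bounded_closed_compact; last exact: closed_closure.
have [K [K0 HK]] := Omega_bounded; exists K; split; first exact: num_real.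
by move=> M KM x cx; apply: le_trans (HK x cx) (ltW KM).
Qed.

Lemma bnd_closed : closed (bnd Omega).
Proof.
have [W oW HW] := Omega_open.
have -> : bnd Omega = closure Omega `&` ~` W.
  apply/seteqP; split => x [cx nx]; split => //; first by rewrite /= -HW //; exact: closure_hyp.
  by move=> Wx; apply: nx; rewrite -HW //; exact: closure_hyp.
by apply: closedI; [exact: closed_closure|exact: open_closedC].
Qed.

Lemma bnd_compact : compact (bnd Omega).
Proof.
apply: (subclosed_compact bnd_closed closure_compact) => x; exact: proj1.
Qed.

Section LocalDefining.
Variables (f : E -> R^o) (U : set E).
Hypothesis oU : open U.
Hypothesis sf : smooth_on U f.
Hypothesis fO : forall x, U x -> hyp x -> (Omega x <-> f x < 0).

Lemma closure_f_le0 x : closure Omega x -> U x -> f x <= 0.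
Proof.
move=> cx Ux; rewrite leNgt; apply/negP => fx.
have cf : f y @[y --> x] --> f x by exact: smooth_continuous sf Ux.
have : \forall y \near x, 0 < f y /\ U y.
  near=> y; split; near: y; first exact: cvgr_gt cf _ fx.
  exact: open_nbhs_nbhs.
move/cx => [y [Oy [fy Uy]]].
have := (fO Uy (Omega_hyp Oy)).1 Oy; rewrite ltNge (ltW fy) //.
Unshelve. all: by end_near. Qed.

Lemma f_bnd q : bnd Omega q -> U q -> f q = 0.
Proof.
move=> bq Uq; have [cq nq] := bq; apply/eqP; rewrite eq_le closure_f_le0 //=.
by rewrite leNgt; apply/negP => fq; apply: nq; apply/(fO Uq) => //; exact: bnd_hyp bq.
Qed.

Hypothesis Hnu : unit_outward_normal Omega nu.
Definition rho q := ddir f (nu q) q.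

Lemma normal_props q : bnd Omega q -> lor q (nu q) = 0 /\ lor (nu q) (nu q) = 1.
Proof. by move=> bq; have [_ /(_ q bq) [h1 h2 _]] := Hnu. Qed.

Lemma local_defining_at q : U q -> (exists2 v, lor q v = 0 & ddir f v q != 0) ->
  local_defining Omega q f.
Proof.
move=> Uq [v qv fv]; exists U; split => //; exists v => //.
by move: fv; rewrite ddir.unlock.
Qed.

Lemma rho_gt0 q : bnd Omega q -> local_defining Omega q f -> 0 < rho q.
Proof.
by move=> bq lq; have [_ /(_ q bq) [_ _ /(_ f lq) [h _]]] := Hnu; rewrite /rho ddir.unlock.
Qed.

(** Tangent vectors in the kernel of df are orthogonal to [nu q]. Subtracting from [v] the multiple
    of [nu q] with the same derivative lands in that kernel, so df is [rho] times the product with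
    the normal. *)
Lemma ddir_normal q v : bnd Omega q -> U q -> local_defining Omega q f -> lor q v = 0 ->
  ddir f v q = rho q * lor v (nu q).
Proof.
move=> bq Uq lq qv; have r0 := rho_gt0 bq lq.
have [qn nn] := normal_props bq.
have [_ /(_ q bq) [_ _ /(_ f lq) [_ h]]] := Hnu.
pose w := v - (ddir f v q / rho q) *: nu q.
have E1 : ddir f w q = 0.
  rewrite /w -scaleNr addrC (ddir_linear oU sf Uq) -/(rho q) mulNr divfK ?addNr //.
  by rewrite gt_eqF.
have E2 : lor w (nu q) = 0.
  apply: h; last by rewrite -E1 ddir.unlock.
  by rewrite /htangent /= /w lorDr lorNr lorZr qv qn mulr0 subrr.
have : lor v (nu q) = ddir f v q / rho q.
  by apply/eqP; rewrite -subr_eq0 -E2 /w lorDl lorNl lorZl nn mulr1.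
by move=> ->; rewrite mulrCA divff ?mulr1 // gt_eqF.
Qed.

Lemma curve_f p b c : bnd Omega p -> U p -> local_defining Omega p f ->
  t^-1 * f (nrm (p + t *: b + t ^+ 2 *: c)) @[t --> at0] --> rho p * lor b (nu p).
Proof.
move=> bp Up lp; have hp := bnd_hyp bp; have [pn nn] := normal_props bp.
have -> : rho p * lor b (nu p) = ddir f (b + lor b p *: p) p.
  rewrite (ddir_normal bp Up lp) ?lorDl ?lorZl ?pn ?mulr0 ?addr0 // lorDr lorZr hp.1.
  by rewrite (lorC p b); ring.
have := smooth_quotient oU sf Up (curve_quotient (b := b) c hp).
by under eq_fun do rewrite (f_bnd bp Up) subr0.
Qed.

Lemma curve_U p b c : bnd Omega p -> U p ->
  \forall t \near at0, U (nrm (p + t *: b + t ^+ 2 *: c)) /\ hyp (nrm (p + t *: b + t ^+ 2 *: c)).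
Proof.
move=> bp Up; have hp := bnd_hyp bp.
have cq := quotient_cvg (curve_quotient (b := b) c hp).
near=> t; split; near: t; first by apply: cq; exact: open_nbhs_nbhs.
by apply: filterS (curve_timelike b c hp) => t [h1 h2]; exact: nrm_hyp.
Unshelve. all: by end_near. Qed.

End LocalDefining.

Hypothesis Hsm : smooth_boundary Omega.
Hypothesis Hnu : unit_outward_normal Omega nu.

Lemma inward_curve p b c : bnd Omega p -> lor b (nu p) < 0 ->
  \forall t \near at0, Omega (nrm (p + t *: b + t ^+ 2 *: c)).
Proof.
move=> bp bn; have [f lp] := Hsm bp; have [U [oU Up sf fO _]] := lp.
have r0 := rho_gt0 Hnu bp lp.
have h := curve_f oU sf fO Hnu (b := b) c bp Up lp.
have l0 : rho f p * lor b (nu p) < 0 by rewrite pmulr_rlt0.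
near=> t.
have [Ut ht] : U (nrm (p + t *: b + t ^+ 2 *: c)) /\ hyp (nrm (p + t *: b + t ^+ 2 *: c)).
  by near: t; exact: curve_U.
have t0 : 0 < t by [].
apply/(fO _ Ut ht); rewrite -(pmulr_rlt0 _ (_ : 0 < t^-1)) ?invr_gt0 //.
by near: t; exact: cvgr_lt h _ l0.
Unshelve. all: by end_near. Qed.

Lemma outward_curve p b c : bnd Omega p -> 0 < lor b (nu p) ->
  \forall t \near at0, ~ closure Omega (nrm (p + t *: b + t ^+ 2 *: c)).
Proof.
move=> bp bn; have [f lp] := Hsm bp; have [U [oU Up sf fO _]] := lp.
have r0 := rho_gt0 Hnu bp lp.
have h := curve_f oU sf fO Hnu (b := b) c bp Up lp.
have l0 : 0 < rho f p * lor b (nu p) by rewrite mulr_gt0.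
near=> t.
have [Ut ht] : U (nrm (p + t *: b + t ^+ 2 *: c)) /\ hyp (nrm (p + t *: b + t ^+ 2 *: c)).
  by near: t; exact: curve_U.
have t0 : 0 < t by [].
move=> /(closure_f_le0 oU sf fO) /(_ Ut); apply/negP; rewrite -ltNge.
rewrite -(pmulr_rgt0 _ (_ : 0 < t^-1)) ?invr_gt0 //.
by near: t; exact: cvgr_gt h _ l0.
Unshelve. all: by end_near. Qed.

(** For tangent [h] one has <p + h, p + h> = -1 + <h, h>, without linear term, so projecting [p + h]
    back to H moves it by a quadratic amount only. *)
Lemma nrm_approx p : hyp p -> exists2 C, 0 < C & forall h, lor p h = 0 ->
  n.+2%:R * `|h| ^+ 2 <= 2^-1 ->
  [/\ lor (p + h) (p + h) < 0, `|h| <= 1 & `|nrm (p + h) - (p + h)| <= C * `|h| ^+ 2].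
Proof.
move=> hp; have [pp p0] := hp.
have n1 : 1 <= n.+2%:R :> R by rewrite ler1n.
exists (n.+2%:R * (`|p| + 1)) => [|h ph hs]; first by rewrite mulr_gt0 ?ltr0n // ltr_wpDl.
have hh : `|lor h h| <= n.+2%:R * `|h| ^+ 2 by rewrite expr2 mulrA; exact: lor_bound.
have h1 : `|h| <= 1.
  rewrite leNgt; apply/negP => h1; have : 1 < `|h| ^+ 2 by rewrite expr2; nra.
  by move: hs n1; nra.
have l : lor (p + h) (p + h) = -1 + lor h h by rewrite !lorE pp ph (lorC h p) ph; ring.
have [hl hu] : - 2^-1 <= lor h h /\ lor h h <= 2^-1.
  by apply/andP; rewrite -ler_norml (le_trans hh).
have ll : lor (p + h) (p + h) < 0 by rewrite l; lra.
split => //; have t0 := tlen_gt0 ll; have t2 := tlen_sqr ll.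
have -> : nrm (p + h) - (p + h) = ((tlen (p + h))^-1 - 1) *: (p + h) by rewrite /nrm scalerBl scale1r.
rewrite normrZ mulrAC ler_pM //; last by rewrite (le_trans (ler_normD _ _)) // lerD2l.
apply: le_trans hh.
have q : (tlen (p + h))^-1 - 1 = lor h h / (tlen (p + h) * (1 + tlen (p + h))).
  have -> : lor h h = 1 - tlen (p + h) ^+ 2 by rewrite t2 l; ring.
  by field; rewrite !gt_eqF // addr_gt0.
have d1 : 1 <= tlen (p + h) * (1 + tlen (p + h)) by move: t2 t0; rewrite l; nra.
rewrite q normrM normfV ler_pdivrMr ?normr_gt0 ?gt_eqF ?(lt_le_trans _ d1) //.
by rewrite ler_peMr // (le_trans d1) // ler_norm.
Qed.

Lemma linear_bound (D : E -> R) : (forall a x y, D (a *: x + y) = a * D x + D y) ->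
  exists2 M, 0 < M & forall x, `|D x| <= M * `|x|.
Proof.
move=> Dl.
have D0 : D 0 = 0 by have := Dl (-1) 0 0; rewrite scaler0 addr0 mulN1r addNr.
have DE x : D x = \sum_(i <- enum 'I_n.+2) x 0 i * D 'e_i.
  rewrite {1}(rV_expand x); elim: (enum _) => [|i r IH]; first by rewrite !big_nil.
  by rewrite !big_cons Dl IH.
exists (\sum_(i <- enum 'I_n.+2) `|D 'e_i| + 1) => [|x].
  by rewrite ltr_wpDl // sumr_ge0.
rewrite DE (le_trans (ler_norm_sum _ _ _)) // mulrDl mul1r ler_wpDr // mulr_suml.
by apply: ler_sum => i _; rewrite normrM mulrC ler_wpM2l // rV_norm_coord.
Qed.

Lemma step_below (s d : R) : s < 1 -> 0 < d ->
  exists x : R, [/\ s < x, x <= 1 & x - s < d].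
Proof.
move=> s1 d0; exists (Num.min (s + d / 2) 1).
rewrite lt_min s1 andbT ltrDl divr_gt0 // ge_min lexx orbT; split => //.
have h : Num.min (s + d / 2) 1 <= s + d / 2 by rewrite ge_min lexx.
by move: h d0; lra.
Qed.

(** The supremum of the parameters at which the curve lies in [Omega] gives a point of the closure;
    were it in [Omega], openness would let the curve continue inside beyond the supremum. *)
Lemma crossing (c : R -> E) : (forall s, `|s| <= 1 -> c z @[z --> s] --> c s) ->
  (forall s, `|s| <= 1 -> hyp (c s)) -> Omega (c (-1)) -> ~ closure Omega (c 1) ->
  exists s, `|s| <= 1 /\ bnd Omega (c s).
Proof.
move=> cc hc O1 O2.
pose S := [set s : R | `|s| <= 1 /\ Omega (c s)].
have SN1 : S (-1) by split; [rewrite normrN normr1|].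
have Sub : has_sup S.
  split; first by exists (-1).
  by exists 1 => s [s1 _]; apply: le_trans (ler_norm s) s1.
have sub (x : R) : S x -> x <= sup S by apply: sup_upper_bound.
have s1 : `|sup S| <= 1.
  rewrite ler_norml sub //=.
  by apply: ge_sup; [exists (-1)|move=> x [x1 _]; apply: le_trans (ler_norm x) x1].
have adh (d : R) : 0 < d -> exists2 x, S x & sup S - d < x by move=> d0; exact: sup_adherent.
move: (sup S) s1 sub adh => s s1 sub adh; exists s; split => //.
have cs : closure Omega (c s).
  move=> B /(cc s s1) /nbhs_ballP [d /= dd Bd].
  have [x [x1 Ox] xs] := adh d dd.
  exists (c x); split => //; apply: Bd; rewrite -ball_normE /= ger0_norm ?subr_ge0.
    by rewrite ltrBlDr addrC -ltrBlDr.
  exact: sub.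
split; [exact: cs|move=> Os].
have [W oW HW] := Omega_open.
have Ws : nbhs (c s) W by apply: open_nbhs_nbhs; split; [exact: oW|exact: (HW (c s) (Omega_hyp Os)).1 Os].
move: (cc s s1 _ Ws) => /nbhs_ballP [d /= dd Wd].
have sl1 : s < 1.
  rewrite lt_neqAle; apply/andP; split; last by move: s1; rewrite ler_norml => /andP[].
  apply/eqP => s1'; apply: O2; apply: subset_closure; by rewrite -s1'.
have [x [sx xl1 xsd]] := step_below sl1 dd.
have x1 : `|x| <= 1.
  by rewrite ler_norml xl1 andbT; exact: le_trans (sub _ SN1) (ltW sx).
have Sx : S x.
  split; first exact: x1.
  apply: (HW (c x) (hc x x1)).2; apply: Wd; rewrite -ball_normE /= distrC gtr0_norm ?subr_gt0; last exact: sx.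
  exact: xsd.
by have := sub x Sx; rewrite leNgt sx.
Qed.

(* For each small t the segment from p + t (e - nu) to p + t (e + nu), projected to H, runs from
   inside Omega to outside its closure, so it crosses the boundary. *)
Lemma boundary_crossing p e : bnd Omega p -> lor p e = 0 ->
  lor e (nu p) = 0 -> \forall t \near at0, exists s, `|s| <= 1 /\
    bnd Omega (nrm (p + t *: (e + s *: nu p))).
Proof.
move=> bp pe en; have hp := bnd_hyp bp; have [pn nn] := normal_props Hnu bp.
have [C C0 HC] := nrm_approx hp.
have i1 : lor (e - nu p) (nu p) < 0 by rewrite lorDl lorNl en nn sub0r ltrN10.
have i2 : 0 < lor (e + nu p) (nu p) by rewrite lorDl en nn add0r.
have h1 := inward_curve 0 bp i1; have h2 := outward_curve 0 bp i2.
have d0 : 0 < (n.+2%:R * (`|e| + `|nu p| + 1) ^+ 2 * 2)^-1.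
  by rewrite invr_gt0 !mulr_gt0 ?ltr0n // exprn_gt0 // ltr_wpDl // addr_ge0.
near=> t.
have t0 : 0 < t by [].
have t1 : t < 1 by near: t; exact: nbhs_right_lt.
have td : t < (n.+2%:R * (`|e| + `|nu p| + 1) ^+ 2 * 2)^-1 by near: t; exact: nbhs_right_lt.
have O1 : Omega (nrm (p + t *: (e - nu p))).
  have : Omega (nrm (p + t *: (e - nu p) + t ^+ 2 *: 0)) by near: t; exact: h1.
  by rewrite scaler0 addr0.
have O2 : ~ closure Omega (nrm (p + t *: (e + nu p))).
  have : ~ closure Omega (nrm (p + t *: (e + nu p) + t ^+ 2 *: 0)) by near: t; exact: h2.
  by rewrite scaler0 addr0.
pose c (s : R) := nrm (p + t *: (e + s *: nu p)).
have tl s : `|s| <= 1 -> lor (p + t *: (e + s *: nu p)) (p + t *: (e + s *: nu p)) < 0.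
  move=> s1; have [] // := HC (t *: (e + s *: nu p)).
    by rewrite !lorE pe pn; ring.
  have b1 : `|t *: (e + s *: nu p)| <= t * (`|e| + `|nu p| + 1).
    rewrite normrZ gtr0_norm // ler_wpM2l ?(ltW t0) //.
    rewrite (le_trans (ler_normD _ _)) // -addrA lerD2l normrZ ler_wpDr //.
    by rewrite -[leRHS]mul1r ler_wpM2r.
  have b2 : `|t *: (e + s *: nu p)| ^+ 2 <= t * (`|e| + `|nu p| + 1) ^+ 2.
    have C1 : 0 <= t * (`|e| + `|nu p| + 1) by rewrite mulr_ge0 ?(ltW t0) // !addr_ge0.
    apply: (le_trans (y := (t * (`|e| + `|nu p| + 1)) ^+ 2)).
      by rewrite ler_pXn2r ?nnegrE.
    by rewrite exprMn ler_wpM2r ?sqr_ge0 // expr2 ler_piMl // ltW.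
  apply: le_trans (ler_wpM2l _ b2) _; first exact: ler0n.
  move: td; rewrite invfM ltr_pdivlMr // => td.
  rewrite mulrCA; move: td; rewrite -[X in _ < X]div1r ltr_pdivlMr; last first.
    by rewrite mulr_gt0 ?ltr0n // exprn_gt0 // ltr_wpDl // addr_ge0.
  set K := n.+2%:R * _; lra.
have cc s : `|s| <= 1 -> c z @[z --> s] --> c s.
  move=> s1; apply: (nrm_cvg (nbhs_filter s) (tl s s1)).
  apply: cvgD; first exact: cvg_cst.
  apply: cvgZ; first exact: cvg_cst.
  by apply: cvgD; [exact: cvg_cst|apply: cvgZ => //; exact: cvg_cst].
apply: (@crossing c); first exact: cc.
- move=> s s1; have lx := tl s s1; apply: (nrm_hyp lx).
  apply: (causal_future hp (ltW lx) _).2.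
  by rewrite !lorE hp.1 pe pn; lra.
- rewrite /c scaleN1r; exact: O1.
- rewrite /c scale1r; exact: O2.
Unshelve. all: by end_near. Qed.

(** This stands in for a parametrisation of the boundary: [q] is picked for each t separately and
    need not be continuous. The crossing points have the form e + s(t) nu with |s(t)| <= 1. Since
    [f] vanishes both there and at [p], its expansion leaves t s(t) rho as the only term not known
    to be o(t), which forces s(t) -> 0. *)
Lemma tangent_seq p e : bnd Omega p -> lor p e = 0 -> lor e (nu p) = 0 ->
  exists q : R -> E, (\forall t \near at0, bnd Omega (q t)) /\
    t^-1 *: (q t - p) @[t --> at0] --> e.
Proof.
move=> bp pe en; have hp := bnd_hyp bp; have [pn nn] := normal_props Hnu bp.
have [f lp] := Hsm bp; have [U [oU Up sf fO _]] := lp.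
have r0 := rho_gt0 Hnu bp lp.
have [C C0 HC] := nrm_approx hp.
have [M M0 HM] : exists2 M, 0 < M & forall x, `|ddir f x p| <= M * `|x|.
  by apply: linear_bound => a x y; exact: (ddir_linear oU sf Up).
pose Q t s := `|s| <= 1 /\ bnd Omega (nrm (p + t *: (e + s *: nu p))).
have /boolp.choice [s sP] : forall t, exists s, (exists s', Q t s') -> Q t s.
  by move=> t; have [[s Qs]|nQ] := pselect (exists s, Q t s); [exists s|exists 0].
pose q t := nrm (p + t *: (e + s t *: nu p)).
have cross := boundary_crossing bp pe en.
pose K := `|e| + `|nu p| + 1.
have K0 : 0 < K by rewrite ltr_wpDl // addr_ge0.
have Kn t : `|s t| <= 1 -> `|e + s t *: nu p| <= K.
  move=> s1; rewrite (le_trans (ler_normD _ _)) // /K -addrA lerD2l normrZ ler_wpDr //.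
  by rewrite -[leRHS]mul1r ler_wpM2r.
have rem : \forall t \near at0, [/\ `|s t| <= 1, bnd Omega (q t) &
    `|q t - p - t *: (e + s t *: nu p)| <= C * K ^+ 2 * t ^+ 2].
  have nK : 0 < n.+2%:R * K ^+ 2 by rewrite mulr_gt0 ?ltr0n // exprn_gt0.
  have d0 : 0 < 2^-1 / (n.+2%:R * K ^+ 2) by rewrite divr_gt0.
  near=> t; have t0 : 0 < t by [].
  have [s1 bq] : Q t (s t) by apply: sP; near: t.
  split => //; set h := t *: _.
  have hb : `|h| <= t * K by rewrite /h normrZ gtr0_norm // ler_wpM2l ?(ltW t0) // Kn.
  have h2 : `|h| ^+ 2 <= (t * K) ^+ 2 by rewrite ler_pXn2r ?nnegrE // mulr_ge0 // ltW.
  have [] := HC h; first by rewrite /h lorZr lorDr lorZr pe pn mulr0 addr0 mulr0.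
    apply: le_trans (ler_wpM2l (ler0n _ _) h2) _.
    have t1 : t <= 1 by near: t; exact: nbhs_right_le.
    have td : t <= 2^-1 / (n.+2%:R * K ^+ 2) by near: t; exact: nbhs_right_le.
    move: td; rewrite ler_pdivlMr // => td; apply: le_trans td.
    have -> : n.+2%:R * (t * K) ^+ 2 = t * (t * (n.+2%:R * K ^+ 2)) by ring.
    by rewrite ler_piMl // mulr_ge0 ?(ltW t0) ?(ltW nK).
  move=> _ _ h3; rewrite -addrA -opprD; apply: le_trans h3 _.
  by rewrite -mulrA -exprMn [K * t]mulrC ler_wpM2l // ltW.
have s_to_0 : s t @[t --> at0] --> (0 : R).
  apply/cvgrPdist_le => eps eps0.
  have B0 : 0 < K + C * K ^+ 2 by rewrite addr_gt0 // mulr_gt0 // exprn_gt0.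
  have e1 : 0 < rho f p * eps / 2 / (K + C * K ^+ 2) by rewrite !divr_gt0 // mulr_gt0.
  have [d dd Hd] := smooth_frechet oU sf Up e1.
  have MC : 0 < M * (C * K ^+ 2) by rewrite !mulr_gt0 // exprn_gt0.
  have /nbhs_ballP [d2 /= d20 Ud] : nbhs p U by apply: open_nbhs_nbhs.
  near=> t; have t0 : 0 < t by [].
  have t1 : t <= 1 by near: t; exact: nbhs_right_le.
  have [s1 bq hq] : [/\ `|s t| <= 1, bnd Omega (q t) &
    `|q t - p - t *: (e + s t *: nu p)| <= C * K ^+ 2 * t ^+ 2] by near: t.
  have qp : `|q t - p| <= t * (K + C * K ^+ 2).
    rewrite -[q t - p](subrK (t *: (e + s t *: nu p))) (le_trans (ler_normD _ _)) //.
    rewrite addrC mulrDr lerD //.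
      by rewrite normrZ gtr0_norm // ler_wpM2l ?(ltW t0) // Kn.
    have CK : 0 <= C * K ^+ 2 by rewrite mulr_ge0 ?(ltW C0) // exprn_ge0 // ltW.
    rewrite (le_trans hq) // mulrC ler_wpM2r //.
    by rewrite expr2 ler_piMl // ltW.
  have qd : `|q t - p| < d.
    apply: le_lt_trans qp _; rewrite -ltr_pdivlMr //; near: t; apply: nbhs_right_lt.
    by rewrite divr_gt0.
  have Uq : U (q t).
    apply: Ud; rewrite -ball_normE /= distrC; apply: le_lt_trans qp _.
    by rewrite -ltr_pdivlMr //; near: t; apply: nbhs_right_lt; rewrite divr_gt0.
  have := Hd _ qd; rewrite subrK (f_bnd oU sf fO bq Uq) (f_bnd oU sf fO bp Up) subrr sub0r normrN.
  set r := q t - p - t *: (e + s t *: nu p) in hq.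
  have -> : ddir f (q t - p) p = t * (s t * rho f p) + ddir f r p.
    rewrite -[q t - p](subrK (t *: (e + s t *: nu p))) -/r addrC.
    rewrite (ddir_linear oU sf Up) (ddirD _ _ oU sf Up) (ddirZ _ _ oU sf Up).
    by rewrite (ddir_normal oU sf Hnu bp Up lp pe) en mulr0 add0r.
  move=> h.
  have h1 : `|t * (s t * rho f p)| <= rho f p * eps / 2 * t + M * (C * K ^+ 2) * t ^+ 2.
    rewrite -[X in `|X|](addrK (ddir f r p)) (le_trans (ler_normB _ _)) // lerD //.
      apply: le_trans h _.
      apply: le_trans (ler_wpM2l (ltW e1) qp) _.
      by rewrite [t * _]mulrC mulrA divfK // gt_eqF.
    by apply: le_trans (HM r) _; rewrite -mulrA ler_wpM2l // ltW.
  rewrite sub0r normrN; move: h1; rewrite !normrM (gtr0_norm t0) (gtr0_norm r0).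
  have t2 : M * (C * K ^+ 2) * t <= rho f p * eps / 2.
    rewrite mulrC -ler_pdivlMr //; near: t; apply: nbhs_right_le.
    by rewrite !divr_gt0 // mulr_gt0.
  have -> : rho f p * eps / 2 * t + M * (C * K ^+ 2) * t ^+ 2 = t * (rho f p * eps / 2 + M * (C * K ^+ 2) * t) by ring.
  rewrite ler_pM2l // => h1.
  by rewrite -(ler_pM2r r0); move: h1 t2; lra.
exists q; split; first by near=> t; have [] : [/\ `|s t| <= 1, bnd Omega (q t) &
    `|q t - p - t *: (e + s t *: nu p)| <= C * K ^+ 2 * t ^+ 2] by near: t.
have H : t^-1 *: (q t - p - t *: (e + s t *: nu p)) + (e + s t *: nu p) @[t --> at0] --> 0 + (e + (0 : R) *: nu p).
  apply: cvgD; last first.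
    by apply: cvgD; [exact: cvg_cst|apply: cvgZ => //; exact: cvg_cst].
  apply/cvgrPdist_le => eps eps0.
  have CK : 0 < C * K ^+ 2 by rewrite mulr_gt0 // exprn_gt0.
  near=> t; have t0 : 0 < t by [].
  have [_ _ hq] : [/\ `|s t| <= 1, bnd Omega (q t) &
    `|q t - p - t *: (e + s t *: nu p)| <= C * K ^+ 2 * t ^+ 2] by near: t.
  rewrite sub0r normrN normrZ gtr0_norm ?invr_gt0 // ler_pdivrMl // (le_trans hq) //.
  rewrite expr2 mulrCA ler_wpM2l ?(ltW t0) //.
  by rewrite mulrC -ler_pdivlMr //; near: t; apply: nbhs_right_le; rewrite divr_gt0.
rewrite add0r scale0r addr0 in H; apply: cvg_trans H; apply: near_eq_cvg.
near=> t; have t0 : 0 < t by [].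
by rewrite scalerBr scalerA mulVf ?gt_eqF // scale1r subrK.
Unshelve. all: by end_near. Qed.

(* Differentiating df_q(v + <v, q> q) = rho(q) <nu(q), v> along the boundary expresses the
   second fundamental form through the Hessian of f; in particular it is symmetric. *)
Lemma second_relation p f U e v : bnd Omega p -> open U -> U p -> smooth_on U f ->
  (forall x, U x -> hyp x -> (Omega x <-> f x < 0)) -> local_defining Omega p f ->
  lor p e = 0 -> lor e (nu p) = 0 -> lor p v = 0 -> lor v (nu p) = 0 ->
  ddir (ddir f v) e p + lor v e * ddir f p p = rho f p * lor (vdir nu e p) v.
Proof.
move=> bp oU Up sf fO lp pe en pv vn; have hp := bnd_hyp bp.
have [pn nn] := normal_props Hnu bp; have r0 := rho_gt0 Hnu bp lp.
have [q [bq qe]] := tangent_seq bp pe en.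
have qp := quotient_cvg qe.
have [[V0 [oV bV sV]] _] := Hnu.
have Vp : V0 p by apply: bV.
have nq : t^-1 *: (nu (q t) - nu p) @[t --> at0] --> vdir nu e p.
  apply: (frechet_quotient (vdir_frechet oV sV Vp) _ qe) => [c x|]; first by rewrite (vdirZ oV sV Vp).
  apply: cvg_coord => i.
  apply: (@linear_cvg R _ n.+1 (fun x => vdir nu x p 0 i) _ _ at0 _ _ qe) => a x y.
  by rewrite (vdir_linear oV sV Vp) !mxE.
have nqp := quotient_cvg nq.
have nq0 : lor (nu p) (q t) @[t --> at0] --> (0 : R).
  have np0 : lor (nu p) p = 0 by rewrite lorC.
  by rewrite -[X in _ --> X]np0; exact: (lor_cvg _ (cvg_cst (nu p)) qp).
have wq : nu p + lor (nu p) (q t) *: q t @[t --> at0] --> nu p.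
  rewrite -[X in _ --> X]addr0 -(scale0r p); apply: cvgD; first exact: cvg_cst.
  exact: cvgZ.
have dq : ddir f (nu p + lor (nu p) (q t) *: q t) (q t) @[t --> at0] --> rho f p.
  exact: ddir_cvg oU sf Up qp wq.
have Uq : \forall t \near at0, U (q t) by apply: qp; exact: open_nbhs_nbhs.
(* The same [f] must be shown to be a defining function at [q t]: a tangent vector close to [nu p]
   has derivative close to [rho f p], hence nonzero. *)
have lq : \forall t \near at0, local_defining Omega (q t) f.
  near=> t; have bqt : bnd Omega (q t) by near: t.
  apply: (local_defining_at oU sf fO); first by near: t.
  exists (nu p + lor (nu p) (q t) *: q t).
    by rewrite lorDr lorZr (bnd_hyp bqt).1 (lorC (q t)); ring.
  by rewrite gt_eqF //; near: t; exact: cvgr_gt dq _ r0.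
have L1 : t^-1 * (ddir f v (q t) - ddir f v p) @[t --> at0] --> ddir (ddir f v) e p.
  exact: smooth_quotient oU (smooth_ddir v sf) Up qe.
have L2 : lor v (t^-1 *: (q t - p)) * ddir f (q t) (q t) @[t --> at0] --> lor v e * ddir f p p.
  apply: cvgM; first exact: (lor_cvg _ (cvg_cst v) qe).
  exact: (ddir_cvg _ oU sf Up qp qp).
have L3 : ddir f (nu (q t)) (q t) * lor (t^-1 *: (nu (q t) - nu p)) v @[t --> at0] -->
   rho f p * lor (vdir nu e p) v.
  apply: cvgM; first exact: ddir_cvg oU sf Up qp nqp.
  exact: (lor_cvg _ nq (cvg_cst v)).
have L : t^-1 * (ddir f v (q t) - ddir f v p) + lor v (t^-1 *: (q t - p)) * ddir f (q t) (q t)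
   @[t --> at0] --> ddir (ddir f v) e p + lor v e * ddir f p p by apply: cvgD.
apply: (cvg_unique _ L _); first exact: norm_hausdorff.
apply: cvg_trans L3; apply: near_eq_cvg; near=> t.
have t0 : t != 0 by rewrite gt_eqF.
have bqt : bnd Omega (q t) by near: t.
have Uqt : U (q t) by near: t.
have lqt : local_defining Omega (q t) f by near: t.
have [qn _] := normal_props Hnu bqt.
have := ddir_normal oU sf Hnu (v := lor v (q t) *: q t + v) bqt Uqt lqt.
rewrite (ddir_linear oU sf Uqt) lorDr lorZr (bnd_hyp bqt).1 (lorC (q t) v) mulrN1 addNr => /(_ erefl).
rewrite lorDl lorZl qn mulr0 add0r => h.
rewrite (ddir_normal oU sf Hnu bp Up lp pv) vn mulr0 subr0.
rewrite lorZr lorZl !lorDr lorDl lorNr lorNl (lorC v p) pv (lorC (nu p) v) vn !subr0.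
rewrite mulrCA (lorC _ v) -/(rho f (q t)) -h; ring.
Unshelve. all: by end_near. Qed.

(** * Eigenframes and the lower curvature bound *)

Hypothesis Hhc : uniformly_hconvex Omega nu.

Lemma is_frame_rotate p v (e : 'I_n -> E) (P : 'M[R]_n) : is_frame p v e -> P *m P^T = 1%:M ->
  is_frame p v (fun i => \sum_j P i j *: e j).
Proof.
move=> [pe ve ee ex] PP; split.
- by move=> i; rewrite lor_sumr big1 // => j _; rewrite lorZr pe mulr0.
- by move=> i; rewrite lor_sumr big1 // => j _; rewrite lorZr ve mulr0.
- move=> i j; have := congr1 (fun A : 'M[R]_n => A i j) PP; rewrite !mxE => <-.
  rewrite lor_suml; apply: eq_bigr => k _; rewrite lorZl lor_sumr (bigD1 k) //= big1 => [|l lk].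
    by rewrite lorZr ee eqxx mulr1 addr0 !mxE.
  by rewrite lorZr ee eq_sym (negbTE lk) mulr0.
- move=> x; rewrite {1}(ex x); congr (_ + _).
  under [RHS]eq_bigr => i _ do rewrite lor_suml scaler_sumr.
  rewrite exchange_big /=; apply: eq_bigr => j _.
  under eq_bigr => i _ do rewrite scalerA mulr_suml.
  rewrite -scaler_suml exchange_big /=; congr (_ *: _).
  have PP' := mulmx1C PP.
  have PPij k : \sum_i P i k * P i j = (k == j)%:R.
    have := congr1 (fun A : 'M[R]_n => A k j) PP'; rewrite !mxE => <-.
    by apply: eq_bigr => i _; rewrite !mxE.
  rewrite (bigD1 j) //= [X in _ + X]big1 => [|k kj].
    under eq_bigr => i _ do rewrite lorZl mulrAC.
    by rewrite -mulr_suml PPij eqxx mul1r addr0.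
  under eq_bigr => i _ do rewrite lorZl mulrAC.
  by rewrite -mulr_suml PPij (negbTE kj) mul0r.
Qed.

(** The left side of [second_relation] is symmetric in the two tangent vectors, so the second
    fundamental form is too, and the spectral theorem applies. The ordering of [kappa] is what
    Weyl's inequality will require. *)
Lemma eigenframe p : bnd Omega p -> exists e : 'I_n -> E, exists kappa : 'I_n -> R,
  [/\ is_frame p (nu p) e, principal_curvatures nu p kappa,
    forall i j, lor (vdir nu (e i) p) (e j) = kappa i * (i == j)%:R &
    forall i j : 'I_n, (i <= j)%N -> kappa i <= kappa j].
Proof.
move=> bp; have hp := bnd_hyp bp; have [pn nn] := normal_props Hnu bp.
have [f lp] := Hsm bp; have [U [oU Up sf fO _]] := lp.
have r0 := rho_gt0 Hnu bp lp.
have [[V0 [oV bV sV]] _] := Hnu; have Vp : V0 p by apply: bV.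
have [e ef] := frame_exists hp pn nn; have [pe ne ee ex] := ef.
(* The sign turns the decreasing order given by [spectral] into an increasing order of the
   curvatures. *)
pose A : 'M[R]_n := \matrix_(i, j) - lor (vdir nu (e i) p) (e j).
have As : A^T = A.
  apply/matrixP => i j; rewrite !mxE; congr (- _).
  have en k : lor (e k) (nu p) = 0 by rewrite lorC.
  have h1 := second_relation bp oU Up sf fO lp (pe i) (en i) (pe j) (en j).
  have h2 := second_relation bp oU Up sf fO lp (pe j) (en j) (pe i) (en i).
  apply: (mulfI (lt0r_neq0 r0)); rewrite -h1 -h2.
  by rewrite (ddir_sym (e j) (e i) oU sf Up) (lorC (e i)).
have [P [d [PP Pd ds]]] := spectral As.
pose e' i := \sum_j P i j *: e j; pose kappa i := - d 0 i.
have ef' := is_frame_rotate ef PP.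
have ev i j : lor (vdir nu (e' i) p) (e' j) = kappa i * (i == j)%:R.
  have -> : lor (vdir nu (e' i) p) (e' j) = - (P *m A *m P^T) i j.
    rewrite /e' -big_enum (vdir_sum oV sV Vp) big_enum lor_suml mxE -sumrN.
    under [RHS]eq_bigr => k _ do rewrite !mxE mulr_suml -sumrN.
    rewrite exchange_big /=; apply: eq_bigr => k _; rewrite lorZl lor_sumr mulr_sumr.
    by apply: eq_bigr => l _; rewrite lorZr !mxE; ring.
  by rewrite Pd -mulmxA PP mulmx1 mxE /kappa mulrnAr mulr1 mulNrn.
exists e', kappa; split => //.
- exists e'.
    split; last by have [_ _ h _] := ef'.
    move=> i; split; first by have [h _ _ _] := ef'; exact: h.
    by have [_ h _ _] := ef'; rewrite lorC h.
  have -> : second_ff nu p e' = diag_mx (\row_i kappa i).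
    apply/matrixP => i j; rewrite !mxE /nabla lorDl lorZl.
    have [h _ _ _] := ef'; rewrite (h j) mulr0 addr0 -[RHS]mulr_natr.
    by have := ev i j; rewrite vdir.unlock.
  rewrite char_poly_trig; last exact: diag_mx_is_trig.
  by apply: eq_bigr => i _; rewrite !mxE eqxx mulr1n.
- by move=> i j ij; rewrite lerN2 ds.
Qed.

(** Expansion in an eigenframe turns the bound on eigenvalues into a bound on the quadratic form. *)
Lemma second_ff_lower : exists2 eps : R, 0 < eps & forall p v, bnd Omega p -> lor p v = 0 ->
  lor v (nu p) = 0 -> (1 + eps) * lor v v <= lor (vdir nu v p) v.
Proof.
have [eps eps0 Heps] := Hhc; exists eps => // p v bp pv vn.
have [e [kappa [[pe ne ee ex] pk ev _]]] := eigenframe bp.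
have [[V0 [oV bV sV]] _] := Hnu; have Vp : V0 p by apply: bV.
have vE : v = \sum_i lor (e i) v *: e i.
  by rewrite {1}(ex v) pv (lorC _ v) vn oppr0 !scale0r !add0r.
have -> : lor (vdir nu v p) v = \sum_i kappa i * lor (e i) v ^+ 2.
  rewrite {1}vE -big_enum (vdir_sum oV sV Vp) big_enum lor_suml; apply: eq_bigr => i _.
  rewrite lorZl; have -> : lor (vdir nu (e i) p) v = kappa i * lor (e i) v; last by ring.
  rewrite {1}vE lor_sumr (bigD1 i) //= big1 => [|j ji].
    by rewrite [lor (vdir _ _ _) _]lorZr ev eqxx mulr1 addr0 mulrC.
  by rewrite [lor (vdir _ _ _) _]lorZr ev eq_sym (negbTE ji) !mulr0.
have -> : lor v v = \sum_i lor (e i) v ^+ 2.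
  rewrite {1}vE lor_suml; apply: eq_bigr => i _; by rewrite lorZl expr2.
rewrite mulr_sumr; apply: ler_sum => i _; rewrite ler_wpM2r ?sqr_ge0 //.
exact: Heps pk i.
Qed.

(* The curve bends inwards with normal curvature at most 1, whereas a tangential curve that stays
   inside must bend inwards at least as much as the boundary. *)
Lemma no_touch p b c : bnd Omega p -> 0 < lor b b + lor b p ^+ 2 ->
  (lor b (nu p) = 0 -> 0 <= 2 * lor c (nu p) + (lor b b + lor b p ^+ 2)) ->
  (\forall t \near at0, closure Omega (nrm (p + t *: b + t ^+ 2 *: c))) ->
  lor b (nu p) < 0.
Proof.
move=> bp G0 cond clo; have hp := bnd_hyp bp; have [pp _] := hp.
have [pn nn] := normal_props Hnu bp.
case: (ltgtP (lor b (nu p)) 0) => // bn.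
  by have out := outward_curve c bp bn; have [t []] := filter_ex (filterI clo out).
have [f lp] := Hsm bp; have [U [oU Up sf fO _]] := lp.
have r0 := rho_gt0 Hnu bp lp.
pose w := b + lor b p *: p; pose x t := nrm (p + t *: b + t ^+ 2 *: c).
have xw : t^-1 *: (x t - p) @[t --> at0] --> w := curve_quotient c hp.
have pw : lor p w = 0 by rewrite /w lorDr lorZr pp (lorC p b); ring.
have wn : lor w (nu p) = 0 by rewrite /w lorDl lorZl bn pn mulr0 addr0.
have ww : lor w w = lor b b + lor b p ^+ 2.
  by rewrite /w lorDl !lorDr !lorZl !lorZr pp (lorC p b); ring.
have H2 := second_relation bp oU Up sf fO lp pw wn pw wn.
have [eps eps0 Heps] := second_ff_lower.
have h1 := Heps p w bp pw wn.
have tl := @curve_tlen_cvg R n p b c hp.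
have Q := smooth_quotient2 oU sf Up xw.
(* The added terms are t^-2 times [ddir f (x t - p) p], so the whole expression equals t^-2 f (x t),
   which is nonpositive as long as [x t] stays in the closure. Its limit is half of rho (h(w, w) + 2
   <c, nu>), which is positive by h-convexity. *)
have L : t^-1 ^+ 2 * (f (x t) - f p - ddir f (x t - p) p) +
   (rho f p * (lor c (nu p) / tlen (p + t *: b + t ^+ 2 *: c)) +
    2^-1 * lor (t^-1 *: (x t - p)) (t^-1 *: (x t - p)) * ddir f p p) @[t --> at0] -->
   ddir (ddir f w) w p / 2 + (rho f p * (lor c (nu p) / 1) + 2^-1 * lor w w * ddir f p p).
  apply: cvgD => //; apply: cvgD.
    apply: cvgM; first exact: cvg_cst.
    by apply: cvgM; [exact: cvg_cst|apply: cvgV => //; exact: oner_neq0].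
  apply: cvgM; last exact: cvg_cst.
  by apply: cvgM; [exact: cvg_cst|exact: (lor_cvg _ xw xw)].
have Lpos : 0 < ddir (ddir f w) w p / 2 + (rho f p * (lor c (nu p) / 1) + 2^-1 * lor w w * ddir f p p).
  have -> : ddir (ddir f w) w p / 2 + (rho f p * (lor c (nu p) / 1) + 2^-1 * lor w w * ddir f p p) =
    rho f p * (lor (vdir nu w p) w + 2 * lor c (nu p)) / 2.
    by rewrite [rho f p * (_ + _)]mulrDr -H2; field.
  rewrite divr_gt0 // mulr_gt0 //; have := cond bn.
  rewrite -ww in G0 *; have : 0 < eps * lor w w by rewrite mulr_gt0.
  by move: h1; lra.
have [t [[[[ct t0] Lt] Pt] Ut]] : exists t, (((closure Omega (x t) /\ 0 < t) /\
    0 < t^-1 ^+ 2 * (f (x t) - f p - ddir f (x t - p) p) +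
   (rho f p * (lor c (nu p) / tlen (p + t *: b + t ^+ 2 *: c)) +
    2^-1 * lor (t^-1 *: (x t - p)) (t^-1 *: (x t - p)) * ddir f p p)) /\
    lor (p + t *: b + t ^+ 2 *: c) (p + t *: b + t ^+ 2 *: c) < 0) /\ U (x t).
  apply: (filter_ex (F := at0)); near=> t; split; [split; [split; [split|]|]|].
  - by near: t.
  - by [].
  - by near: t; exact: cvgr_gt L _ Lpos.
  - by near: t; apply: filterS (curve_timelike b c hp) => s [].
  - by near: t; have xp := quotient_cvg xw; apply: xp; exact: open_nbhs_nbhs.
have fx := closure_f_le0 oU sf fO ct Ut.
have hx : hyp (x t) := closure_hyp ct.
suff E1 : t^-1 ^+ 2 * (f (x t) - f p - ddir f (x t - p) p) +
   (rho f p * (lor c (nu p) / tlen (p + t *: b + t ^+ 2 *: c)) +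
    2^-1 * lor (t^-1 *: (x t - p)) (t^-1 *: (x t - p)) * ddir f p p) = t^-1 ^+ 2 * f (x t).
  by move: Lt; rewrite E1 pmulr_rgt0 ?exprn_gt0 ?invr_gt0 // ltNge fx.
rewrite (f_bnd oU sf fO bp Up) subr0.
have d1 : ddir f (x t - p) p = rho f p * lor (x t) (nu p) - lor p (x t - p) * ddir f p p.
  have : lor p (lor p (x t - p) *: p + (x t - p)) = 0.
    by rewrite [LHS]lorDr [lor p (_ *: _)]lorZr pp mulrN1 addNr.
  move/(ddir_normal oU sf Hnu bp Up lp); rewrite (ddir_linear oU sf Up) -/(rho f p).
  by rewrite lorDl lorZl pn mulr0 add0r [lor (x t - p) _]lorDl lorNl pn oppr0 addr0 => <-; ring.
have d2 : lor (x t) (nu p) = t ^+ 2 * (lor c (nu p) / tlen (p + t *: b + t ^+ 2 *: c)).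
  by rewrite /x nrm_lor !lorDl !lorZl pn bn; ring.
have d3 : lor (x t - p) (x t - p) = - 2 * lor p (x t - p).
  by rewrite !lorDl !lorDr !lorNl !lorNr pp hx.1 (lorC _ p); ring.
rewrite d1 d2 lorZl lorZr d3; move: (lor c (nu p) / _) (lor p (x t - p)) => c1 l.
by field; rewrite gt_eqF.
Unshelve. all: by end_near. Qed.

(** * Convexity *)

Lemma bnd_frechet_quotient p e (q : R -> E) : bnd Omega p -> t^-1 *: (q t - p) @[t --> at0] --> e ->
  t^-1 *: (nu (q t) - nu p) @[t --> at0] --> vdir nu e p.
Proof.
move=> bp qe; have [[V0 [oV bV sV]] _] := Hnu.
have Vp : V0 p by apply: bV.
apply: (frechet_quotient (vdir_frechet oV sV Vp) _ qe) => [c x|]; first by rewrite (vdirZ oV sV Vp).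
apply: cvg_coord => i.
apply: (@linear_cvg R _ n.+1 (fun x => vdir nu x p 0 i) _ _ at0 _ _ qe) => a x y.
by rewrite (vdir_linear oV sV Vp) !mxE.
Qed.

(** Both identities come from difference quotients, along chords tending to [e], of <q, nu q> = 0
    and <nu q, nu q> = 1. *)
Lemma weingarten_tangent p e : bnd Omega p -> lor p e = 0 -> lor e (nu p) = 0 ->
  lor p (vdir nu e p) = 0 /\ lor (nu p) (vdir nu e p) = 0.
Proof.
move=> bp pe en; have [q [bq qe]] := tangent_seq bp pe en.
have nq := bnd_frechet_quotient bp qe; have qp := quotient_cvg qe; have nqp := quotient_cvg nq.
have [pn nn] := normal_props Hnu bp.
split.
  have L1 : lor p (t^-1 *: (nu (q t) - nu p)) @[t --> at0] --> lor p (vdir nu e p).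
    exact: (lor_cvg _ (cvg_cst p) nq).
  apply: (cvg_unique _ L1); first exact: norm_hausdorff.
  have L2 : - lor (t^-1 *: (q t - p)) (nu (q t)) @[t --> at0] --> - lor e (nu p).
    by apply: cvgN; exact: (lor_cvg _ qe nqp).
  rewrite en oppr0 in L2; apply: cvg_trans L2; apply: near_eq_cvg; near=> t.
  have bqt : bnd Omega (q t) by near: t.
  have [qn _] := normal_props Hnu bqt.
  by rewrite lorZl lorZr lorDl lorDr lorNl lorNr qn pn; ring.
have L1 : lor (nu (q t) + nu p) (t^-1 *: (nu (q t) - nu p)) @[t --> at0] -->
    lor (nu p + nu p) (vdir nu e p).
  by apply: (lor_cvg _ _ nq); apply: cvgD => //; exact: cvg_cst.
suff : lor (nu p + nu p) (vdir nu e p) = 0 by rewrite lorDl => h; lra.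
apply: (lim_near_eq L1 (cvg_cst 0)); near=> t.
have bqt : bnd Omega (q t) by near: t.
have [_ qnn] := normal_props Hnu bqt.
by rewrite lorZr lorDl !lorDr !lorNr qnn nn (lorC (nu p)); ring.
Unshelve. all: by end_near. Qed.

Lemma weingarten_eigen p (e : 'I_n -> E) (kappa : 'I_n -> R) : bnd Omega p ->
  is_frame p (nu p) e ->
  (forall i j, lor (vdir nu (e i) p) (e j) = kappa i * (i == j)%:R) ->
  forall i, vdir nu (e i) p = kappa i *: e i.
Proof.
move=> bp [pe ne ee ex] ev i; have en : lor (e i) (nu p) = 0 by rewrite lorC.
have [h1 h2] := weingarten_tangent bp (pe i) en.
rewrite (ex (vdir nu (e i) p)) h1 h2 oppr0 !scale0r !add0r (bigD1 i) //= big1 => [|j ji].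
  by rewrite lorC ev eqxx mulr1 addr0.
by rewrite lorC ev eq_sym (negbTE ji) mulr0 scale0r.
Qed.

(** The geodesic from [x] to [y], parametrised by the chord rather than by arc length. *)
Definition seg x y (t : R) : E := nrm ((1 - t) *: x + t *: y).

Lemma seg_timelike x y (t : R) : hyp x -> hyp y -> 0 <= t <= 1 ->
  lor ((1 - t) *: x + t *: y) ((1 - t) *: x + t *: y) < 0 /\
  0 < ((1 - t) *: x + t *: y) 0 0.
Proof.
move=> hx hy /andP[t0 t1]; have [xx x0] := hx; have [yy y0] := hy.
have xy := hyp_le hx hy; split; last first.
  rewrite !mxE; have [->|tn] := eqVneq t 0; first by rewrite subr0 mul0r mul1r addr0.
  have tp : 0 < t by rewrite lt0r tn.
  by rewrite ltr_wpDl ?mulr_ge0 ?mulr_gt0 ?subr_ge0 // ltW.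
have -> : lor ((1 - t) *: x + t *: y) ((1 - t) *: x + t *: y) =
    -1 + 2 * (t * (1 - t)) * (1 + lor x y) by rewrite !lorE xx yy (lorC y x); ring.
have : 0 <= t * (1 - t) by rewrite mulr_ge0 // subr_ge0.
by move: (t * (1 - t)) (lor x y) xy => r l; nra.
Qed.

Lemma seg_hyp x y (t : R) : hyp x -> hyp y -> 0 <= t <= 1 -> hyp (seg x y t).
Proof. by move=> hx hy ht; have [h1 h2] := seg_timelike hx hy ht; exact: nrm_hyp. Qed.

Lemma seg_cvg {T : Type} (F : set_system T) (u : T -> R) (a b : T -> E) (t : R) x y :
  Filter F -> hyp x -> hyp y -> 0 <= t <= 1 ->
  a s @[s --> F] --> x -> b s @[s --> F] --> y -> u s @[s --> F] --> t ->
  seg (a s) (b s) (u s) @[s --> F] --> seg x y t.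
Proof.
move=> FF hx hy ht ax bY ut; apply: nrm_cvg; first by have [] := seg_timelike hx hy ht.
apply: cvgD; apply: cvgZ => //; apply: cvgB => //; exact: cvg_cst.
Qed.

Lemma closure_image (A B : set E) (g : E -> E) y : {for y, continuous g} ->
  (forall z, A z -> B (g z)) -> closure A y -> closure B (g y).
Proof.
move=> cg AB cA W /cg W'; have [z [Az Wz]] := cA _ W'.
by exists (g z); split => //; exact: AB.
Qed.

(** At a boundary point the segment, run in either direction, is a curve inside the closure. By
    [no_touch] both y - x and x - y would then have negative product with the normal. *)
Lemma seg_no_touch x y : Omega x -> Omega y ->
  (forall t : R, 0 <= t <= 1 -> closure Omega (seg x y t)) ->
  forall t : R, 0 <= t <= 1 -> Omega (seg x y t).
Proof.
move=> Ox Oy clo t ht; have hx := Omega_hyp Ox; have hy := Omega_hyp Oy.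
have [//|bp] := closure_cases (clo t ht); exfalso.
have t0 : t != 0.
  by apply: contraPneq bp => -> [_]; rewrite /seg subr0 scale1r scale0r addr0 nrm_id.
have t1 : t != 1.
  by apply: contraPneq bp => -> [_]; rewrite /seg subrr scale1r scale0r add0r nrm_id.
have [xy|xy] := eqVneq x y.
  by case: bp => _; rewrite /seg -xy -scalerDl subrK scale1r nrm_id.
have := ht => /andP[]; rewrite le0r (negbTE t0) /= => tp.
rewrite le_eqVlt (negbTE t1) /= => tp1.
have [zz z0] := seg_timelike hx hy ht.
set z := (1 - t) *: x + t *: y in zz z0; have l0 := tlen_gt0 zz.
set p := seg x y t in bp; have zE : z = tlen z *: p.
  by rewrite /p /seg -/z /nrm scalerA mulfV ?scale1r // gt_eqF.
have [pn nn] := normal_props Hnu bp.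
have bb : 0 < lor (y - x) (y - x).
  have -> : lor (y - x) (y - x) = - 2 - 2 * lor x y.
    by rewrite !lorDl !lorDr !lorNl !lorNr hx.1 hy.1 (lorC y); ring.
  have : lor x y < -1 by rewrite ltNge; apply: contra_neqN xy => /(hyp_eq hx hy) ->.
  by lra.
have key (s : R) : s ^+ 2 = 1 -> lor (s *: (y - x)) (nu p) < 0.
  move=> s2; apply: (@no_touch p _ 0 bp).
  - rewrite ltr_pwDl ?sqr_ge0 // lorZl lorZr mulrA -expr2 s2 mul1r //.
  - by move=> _; rewrite lor0l mulr0 add0r ltW // ltr_pwDl ?sqr_ge0 // lorZl lorZr mulrA -expr2 s2 mul1r.
  have d0 : 0 < Num.min t (1 - t) / tlen z by rewrite divr_gt0 // lt_min tp subr_gt0.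
  near=> r.
  have r0 : 0 < r by [].
  have rd : r < Num.min t (1 - t) / tlen z.
    by near: r; apply: nbhs_right_lt.
  have -> : p + r *: (s *: (y - x)) + r ^+ 2 *: 0 =
      (tlen z)^-1 *: ((1 - (t + tlen z * r * s)) *: x + (t + tlen z * r * s) *: y).
    have -> : (1 - (t + tlen z * r * s)) *: x + (t + tlen z * r * s) *: y =
      tlen z *: p + (tlen z * r * s) *: (y - x).
      by rewrite -zE /z; apply/rowP => i; rewrite !mxE; ring.
    by apply/rowP => i; rewrite !mxE; field; rewrite gt_eqF.
  rewrite nrmZ ?invr_gt0 //; apply: clo.
  move: rd; rewrite ltr_pdivlMr // lt_min mulrC => /andP[].
  have lr : 0 < tlen z * r by rewrite mulr_gt0.
  have : s = 1 \/ s = -1.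
    by have /eqP := s2; rewrite -subr_eq0 subr_sqr_1 mulf_eq0 subr_eq0 addr_eq0 => /orP[] /eqP; auto.
  by case=> ->; move: lr; move: (tlen z * r) => k; rewrite ?mulr1 ?mulrN1; lra.
have := key 1; have := key (-1); rewrite sqrrN expr1n !lorZl => /(_ erefl) h1 /(_ erefl) h2.
by move: h1 h2; lra.
Unshelve. all: by end_near. Qed.

(** The points whose whole segment from [x] lies in [Omega] form an open set, by compactness of
    [0, 1], and a relatively closed one, by [seg_no_touch]. Connectedness of [Omega] concludes. *)
Lemma geodesic_convex x y (t : R) : Omega x -> Omega y -> 0 <= t <= 1 -> Omega (seg x y t).
Proof.
move=> Ox; have hx := Omega_hyp Ox; have [W oW OW] := Omega_open.
pose S := [set y | Omega y /\ forall t : R, 0 <= t <= 1 -> Omega (seg x y t)].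
suff OS : Omega = S by move=> Oy ht; move: Oy; rewrite {1}OS => -[_]; apply.
have [_ _ conn _] := Hdom; apply/esym/conn.
- exists x; split => // s hs; rewrite /seg -scalerDl subrK scale1r nrm_id //.
- pose C := [set y | forall s : R, `[0, 1]%classic s -> W (seg x y s)].
  exists (interior C); first exact: open_interior.
  apply/seteqP; split => z; last first.
    case=> Oz /interior_subset Cz; split => // s hs.
    by apply/OW; [exact: seg_hyp (Omega_hyp Oz) _|apply: Cz; rewrite /= in_itv].
  move=> [Oz Sz]; split => //; have hz := Omega_hyp Oz.
  have /compact_near_coveringP cov := @segment_compact R 0 1.
  apply: (cov _ (nbhs z) (fun y s => W (seg x y s))) => s /=; rewrite in_itv /= => hs.
  have c : seg x w.2 w.1 @[w --> (nbhs s, nbhs z)] --> seg x z s.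
    by apply: seg_cvg => //; [exact: cvg_cst|exact: cvg_snd|exact: cvg_fst].
  by apply: c; apply: open_nbhs_nbhs; split => //; apply/OW; [exact: seg_hyp|exact: Sz].
- exists (closure S); first exact: closed_closure.
  apply/seteqP; split => z; first by move=> Sz; split; [exact: Sz.1|exact: subset_closure].
  move=> [Oz Cz]; split => //; apply: seg_no_touch => // s hs.
  apply: (closure_image (g := fun w => seg x w s) _ _ Cz); last by move=> w [_]; apply.
  apply: (seg_cvg (nbhs_filter z)) => //; [exact: Omega_hyp|exact: cvg_cst|exact: cvg_cst].
Qed.

(** If <nu p, z> > 0, the segment from [p] to [z] leaves the closure at once, although it is a limit
    of segments with both ends in [Omega]. *)
Lemma convex_support p q : bnd Omega p -> closure Omega q -> lor (nu p) q <= 0.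
Proof.
move=> bp; have hp := bnd_hyp bp; have [pn nn] := normal_props Hnu bp.
have cl : closed [set q : E | lor (nu p) q <= 0].
  by apply: closed_level_le => x; exact: lor_continuous.
suff sub : Omega `<=` [set q : E | lor (nu p) q <= 0].
  by move=> cq; apply: cl; apply: closure_subset cq.
move=> z Oz /=; have hz := Omega_hyp Oz; rewrite leNgt; apply/negP => nz.
have bn : 0 < lor (z - p) (nu p) by rewrite lorDl lorNl pn oppr0 addr0 lorC.
have out := outward_curve 0 bp bn.
have [t [[/andP[t0 t1]]]] := filter_ex (filterI (near_at0 (@ltr01 R)) out); apply.
have ht : 0 <= t <= 1 by rewrite !ltW.
have -> : nrm (p + t *: (z - p) + t ^+ 2 *: 0) = seg p z t.
  by congr nrm; apply/rowP => i; rewrite !mxE; ring.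
apply: (closure_image (g := fun w => seg w z t) (y := p) (A := Omega)) => [|w Ow|].
- by apply: (seg_cvg (nbhs_filter p)) => //; exact: cvg_cst.
- exact: geodesic_convex.
- by case: bp.
Qed.

(* Locked, lest the rewriting rules for lor expand it. *)
Definition horo p := locked (p - nu p).

Lemma horoE p : horo p = p - nu p.
Proof. by rewrite /horo -lock. Qed.

Lemma horo_null p : bnd Omega p -> null (horo p) /\ lor p (horo p) = -1.
Proof.
move=> bp; have hp := bnd_hyp bp; have [pn nn] := normal_props Hnu bp.
have h1 : lor p (horo p) = -1 by rewrite horoE lorDr lorNr pn hp.1 oppr0 addr0.
have h0 : lor (horo p) (horo p) = 0.
  by rewrite {1}horoE lorDl lorNl h1 horoE lorDr lorNr nn lorC pn; ring.
by split => //; split => //; have [] // := @causal_future _ _ p (horo p) hp; rewrite ?h0 ?h1.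
Qed.

Lemma horo_continuous p : bnd Omega p -> {for p, continuous horo}.
Proof.
move=> bp; have [[V0 [oV bV sV]] _] := Hnu.
have [nuc _] := sV 0%N; have nup := nuc p (bV _ bp).
apply: (@cvg_coord R E n.+1 horo (horo p) (nbhs p) (nbhs_filter p)) => i.
have h1 := @coord_cvg R E n.+1 id p (nbhs p) i (nbhs_filter p) cvg_id.
have h2 := @coord_cvg R E n.+1 nu (nu p) (nbhs p) i (nbhs_filter p) nup.
have h : ((fun x : E => x 0 i) \- (fun x : E => nu x 0 i)) @ nbhs p --> p 0 i - nu p 0 i by apply: cvgB.
by rewrite !horoE; under eq_fun do rewrite horoE !mxE; rewrite !mxE.
Qed.

(* At the boundary point where <q, horo p> is minimal, q lies in the plane of p and nu p,
   because the differential of horo is invertible on the tangent space. *)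
Lemma horo_extremal p q : bnd Omega p -> closure Omega q ->
  (forall p', bnd Omega p' -> lor q (horo p) <= lor q (horo p')) ->
  -1 <= lor q (horo p) /\ (lor q (horo p) <= -1 -> q = p).
Proof.
move=> bp cq pmax; have hp := bnd_hyp bp; have hq := closure_hyp cq.
have [pn nn] := normal_props Hnu bp.
have [eps eps0 Heps] := Hhc.
have [e [kappa [ef pk ev _]]] := eigenframe bp; have [pe ne ee ex] := ef.
have we := weingarten_eigen bp ef ev.
have qe i : lor (e i) q = 0.
  have one (s : R) : 0 <= (1 - kappa i) * s * lor q (e i).
    have pse : lor p (s *: e i) = 0 by rewrite lorZr pe mulr0.
    have sen : lor (s *: e i) (nu p) = 0 by rewrite lorZl lorC ne mulr0.
    have [u [bu ue]] := tangent_seq bp pse sen.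
    have nq := bnd_frechet_quotient bp ue.
    have L : lor q (t^-1 *: (u t - p) - t^-1 *: (nu (u t) - nu p)) @[t --> at0] -->
        lor q (s *: e i - vdir nu (s *: e i) p).
      by apply: (lor_cvg _ (cvg_cst q)); apply: cvgB.
    have [[V0 [oV bV sV]] _] := Hnu; have Vp : V0 p by apply: bV.
    have <- : lor q (s *: e i - vdir nu (s *: e i) p) = (1 - kappa i) * s * lor q (e i).
      by rewrite (vdirZ oV sV Vp) we lorDr lorNr !lorZr; ring.
    apply: (ler_cvg_to (cvg_cst 0) L); near=> t.
    have but : bnd Omega (u t) by near: t.
    have t0 : 0 < t by [].
    have -> : t^-1 *: (u t - p) - t^-1 *: (nu (u t) - nu p) = t^-1 *: (horo (u t) - horo p).
      by rewrite !horoE; apply/rowP => j; rewrite !mxE; ring.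
    by rewrite lorZr mulr_ge0 ?invr_ge0 ?(ltW t0) // lorDr lorNr subr_ge0; apply: pmax.
  have := one 1; have := one (-1); rewrite lorC.
  have := Heps p kappa bp pk i; move: (lor (e i) q) => l k1 a b.
  have : (1 - kappa i) * l = 0 by lra.
  by move/eqP; rewrite mulf_eq0 => /orP[] /eqP h //; lra.
have qE : q = - lor p q *: p + lor (nu p) q *: nu p.
  by rewrite {1}(ex q) big1 ?addr0 // => i _; rewrite qe scale0r.
have b0 := convex_support bp cq; have a1 := hyp_le hp hq.
have qq : lor p q ^+ 2 - lor (nu p) q ^+ 2 = 1.
  have := hq.1; rewrite {1}qE lorDl !lorZl => h; move: h; lra.
have -> : lor q (horo p) = lor p q - lor (nu p) q.
  by rewrite horoE lorDr lorNr !(lorC q).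
move: a1 b0 qq qE; move: (lor p q) (lor (nu p) q) => a b a1 b0 ab qE.
(* As a <= -1 and b <= 0, the factor a + b is at most -1, so its inverse a - b is at least -1. *)
have h : (a - b) * (a + b) = 1 by move: ab; rewrite subr_sqr.
split; first by nra.
move=> ab1; have b00 : b = 0 by nra.
have a11 : a = -1 by nra.
by rewrite qE a11 b00 opprK scale1r scale0r addr0.
Unshelve. all: by end_near. Qed.

(** Compactness provides a minimiser of <q, horo .>, and [horo_extremal] puts the minimum at -1 or
    above. A point with value at most -1 is then itself a minimiser, so the equality case applies to
    it. *)
Lemma horo_support p q : bnd Omega p -> closure Omega q ->
  -1 <= lor q (horo p) /\ (lor q (horo p) <= -1 -> q = p).
Proof.
move=> bp cq.
have [p0 bp0 pmax] : exists2 p0, bnd Omega p0 & forall p', bnd Omega p' ->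
    - lor q (horo p') <= - lor q (horo p0).
  apply: compact_max bnd_compact _; first by exists p.
  move=> x bx.
  have h : lor q (horo y) @[y --> x] --> lor q (horo x).
    exact: (lor_cvg (nbhs_filter x) (cvg_cst q) (horo_continuous bx)).
  exact: (cvgN h).
have [h1 h2] : -1 <= lor q (horo p0) /\ (lor q (horo p0) <= -1 -> q = p0).
  by apply: horo_extremal => // p' /pmax; rewrite lerN2.
have lb p' : bnd Omega p' -> -1 <= lor q (horo p').
  by move=> bp'; apply: le_trans h1 _; rewrite -lerN2; exact: pmax.
split; first exact: lb.
move=> hl; have [|_] := horo_extremal bp cq; last exact.
by move=> p' b'; exact: le_trans hl (lb p' b').
Qed.

Lemma closure_nonempty : exists q, closure Omega q.
Proof. by have [[x Ox] _ _ _] := Hdom; exists x; exact: subset_closure. Qed.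

(** Admissible variations decide everything. An interior point could be moved along the tangential
    part of -z. At a boundary point every strictly inward direction is admissible, which kills the
    components of [z] along the boundary; nullity of [z] and the sign of <nu p, z> then leave only
    multiples of [horo p]. *)
Lemma horosphere_max_bnd z p : null z -> closure Omega p ->
  (forall q, closure Omega q -> lor p z <= lor q z) -> bnd Omega p /\ z = - lor p z *: horo p.
Proof.
move=> nz cp pmin; have hp := closure_hyp cp.
have a0 : lor p z < 0 := causal_lt0 hp (null_causal nz).
have tl v : lor p v = 0 -> \forall t \near at0, tlen (p + t *: v + t ^+ 2 *: 0) <= 1 /\
   0 < tlen (p + t *: v + t ^+ 2 *: 0).
  move=> pv; apply: filterS (curve_timelike v 0 hp) => t [h _]; split; last exact: tlen_gt0.
  rewrite -(@ler_pXn2r _ 2) ?nnegrE ?sqrtr_ge0 // tlen_sqr // expr1n.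
  rewrite scaler0 addr0 lorDl !lorDr !lorZl !lorZr hp.1 pv (lorC v) pv.
  have : 0 <= t * (t * lor v v) by rewrite mulrA mulr_ge0 ?(tangent_ge0 hp pv) // -expr2 sqr_ge0.
  lra.
have one v : lor p v = 0 -> (\forall t \near at0, closure Omega (nrm (p + t *: v + t ^+ 2 *: 0))) ->
    0 <= lor v z.
  move=> pv clo; have [t [[[l1 l0] ct] /andP[t0 _]]] :=
    filter_ex (filterI (filterI (tl v pv) clo) (near_at0 (@ltr01 R))).
  have := pmin _ ct; rewrite nrm_lor ler_pdivlMr // scaler0 addr0 lorDl lorZl => h.
  rewrite leNgt; apply/negP => vz; move: h l1 l0; rewrite scaler0 addr0.
  move: (tlen _) => l; have : t * lor v z < 0 by rewrite pmulr_rlt0.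
  by nra.
have bp : bnd Omega p.
  have [Op|//] := closure_cases cp; exfalso.
  pose v := - z - lor p z *: p.
  have pv : lor p v = 0 by rewrite /v lorDr !lorNr lorZr hp.1; ring.
  have : 0 <= lor v z.
    apply: (one v pv); have [W oW OW] := Omega_open.
    have c := @curve_cvg R n p v 0; near=> t; apply: subset_closure; apply/OW.
      have [h1 h2] : lor (p + t *: v + t ^+ 2 *: 0) (p + t *: v + t ^+ 2 *: 0) < 0 /\
        0 < (p + t *: v + t ^+ 2 *: 0) 0 0 by near: t; exact: curve_timelike.
      exact: nrm_hyp.
    near: t; have pp0 : lor p p < 0 by rewrite hp.1.
    have := nrm_cvg _ pp0 c; rewrite (nrm_id hp); apply.
    by apply: open_nbhs_nbhs; split => //; apply/OW.
  by rewrite /v lorDl !lorNl lorZl nz.1; nra.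
split => //; have [pn nn] := normal_props Hnu bp.
have inw v : lor p v = 0 -> lor v (nu p) < 0 -> 0 <= lor v z.
  move=> pv vn; apply: one => //.
  by apply: filterS (inward_curve 0 bp vn) => t; exact: subset_closure.
have [e [pe ne ee ex]] := frame_exists hp pn nn.
have ez i : lor (e i) z = 0.
  apply: contrapT => /eqP ez0.
  (* The coefficient makes <k e_i - nu p, z> equal to -1, although this direction points strictly
     inwards. *)
  pose k := (lor (nu p) z - 1) / lor (e i) z.
  have : 0 <= lor (k *: e i - nu p) z.
    apply: inw; first by rewrite lorDr lorNr lorZr pe pn; ring.
    by rewrite lorDl lorNl lorZl (lorC _ (nu p)) ne nn; lra.
  by rewrite lorDl lorNl lorZl /k divfK //; lra.
have zE : z = - lor p z *: p + lor (nu p) z *: nu p.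
  by rewrite {1}(ex z) big1 ?addr0 // => i _; rewrite ez scale0r.
have nz0 : lor (nu p) z <= 0.
  have : 0 <= lor (- nu p) z.
    by apply: inw; rewrite ?lorNr ?lorNl ?pn ?nn ?oppr0 // ltrN10.
  by rewrite lorNl oppr_ge0.
have : lor p z ^+ 2 - lor (nu p) z ^+ 2 = 0.
  have := nz.1; rewrite {1}zE lorDl !lorZl => h; move: h; lra.
rewrite subr_sqr => /eqP; rewrite mulf_eq0 => /orP[] /eqP h; last first.
  by exfalso; move: nz0 a0 h; lra.
by rewrite {1}zE (_ : lor (nu p) z = lor p z) ?horoE ?scalerBr ?scaleNr ?opprK //; lra.
Unshelve. all: by end_near. Qed.

(** The condition that [z] be null stands below the existential, so that a touching point can be
    chosen as a total function of [z]. *)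
Lemma touching_exists z : exists p, null z ->
  [/\ bnd Omega p, z = - lor p z *: horo p & forall q, closure Omega q -> lor p z <= lor q z /\
    (lor q z <= lor p z -> q = p)].
Proof.
have [nz|nz] := pselect (null z); last by exists 0.
have [q0 cq0] := closure_nonempty.
have [p cp pmax] : exists2 p, closure Omega p & forall q, closure Omega q ->
    - lor q z <= - lor p z.
  apply: compact_max closure_compact _; first by exists q0.
  move=> x _; have h : lor y z @[y --> x] --> lor x z.
    by under eq_fun do rewrite lorC; rewrite lorC; exact: lor_continuous.
  exact: (cvgN h).
have pmin q : closure Omega q -> lor p z <= lor q z by move=> cq; rewrite -lerN2; exact: pmax.
exists p => _; have [bp zE] := horosphere_max_bnd nz cp pmin; split => // q cq.
split; first exact: pmin.
have a0 : lor p z < 0 := causal_lt0 (bnd_hyp bp) (null_causal nz).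
rewrite {1}zE lorZr mulNr -[leRHS]opprK lerN2 => h.
have [_] := horo_support bp cq; apply.
by move: h a0; move: (lor q _) (lor p z) => x y; nra.
Qed.

(** * Second-order expansion of the boundary *)

Lemma chord_lor p q : hyp p -> hyp q -> lor p (q - p) = - 2^-1 * lor (q - p) (q - p).
Proof. by move=> hp hq; rewrite lorDl !lorDr !lorNl !lorNr hp.1 hq.1 (lorC q p); field. Qed.

Lemma ddir_chord p f U q : bnd Omega p -> open U -> U p -> smooth_on U f ->
  local_defining Omega p f ->
  ddir f (q - p) p = rho f p * lor (nu p) (q - p) - lor p (q - p) * ddir f p p.
Proof.
move=> bp oU Up sf lp; have hp := bnd_hyp bp; have [pn nn] := normal_props Hnu bp.
have : lor p (lor p (q - p) *: p + (q - p)) = 0.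
  by rewrite [LHS]lorDr [lor p (_ *: _)]lorZr hp.1 mulrN1 addNr.
move/(ddir_normal oU sf Hnu bp Up lp); rewrite (ddir_linear oU sf Up) -/(rho f p).
by rewrite lorDl lorZl pn mulr0 add0r (lorC (nu p)) => <-; ring.
Qed.

Lemma open_norm_ball (U : set E) p : open U -> U p ->
  exists2 r : R, 0 < r & forall q, `|q - p| < r -> U q.
Proof.
move=> oU Up; have /nbhs_ballP [r r0 rU] : nbhs p U by exact: open_nbhs_nbhs.
by exists r => // q qr; apply: rU; rewrite -ball_normE /= distrC.
Qed.

(** Chords are tangential to first order: <p, q - p> is - <q - p, q - p> / 2 exactly, and the normal
    component is o(|q - p|) because [f] vanishes at both ends. *)
Lemma small_defect p eta : bnd Omega p -> 0 < eta -> exists2 d, 0 < d & forall q, bnd Omega q ->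
  `|q - p| < d -> `|lor p (q - p)| + `|lor (nu p) (q - p)| <= eta * `|q - p|.
Proof.
move=> bp eta0; have hp := bnd_hyp bp.
have [f lp] := Hsm bp; have [U [oU Up sf fO _]] := lp.
have r0 := rho_gt0 Hnu bp lp; have [r rp rU] := open_norm_ball oU Up.
pose N := n.+2%:R : R; have N0 : 0 < N by rewrite ltr0n.
pose A := 2^-1 * N * (`|ddir f p p| + rho f p).
have A0 : 0 < A by rewrite !mulr_gt0 ?invr_gt0 // ltr_wpDl.
have th0 : 0 < rho f p * eta / 2 by rewrite divr_gt0 ?mulr_gt0.
have [d d0 Hd] := smooth_frechet oU sf Up th0.
exists (Num.min r (Num.min d (rho f p * eta / 2 / A))).
  by rewrite !lt_min rp d0 divr_gt0.
move=> q bq; rewrite !lt_min => /andP[qr /andP[qd]]; have hq := bnd_hyp bq.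
rewrite ltr_pdivlMr // => qA.
have := Hd _ qd; rewrite subrK (f_bnd oU sf fO bp Up) (f_bnd oU sf fO bq (rU _ qr)).
rewrite subrr sub0r normrN (ddir_chord q bp oU Up sf lp).
have := lor_bound (q - p) (q - p); rewrite -/N (chord_lor hp hq) normrM normrN.
rewrite (_ : `|2^-1| = 2^-1 :> R); last by rewrite ger0_norm.
move: (lor (nu p) _) (lor (q - p) _) (`|q - p|) (normr_ge0 (q - p)) qA => b l x x0.
rewrite /A; move: (ddir f p p) (rho f p) r0 => D rh rh0 qA hl hb.
have hx : 2^-1 * `|l| * (`|D| + rh) <= rh * eta / 2 * x.
  have : `|l| * (`|D| + rh) <= N * x * x * (`|D| + rh) by rewrite ler_wpM2r // addr_ge0 // ltW.
  have : x * (x * (2^-1 * N * (`|D| + rh))) <= x * (rh * eta / 2) by rewrite ler_wpM2l // ltW.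
  by lra.
have hb' : rh * `|b| <= rh * eta / 2 * x + 2^-1 * `|l| * `|D|.
  have -> : rh * `|b| = `|(rh * b - - 2^-1 * l * D) + - 2^-1 * l * D|.
    by rewrite subrK normrM (gtr0_norm rh0).
  rewrite (le_trans (ler_normD _ _)) // lerD // !normrM normrN.
  by rewrite [`|2^-1|]ger0_norm.
by rewrite -(ler_pM2l rh0); lra.
Qed.

(** The height over the tangent horosphere is <p, q - p> - <nu p, q - p>. The first product equals -
    <q - p, q - p> / 2 and produces the -1; the second is read off from the Taylor formula of [f]
    through [second_relation] and produces [kappa i]. *)
Lemma boundary_taylor p (e : 'I_n -> E) (kappa : 'I_n -> R) eta : bnd Omega p ->
  is_frame p (nu p) e ->
  (forall i j, lor (vdir nu (e i) p) (e j) = kappa i * (i == j)%:R) -> 0 < eta ->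
  exists2 d, 0 < d & forall q, bnd Omega q -> `|q - p| < d ->
    `|lor (q - p) (horo p) - 2^-1 * \sum_i (kappa i - 1) * lor (e i) (q - p) ^+ 2|
      <= eta * `|q - p| ^+ 2.
Proof.
move=> bp ef ev eta0; have hp := bnd_hyp bp; have [pn nn] := normal_props Hnu bp.
have [pe ne ee ex] := ef.
have [f lp] := Hsm bp; have [U [oU Up sf fO _]] := lp.
have r0 := rho_gt0 Hnu bp lp; have [r rp rU] := open_norm_ball oU Up.
pose B x y := ddir (ddir f x) y p.
have Bs x y : B x y = B y x by exact: ddir_sym oU sf Up.
have BD x y z : B (x + y) z = B x z + B y z by exact: ddir2D oU sf Up.
have BZ (c : R) x y : B (c *: x) y = c * B x y by exact: ddir2Z oU sf Up.
have Bl z (a : R) x y : B (a *: x + y) z = a * B x z + B y z by rewrite BD BZ.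
have [M1 M10 HM1] := linear_bound (Bl p); have [M2 M20 HM2] := linear_bound (Bl (nu p)).
pose K := `|B p p| + 2 * `|B p (nu p)| + `|B (nu p) (nu p)|.
pose D := ddir f p p; pose rh := rho f p.
(* [L] collects the coefficients of all errors from replacing the chord by its tangential part [w]:
   the mixed Hessian terms ([M1], [M2]), the pure ones ([K]), and the terms in a^2 and b^2. Each is
   of size at most sg |x|^2; the summand 1 keeps [L] positive. *)
pose L := 2 * (M1 + M2) + K + 2 * (`|D| + rh) + 1.
have K0 : 0 <= K by rewrite !addr_ge0 // mulr_ge0.
have L0 : 0 < L by rewrite ltr_wpDl // !addr_ge0 // mulr_ge0 // addr_ge0 // ltW.
pose sg := Num.min 1 (rh * eta / L).
have s0 : 0 < sg by rewrite lt_min ltr01 /= divr_gt0 // mulr_gt0.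
have h2 : 0 < rh * eta / 2 by rewrite divr_gt0 // mulr_gt0.
have [d1 d10 H1] := small_defect bp s0.
have [d2 d20 H2] := taylor2 oU sf Up h2.
exists (Num.min r (Num.min d1 d2)); first by rewrite !lt_min rp d10 d20.
move=> q bq; rewrite !lt_min => /andP[qr /andP[qd1 qd2]]; have hq := bnd_hyp bq.
have := H1 q bq qd1; have := H2 _ qd2; rewrite subrK (f_bnd oU sf fO bp Up).
rewrite (f_bnd oU sf fO bq (rU _ qr)) subrr sub0r -opprD normrN.
rewrite (ddir_chord q bp oU Up sf lp) -/rh -/D -/(B (q - p) (q - p)).
have := chord_lor hp hq; move: (q - p) => x; set a := lor p x; set b := lor (nu p) x => ax.
pose w := x + a *: p - b *: nu p.
have pw : lor p w = 0 by rewrite /w !lorDr lorNr !lorZr hp.1 pn -/a; ring.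
have wn : lor w (nu p) = 0 by rewrite lorC /w !lorDr lorNr !lorZr nn [lor (nu p) p]lorC pn -/b; ring.
have ew i : lor (e i) w = lor (e i) x.
  by rewrite /w !lorDr lorNr !lorZr !(lorC (e i)) pe ne !mulr0 addr0 subr0.
have ww : lor w w = \sum_i lor (e i) x ^+ 2.
  rewrite {1}(ex w) pw (lorC (nu p)) wn oppr0 !scale0r !add0r lor_suml.
  by apply: eq_bigr => i _; rewrite lorZl !ew expr2.
have hw : lor (vdir nu w p) w = \sum_i kappa i * lor (e i) x ^+ 2.
  have [[V0 [oV bV sV]] _] := Hnu; have Vp : V0 p by apply: bV.
  have wE : w = \sum_i lor (e i) w *: e i.
    by rewrite {1}(ex w) pw (lorC (nu p)) wn oppr0 !scale0r !add0r.
  rewrite {1}wE -big_enum (vdir_sum oV sV Vp) big_enum lor_suml; apply: eq_bigr => i _.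
  by rewrite (weingarten_eigen bp ef ev) lorZl lorZl !ew; ring.
have rel := second_relation bp oU Up sf fO lp pw wn pw wn.
rewrite -/(B w w) -/D -/rh hw ww in rel.
have xx : lor x x = \sum_i lor (e i) x ^+ 2 - a ^+ 2 + b ^+ 2.
  rewrite -ww /w !(lorDl, lorDr, lorNl, lorNr, lorZl, lorZr) hp.1 nn pn (lorC x) -/a (lorC x) -/b (lorC (nu p)) pn; ring.
have Bx : B x x - B w w = 2 * (b * B x (nu p) - a * B x p) -
    (a ^+ 2 * B p p - 2 * a * b * B p (nu p) + b ^+ 2 * B (nu p) (nu p)).
  have -> : w = (-b) *: nu p + (a *: p + x) by rewrite /w scaleNr; apply/rowP => i; rewrite !mxE; ring.
  rewrite !Bl !(Bs _ (_ + _)) !Bl !(Bs _ x) (Bs (nu p) p); ring.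
have -> : \sum_i (kappa i - 1) * lor (e i) x ^+ 2 =
    \sum_i kappa i * lor (e i) x ^+ 2 - \sum_i lor (e i) x ^+ 2.
  by rewrite -sumrB; apply: eq_bigr => i _; rewrite mulrBl mul1r.
have -> : lor x (horo p) = a - b by rewrite horoE lorDr lorNr !(lorC x).
have HB1 := HM1 x; have HB2 := HM2 x.
move: (\sum_i kappa i * _) (\sum_i _ ^+ 2) (lor x x) (B x x) (B w w) rel xx Bx ax => S1 S2 X Bxx Bww.
move: (B x p) (B x (nu p)) HB1 HB2 => bp1 bn1 HB1 HB2 rel xx Bx ax.
move=> T1 T2.
have sgL : sg * L <= rh * eta by rewrite -ler_pdivlMr // ge_min lexx orbT.
have sg1 : sg <= 1 by rewrite ge_min lexx.
have -> : a - b - 2^-1 * (S1 - S2) = rh^-1 * (- (rh * b - a * D + Bxx / 2) + 2^-1 * (Bxx - Bww)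
    + 2^-1 * (D - rh) * (b ^+ 2 - a ^+ 2)).
  have -> : S1 = (Bww + S2 * D) / rh by rewrite rel mulrC mulKf // gt_eqF.
  have -> : S2 = - 2 * a + a ^+ 2 - b ^+ 2 by move: xx ax; lra.
  by field; rewrite gt_eqF.
rewrite Bx normrM gtr0_norm ?invr_gt0 // ler_pdivrMl //.
move: T1 T2 HB1 HB2; move: (`|x|) (normr_ge0 x) => y y0 T1 T2 HB1 HB2.
have a1 : `|a| <= sg * y by apply: le_trans T2; rewrite lerDl.
have b1 : `|b| <= sg * y by apply: le_trans T2; rewrite lerDr.
have sy : (sg * y) * (sg * y) <= sg * y ^+ 2.
  have -> : sg * y * (sg * y) = sg * (sg * y ^+ 2) by ring.
  by rewrite ler_piMl // mulr_ge0 ?sqr_ge0 // ltW.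
have prodb (u v : R) : `|u| <= sg * y -> `|v| <= sg * y -> `|u * v| <= sg * y ^+ 2.
  by move=> hu hv; apply: le_trans sy; rewrite normrM ler_pM.
have lin (u v M : R) : `|u| <= sg * y -> `|v| <= M * y -> `|u * v| <= M * (sg * y ^+ 2).
  move=> hu hv; rewrite normrM (le_trans (ler_pM _ _ hu hv)) //.
  by rewrite le_eqVlt; apply/orP; left; apply/eqP; ring.
have c1 := lin _ _ _ b1 HB2; have c2 := lin _ _ _ a1 HB1.
have Z0 : 0 <= sg * y ^+ 2 by rewrite mulr_ge0 ?sqr_ge0 // ltW.
have quad (u v k : R) : `|u| <= sg * y -> `|v| <= sg * y -> `|u * v * k| <= sg * y ^+ 2 * `|k|.
  by move=> hu hv; rewrite normrM ler_wpM2r // prodb.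
have q1 := quad _ _ (B p p) a1 a1; have q2 := quad _ _ (B p (nu p)) a1 b1.
have q3 := quad _ _ (B (nu p) (nu p)) b1 b1.
have q4 := quad _ _ (D - rh) b1 b1; have q5 := quad _ _ (D - rh) a1 a1.
have Dr : `|D - rh| <= `|D| + rh by rewrite (le_trans (ler_normB _ _)) // (gtr0_norm r0).
have -> : 2^-1 * (D - rh) * (b ^+ 2 - a ^+ 2) = 2^-1 * (b * b * (D - rh) - a * a * (D - rh)) by ring.
have -> : a ^+ 2 * B p p - 2 * a * b * B p (nu p) + b ^+ 2 * B (nu p) (nu p) =
  a * a * B p p - 2 * (a * b * B p (nu p)) + b * b * B (nu p) (nu p) by ring.
apply: (taylor_combine _ c1 c2 q1 q2 q3 (le_trans q4 _) (le_trans q5 _)).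
- by rewrite (mulrA rh) mulrAC.
- exact: ler_wpM2l Z0 _ _ Dr.
- exact: ler_wpM2l Z0 _ _ Dr.
- apply: (@le_trans _ _ (L * (sg * y ^+ 2))); last first.
    by rewrite mulrA (mulrC L) (mulrA rh) ler_wpM2r // sqr_ge0.
  by rewrite ler_wpM2r // /L /K lerDl.
Qed.

(* In the eigenframe, the parabola <q - p, horo p> = sum (kappa_i - 1) x_i^2 / 2 is tested
   against the linear form <., v>; the optimal displacement is x_i = - <e_i, v> / (P (kappa_i - 1)). *)
Lemma support_lower p (e : 'I_n -> E) (kappa : 'I_n -> R) z v u (P eta : R) : bnd Omega p ->
  is_frame p (nu p) e ->
  (forall i j, lor (vdir nu (e i) p) (e j) = kappa i * (i == j)%:R) ->
  (forall i, 1 < kappa i) -> 0 < P -> z = P *: horo p -> 0 < eta ->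
  \forall t \near at0, exists2 q, bnd Omega q &
    - lor p (z + t *: v + t ^+ 2 *: u) +
      t ^+ 2 * ((2 * P)^-1 * (\sum_i lor (e i) v ^+ 2 / (kappa i - 1)) - eta) <=
    - lor q (z + t *: v + t ^+ 2 *: u).
Proof.
move=> bp ef ev k1 P0 zE eta0; have [pe ne ee ex] := ef; have hp := bnd_hyp bp.
pose w := \sum_i (- lor (e i) v / (P * (kappa i - 1))) *: e i.
have ew i : lor (e i) w = - lor (e i) v / (P * (kappa i - 1)).
  rewrite lor_sumr (bigD1 i) //= big1 => [|j ji]; first by rewrite lorZr ee eqxx mulr1 addr0.
  by rewrite lorZr ee eq_sym (negbTE ji) mulr0.
have pw : lor p w = 0 by rewrite lor_sumr big1 // => i _; rewrite lorZr pe mulr0.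
have wn : lor w (nu p) = 0 by rewrite lorC lor_sumr big1 // => i _; rewrite lorZr ne mulr0.
have vw : lor v w = - (P^-1 * \sum_i lor (e i) v ^+ 2 / (kappa i - 1)).
  rewrite lor_sumr mulr_sumr -sumrN; apply: eq_bigr => i _; rewrite lorZr (lorC v).
  by field; rewrite subr_eq0 !gt_eqF.
have [q [bq qe]] := tangent_seq bp pw wn; have qp := quotient_cvg qe.
pose e1 := eta / (2 * P * (`|w| ^+ 2 + 1)).
have e10 : 0 < e1 by rewrite divr_gt0 // !mulr_gt0 // ltr_wpDl ?sqr_ge0.
have [d d0 Hd] := boundary_taylor bp ef ev e10.
pose Q := \sum_i lor (e i) v ^+ 2 / (kappa i - 1).
pose G t := - (P * (2^-1 * \sum_i (kappa i - 1) * lor (e i) (t^-1 *: (q t - p)) ^+ 2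
    + e1 * `|t^-1 *: (q t - p)| ^+ 2)) - lor v (t^-1 *: (q t - p)) - t * lor u (t^-1 *: (q t - p)).
have GL : G t @[t --> at0] --> - (P * (2^-1 * \sum_i (kappa i - 1) * lor (e i) w ^+ 2
    + e1 * `|w| ^+ 2)) - lor v w - 0 * lor u w.
  have lc x : lor x (t^-1 *: (q t - p)) @[t --> at0] --> lor x w.
    exact: (lor_cvg _ (cvg_cst x) qe).
  apply: cvgB; last by apply: cvgM; [exact: at0_cvg0|exact: lc].
  apply: cvgB; last exact: lc.
  apply: cvgN; apply: cvgM; first exact: cvg_cst.
  apply: cvgD; apply: cvgM; try exact: cvg_cst.
    apply: cvg_sum => i; apply: cvgM; first exact: cvg_cst.
    by rewrite !expr2; apply: cvgM; exact: lc.
  by rewrite !expr2; apply: cvgM; exact: cvg_norm.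
have Gv : (2 * P)^-1 * Q - eta < - (P * (2^-1 * \sum_i (kappa i - 1) * lor (e i) w ^+ 2
    + e1 * `|w| ^+ 2)) - lor v w - 0 * lor u w.
  have -> : \sum_i (kappa i - 1) * lor (e i) w ^+ 2 = P^-1 ^+ 2 * Q.
    rewrite mulr_sumr; apply: eq_bigr => i _; rewrite ew.
    by field; rewrite subr_eq0 !gt_eqF.
  rewrite vw -/Q mul0r subr0.
  have h : P * (e1 * `|w| ^+ 2) < eta.
    have w0 := sqr_ge0 `|w|; rewrite /e1; move: (`|w| ^+ 2) w0 => W W0.
    have -> : P * (eta / (2 * P * (W + 1)) * W) = eta * (W / (2 * (W + 1))).
      by field; rewrite (gt_eqF P0) gt_eqF // ltr_wpDl.
    by rewrite gtr_pMr // ltr_pdivrMr; lra.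
  rewrite [P * (_ + _)]mulrDr.
  have -> : P * (2^-1 * (P^-1 ^+ 2 * Q)) = 2^-1 * (P^-1 * Q) by field; rewrite gt_eqF.
  by rewrite invfM -mulrA; lra.
near=> t.
have t0 : 0 < t by [].
have bqt : bnd Omega (q t) by near: t.
exists (q t) => //.
have qd : `|q t - p| < d by rewrite distrC; near: t; move/cvgrPdist_lt: qp; apply.
have Gt : (2 * P)^-1 * Q - eta < G t by near: t; exact: cvgr_gt GL _ Gv.
have := Hd _ bqt qd; rewrite ler_norml => /andP[_].
have -> : - lor (q t) (z + t *: v + t ^+ 2 *: u) = - lor p (z + t *: v + t ^+ 2 *: u)
   - lor (q t - p) (z + t *: v + t ^+ 2 *: u) by rewrite lorDl lorNl; ring.
rewrite lerD2l zE !lorDr !lorZr; move: Gt; rewrite /G.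
set x := q t - p => Gt hx.
have := ltW Gt; rewrite -(ler_pM2l (exprn_gt0 2 t0)) -/Q => Gt'; apply: le_trans Gt' _.
have -> : \sum_i (kappa i - 1) * lor (e i) (t^-1 *: x) ^+ 2 =
  t^-1 ^+ 2 * \sum_i (kappa i - 1) * lor (e i) x ^+ 2.
  by rewrite mulr_sumr; apply: eq_bigr => i _; rewrite lorZr; ring.
rewrite normrZ exprMn gtr0_norm ?invr_gt0 // !lorZr (lorC v) (lorC u).
have -> : t ^+ 2 * (- (P * (2^-1 * (t^-1 ^+ 2 * (\sum_i (kappa i - 1) * lor (e i) x ^+ 2)) +
   e1 * (t^-1 ^+ 2 * `|x| ^+ 2))) - t^-1 * lor x v - t * (t^-1 * lor x u)) =
   - (P * (2^-1 * \sum_i (kappa i - 1) * lor (e i) x ^+ 2 + e1 * `|x| ^+ 2)) - t * lor x v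
   - t ^+ 2 * lor x u.
  by field; rewrite gt_eqF.
have : P * lor x (horo p) <= P * (2^-1 * \sum_i (kappa i - 1) * lor (e i) x ^+ 2 + e1 * `|x| ^+ 2).
  rewrite ler_pM2l // -lerBlDl; exact: hx.
by lra.
Unshelve. all: by end_near. Qed.

(** Near [p] the components of the chord along [p] and [nu p] contribute at most half of its norm.
    The tangential part [w] thus satisfies |x| <= 2 |w|, and [tangent_norm] turns this into the
    constant 4 p_0^2. *)
Lemma chord_coercive p (e : 'I_n -> E) : bnd Omega p -> is_frame p (nu p) e ->
  exists C d, [/\ 0 < C, 0 < d & forall q, bnd Omega q -> `|q - p| < d ->
    `|q - p| ^+ 2 <= C * \sum_i lor (e i) (q - p) ^+ 2].
Proof.
move=> bp ef; have hp := bnd_hyp bp; have [pn nn] := normal_props Hnu bp.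
have [pe ne ee ex] := ef.
pose M := `|p| + `|nu p| + 1.
have M0 : 0 < M by rewrite ltr_wpDl // addr_ge0.
have s0 : 0 < (2 * M)^-1 by rewrite invr_gt0 mulr_gt0.
have [d d0 Hd] := small_defect bp s0.
exists (4 * p 0 0 ^+ 2), d; split => //.
  by rewrite mulr_gt0 // exprn_gt0 //; have [] := hp.
move=> q bq qd; have := Hd q bq qd; move: (q - p) => x {qd}.
set a := lor p x; set b := lor (nu p) x => hab.
pose w := x + a *: p - b *: nu p.
have pw : lor p w = 0 by rewrite /w !lorDr lorNr !lorZr hp.1 pn -/a; ring.
have ew i : lor (e i) w = lor (e i) x.
  by rewrite /w !lorDr lorNr !lorZr !(lorC (e i)) pe ne !mulr0 addr0 subr0.
have nw : lor (nu p) w = 0 by rewrite /w !lorDr lorNr !lorZr nn [lor (nu p) p]lorC pn -/b; ring.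
have ww : lor w w = \sum_i lor (e i) x ^+ 2.
  rewrite {1}(ex w) pw nw oppr0 !scale0r !add0r lor_suml.
  by apply: eq_bigr => i _; rewrite lorZl !ew expr2.
have hw := tangent_norm hp pw.
have xw : `|x| <= 2 * `|w|.
  have : `|x| <= `|w| + (`|a| * `|p| + `|b| * `|nu p|).
    have -> : x = w + (b *: nu p - a *: p) by rewrite /w; apply/rowP => i; rewrite !mxE; ring.
    rewrite (le_trans (ler_normD _ _)) // lerD2l (le_trans (ler_normB _ _)) //.
    by rewrite !normrZ addrC.
  have : `|a| * `|p| + `|b| * `|nu p| <= (`|a| + `|b|) * M.
    rewrite mulrDl lerD // ler_wpM2l // /M.
      by rewrite -addrA lerDl addr_ge0.
    by rewrite addrAC lerDr addr_ge0.
  have : (`|a| + `|b|) * M <= `|x| / 2.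
    have -> : `|x| / 2 = (2 * M)^-1 * `|x| * M by field; rewrite gt_eqF.
    by rewrite ler_wpM2r // ltW.
  by lra.
rewrite -ww; apply: (@le_trans _ _ (4 * `|w| ^+ 2)); last by rewrite -mulrA ler_pM2l.
have -> : 4 * `|w| ^+ 2 = (2 * `|w|) ^+ 2 by ring.
by rewrite ler_pXn2r // nnegrE // mulr_ge0.
Qed.

(** The counterpart of [support_lower] for any points q t -> p that do at least as well as [p]. In
    each eigendirection the difference from the claimed bound is a completed square ([T4]); the
    remaining errors ([T1], [T2], [T3]) receive eta / 3 each. *)
Lemma support_upper p (e : 'I_n -> E) (kappa : 'I_n -> R) z v u (P eta : R) (q : R -> E) :
  bnd Omega p -> is_frame p (nu p) e ->
  (forall i j, lor (vdir nu (e i) p) (e j) = kappa i * (i == j)%:R) ->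
  (exists2 eps : R, 0 < eps & forall i, 1 + eps <= kappa i) ->
  0 < P -> z = P *: horo p -> 0 < eta ->
  q t @[t --> at0] --> p ->
  (\forall t \near at0, bnd Omega (q t) /\
    lor (q t) (z + t *: v + t ^+ 2 *: u) <= lor p (z + t *: v + t ^+ 2 *: u)) ->
  \forall t \near at0,
    - lor (q t) (z + t *: v + t ^+ 2 *: u) <=
    - lor p (z + t *: v + t ^+ 2 *: u) +
      t ^+ 2 * ((2 * P)^-1 * (\sum_i lor (e i) v ^+ 2 / (kappa i - 1)) + eta).
Proof.
move=> bp ef ev [eps eps0 keps] P0 zE eta0 qp bq; have [pe ne ee ex] := ef; have hp := bnd_hyp bp.
have k0 i : 0 < kappa i - 1 by have := keps i; lra.
have [C [d1 [C0 d10 HC]]] := chord_coercive bp ef.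
pose N := n.+2%:R : R; have N0 : 0 < N by rewrite ltr0n.
pose C1 := N * (`|v| + `|u| + 1) * (4 * C) / (eps * P).
have C10 : 0 < C1 by rewrite divr_gt0 ?mulr_gt0 // ltr_wpDl // addr_ge0.
pose e1 := Num.min (eps / (4 * C)) (eta / 3 / (P * C1 ^+ 2)).
have e10 : 0 < e1 by rewrite lt_min !divr_gt0 // mulr_gt0 // exprn_gt0.
pose A := `|lor p v| + `|lor (nu p) v| + 1.
have A0 : 0 < A by rewrite ltr_wpDl // addr_ge0.
pose sg := eta / 3 / (C1 * A).
have s0 : 0 < sg by rewrite !divr_gt0 // mulr_gt0.
have [d2 d20 Hd2] := boundary_taylor bp ef ev e10.
have [d3 d30 Hd3] := small_defect bp s0.
pose t1 := Num.min 1 (eta / 3 / (N * C1 * (`|u| + 1))).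
have u1 : 0 < `|u| + 1 by rewrite ltr_wpDl.
have t10 : 0 < t1 by rewrite lt_min ltr01 /=; apply: divr_gt0; [exact: divr_gt0|exact: mulr_gt0 (mulr_gt0 N0 C10) u1].
have near_d d : 0 < d -> \forall t \near at0, `|q t - p| < d.
  by move=> d0; move/cvgrPdist_lt: qp => /(_ d d0); apply: filterS => t; rewrite distrC.
apply: filterS3 (filterI bq (near_at0 t10)) (filterI (near_d _ d10) (near_d _ d20)) (near_d _ d30).
move=> t [[bqt le_t] /andP[t0 tt1]] [qd1 qd2] qd3.
have := HC _ bqt qd1; have := Hd2 _ bqt qd2; have := Hd3 _ bqt qd3.
have -> : - lor (q t) (z + t *: v + t ^+ 2 *: u) = - lor p (z + t *: v + t ^+ 2 *: u)
   - lor (q t - p) (z + t *: v + t ^+ 2 *: u) by rewrite lorDl lorNl; ring.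
have : lor (q t - p) (z + t *: v + t ^+ 2 *: u) <= 0 by rewrite lorDl lorNl subr_le0.
move: (q t - p) => {qd1 qd2 qd3 le_t bqt} x.
have bv := lor_bound x v; have bu := lor_bound x u; rewrite -/N in bv bu.
have vE : lor x v = - lor p x * lor p v + lor (nu p) x * lor (nu p) v
     + \sum_i lor (e i) x * lor (e i) v.
  by rewrite {1}(ex x) !lorDl !lorZl lor_suml; congr (_ + _); apply: eq_bigr => i _; rewrite lorZl.
rewrite zE !lorDr !lorZr lerD2l => neg h3 h2 h1.
have SS : eps * \sum_i lor (e i) x ^+ 2 <= \sum_i (kappa i - 1) * lor (e i) x ^+ 2.
  rewrite mulr_sumr; apply: ler_sum => i _; rewrite ler_wpM2r ?sqr_ge0 //.
  by have := keps i; lra.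
have [e1a e1b] : e1 <= eps / (4 * C) /\ e1 * (P * C1 ^+ 2) <= eta / 3.
  have h : 0 < P * C1 ^+ 2 by exact: mulr_gt0 P0 (exprn_gt0 2 C10).
  by split; [|rewrite -(ler_pdivlMr _ _ h)]; rewrite /e1 ge_min lexx ?orbT.
have [ta tb] : t <= 1 /\ t * (N * C1 * (`|u| + 1)) <= eta / 3.
  have h : 0 < N * C1 * (`|u| + 1) by exact: mulr_gt0 (mulr_gt0 N0 C10) u1.
  rewrite -(ler_pdivlMr _ _ h).
  by move: tt1; rewrite /t1 lt_min => /andP[/ltW ? /ltW ?].
have sA : sg * (C1 * A) = eta / 3 by rewrite /sg divfK // gt_eqF // mulr_gt0.
have x0 := normr_ge0 x.
(* coercivity and maximality of q t give [`|q t - p| = O(t)] *)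
have xt : `|x| <= C1 * t.
  have low : eps / (4 * C) * `|x| ^+ 2 <= lor x (horo p).
    have : eps / (2 * C) * `|x| ^+ 2 <= 2^-1 * (eps * \sum_i lor (e i) x ^+ 2).
      have -> : 2^-1 * (eps * \sum_i lor (e i) x ^+ 2) = eps / (2 * C) * (C * \sum_i lor (e i) x ^+ 2).
        by field; rewrite gt_eqF.
      by rewrite ler_wpM2l // divr_ge0 ?mulr_ge0 // ltW.
    have : e1 * `|x| ^+ 2 <= eps / (4 * C) * `|x| ^+ 2 by rewrite ler_wpM2r // sqr_ge0.
    have -> : eps / (2 * C) = 2 * (eps / (4 * C)) by field; rewrite gt_eqF.
    by move: h2; rewrite ler_norml => /andP[]; lra.
  have up : P * lor x (horo p) <= t * (N * (`|v| + `|u| + 1) * `|x|).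
    have hv : - (t * lor x v) <= t * (N * `|x| * `|v|).
      by rewrite -mulrN ler_pM2l // (le_trans (ler_norm _)) // normrN.
    have hu : - (t ^+ 2 * lor x u) <= t * (N * `|x| * `|u|).
      rewrite -mulrN (le_trans (ler_norm _)) // normrM normrN (gtr0_norm (exprn_gt0 2 t0)).
      by rewrite ler_pM // ?sqr_ge0 // expr2 ger_pMr.
    have : 0 <= t * (N * `|x|) by rewrite !mulr_ge0 // ltW.
    by lra.
  have [->|xn] := eqVneq x 0; first by rewrite normr0 mulr_ge0 // ltW.
  have xp : 0 < `|x| by rewrite normr_gt0.
  rewrite -(ler_pM2r xp) -expr2.
  have -> : C1 * t * `|x| = (4 * C) / (eps * P) * (t * (N * (`|v| + `|u| + 1) * `|x|)).
    by rewrite /C1; field; rewrite !gt_eqF.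
  apply: (@le_trans _ _ (4 * C / (eps * P) * (P * (eps / (4 * C) * `|x| ^+ 2)))).
    by rewrite le_eqVlt; apply/orP; left; apply/eqP; field; rewrite !gt_eqF.
  rewrite ler_wpM2l ?divr_ge0 ?mulr_ge0 ?(ltW C0) ?(ltW eps0) ?(ltW P0) //.
  by apply: le_trans up; rewrite ler_pM2l.
have T1 : P * (e1 * `|x| ^+ 2) <= t ^+ 2 * (eta / 3).
  apply: (@le_trans _ _ (P * (e1 * (C1 * t) ^+ 2))).
    by rewrite ler_pM2l // ler_pM2l // ler_pXn2r // nnegrE // mulr_ge0 // ltW.
  have -> : P * (e1 * (C1 * t) ^+ 2) = t ^+ 2 * (e1 * (P * C1 ^+ 2)) by ring.
  by rewrite ler_pM2l // exprn_gt0.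
have T2 : - (t ^+ 2 * lor x u) <= t ^+ 2 * (eta / 3).
  rewrite -mulrN ler_pM2l ?exprn_gt0 // (le_trans (ler_norm _)) // normrN (le_trans bu) //.
  apply: le_trans tb; have -> : t * (N * C1 * (`|u| + 1)) = N * (C1 * t) * (`|u| + 1) by ring.
  by rewrite ler_pM ?mulr_ge0 ?ler_pM2l ?(ltW N0) // lerDl.
have T3 : - (t * (- lor p x * lor p v + lor (nu p) x * lor (nu p) v)) <= t ^+ 2 * (eta / 3).
  have -> : t ^+ 2 * (eta / 3) = t * ((sg * (C1 * t)) * A) by rewrite -sA; ring.
  rewrite -mulrN ler_pM2l // (le_trans (ler_norm _)) // normrN (le_trans (ler_normD _ _)) //.
  rewrite !normrM normrN.
  have : `|lor p x| * `|lor p v| + `|lor (nu p) x| * `|lor (nu p) v| <=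
     (`|lor p x| + `|lor (nu p) x|) * A.
    rewrite mulrDl lerD // ler_wpM2l // /A.
      by rewrite -addrA lerDl addr_ge0.
    by rewrite addrAC lerDr addr_ge0.
  move=> h; apply: le_trans h _; rewrite ler_wpM2r ?(ltW A0) // (le_trans h3) //.
  by rewrite ler_pM2l.
have T4 : - (P * (2^-1 * \sum_i (kappa i - 1) * lor (e i) x ^+ 2)) - t * \sum_i lor (e i) x * lor (e i) v
   <= t ^+ 2 * ((2 * P)^-1 * \sum_i lor (e i) v ^+ 2 / (kappa i - 1)).
  rewrite !mulr_sumr -sumrN -sumrB; apply: ler_sum => i _.
  rewrite -subr_ge0; move: (lor (e i) x) (lor (e i) v) => s w.
  have -> : t ^+ 2 * ((2 * P)^-1 * (w ^+ 2 / (kappa i - 1))) -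
     (- (P * (2^-1 * ((kappa i - 1) * s ^+ 2))) - t * (s * w)) =
     (P * (kappa i - 1) * s + t * w) ^+ 2 / (2 * P * (kappa i - 1)).
    by field; rewrite !gt_eqF.
  by rewrite divr_ge0 ?sqr_ge0 // !mulr_ge0 // ltW.
have low : P * (2^-1 * \sum_i (kappa i - 1) * lor (e i) x ^+ 2) - P * (e1 * `|x| ^+ 2) <= P * lor x (horo p).
  by rewrite -mulrBr ler_pM2l //; move: h2; rewrite ler_norml => /andP[]; lra.
rewrite vE; move: T1 T2 T3 T4 low; lra.
Qed.

(** * The horospherical support function *)

(** The mirror of a spacelike vector meets H: the time vector is projected orthogonally to [m] and
    normalised. Such a fixed point of the reflection shows that the reflection preserves the time
    orientation. *)
Lemma perp_hyp (m : E) : 0 < lor m m -> exists2 p : E, hyp p & lor m p = 0.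
Proof.
move=> mm; pose x := timevec - (lor m timevec / lor m m) *: m : E.
have mx : lor m x = 0 by rewrite /x lorDr lorNr lorZr divfK ?subrr // gt_eqF.
have tx : lor timevec x = -1 - lor m timevec ^+ 2 / lor m m.
  rewrite /x lorDr lorNr lorZr (lorC _ m) (@hyp_time R n).1; ring.
have t0 : 0 <= lor m (timevec : E) ^+ 2 / lor m m by rewrite divr_ge0 ?sqr_ge0 // ltW.
have xx : lor x x < 0.
  have -> : lor x x = lor timevec x.
    by rewrite {1}/x lorDl lorNl lorZl mx mulr0 subr0.
  by rewrite tx; move: t0; lra.
have [_ x0] : causal x by apply: (causal_future hyp_time); rewrite ?tx ?(ltW xx) //; move: t0; lra.
by exists (nrm x); [exact: nrm_hyp|rewrite lorC nrm_lor lorC mx mul0r].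
Qed.

Lemma refl_null (m z : E) : 0 < lor m m -> null z -> null (refl m z).
Proof.
move=> mm [zz z0]; have [p hp mp] := perp_hyp mm; have h0 : lor (refl m z) (refl m z) = 0 by rewrite refl_lor.
split => //; have [] // : causal (refl m z); apply: (causal_future hp); first by rewrite h0.
by rewrite lorC refl_lorC (refl_perp mp) lorC; apply: (causal_lt0 hp); exact: null_causal.
Qed.

Lemma refl_hyp (m x : E) : 0 < lor m m -> hyp x -> hyp (refl m x).
Proof.
move=> mm hx; have [p hp mp] := perp_hyp mm.
have h0 : lor (refl m x) (refl m x) = -1 by rewrite refl_lor; case: hx.
split => //; have [] // : causal (refl m x); apply: (causal_future hp); first by rewrite h0 lerN10.
by rewrite lorC refl_lorC (refl_perp mp) lorC; apply: (causal_lt0 hp); exact: hyp_causal.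
Qed.

Lemma nullZ (k : R) (z : E) : 0 < k -> null z -> null (k *: z).
Proof. by move=> k0 [zz z0]; split; rewrite ?mxE ?mulr_gt0 // lorZl lorZr zz !mulr0. Qed.

Lemma lor_quad (a x y w : E) (t : R) :
  lor a (x + t *: y + t ^+ 2 *: w) = lor a x + t * lor a y + t ^+ 2 * lor a w.
Proof. by rewrite !lorDr !lorZr. Qed.

(* Meaningful for null z only: supp z is the maximum of - <., z> on the closure, touch z the unique
   point where it is attained. *)
Definition touch z : E := sval (cid (touching_exists z)).
Definition supp z : R := - lor (touch z) z.

Section Support.
Variable z : E.
Hypothesis nz : null z.

Lemma touchP : [/\ bnd Omega (touch z), z = supp z *: horo (touch z) &
  forall q, closure Omega q -> - lor q z <= supp z /\ (supp z <= - lor q z -> q = touch z)].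
Proof.
have [h1 h2 h3] := svalP (cid (touching_exists z)) nz; split => // q cq.
by have [h4 h5] := h3 q cq; rewrite !lerN2.
Qed.

Lemma touch_bnd : bnd Omega (touch z). Proof. by case: touchP. Qed.

Lemma supp_gt0 : 0 < supp z.
Proof. rewrite oppr_gt0; exact: causal_lt0 (bnd_hyp touch_bnd) (null_causal nz). Qed.

Lemma supp_ge q : closure Omega q -> - lor q z <= supp z.
Proof. by case: touchP => _ _ h /h[]. Qed.

Lemma touch_unique q : closure Omega q -> supp z <= - lor q z -> touch z = q.
Proof. by case: touchP => _ _ h /h[_] h2 /h2. Qed.

Lemma touchZ (k : R) : 0 < k -> touch (k *: z) = touch z.
Proof.
move=> k0; have [b1 _ h1] : [/\ bnd Omega (touch (k *: z)), k *: z = supp (k *: z) *: horo (touch (k *: z)) &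
  forall q, closure Omega q -> - lor q (k *: z) <= supp (k *: z) /\
    (supp (k *: z) <= - lor q (k *: z) -> q = touch (k *: z))].
  have [a1 a2 a3] := svalP (cid (touching_exists (k *: z))) (nullZ k0 nz); split => // q cq.
  by have [h4 h5] := a3 q cq; rewrite !lerN2.
symmetry; apply: touch_unique; first by case: b1.
have [h _] := h1 _ touch_bnd.1.
by rewrite -(ler_pM2l k0); move: h; rewrite /supp !lorZr !mulrN.
Qed.

Lemma suppZ (k : R) : 0 < k -> supp (k *: z) = k * supp z.
Proof. by move=> k0; rewrite /supp touchZ // lorZr mulrN. Qed.

End Support.

Lemma touch_horo p : bnd Omega p -> touch (horo p) = p.
Proof.
move=> bp; have [nh hp] := horo_null bp; apply: touch_unique => //; first by case: bp.
have [h _] := horo_support bp (touch_bnd nh).1.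
by rewrite hp opprK /supp lerNl.
Qed.

Lemma supp_lip : exists2 C, 0 < C & forall z z', null z -> null z' -> supp z <= supp z' + C * `|z - z'|.
Proof.
have [K [K0 HK]] := Omega_bounded.
exists (n.+2%:R * K); first by rewrite mulr_gt0 ?ltr0n.
move=> z z' nz nz'; have bt := touch_bnd nz.
have -> : supp z = - lor (touch z) z' - lor (touch z) (z - z').
  by rewrite /supp lorDr lorNr; ring.
rewrite lerD //; first exact: (supp_ge nz' bt.1).
rewrite (le_trans (ler_norm _)) // normrN (le_trans (lor_bound _ _)) //.
by rewrite ler_wpM2r // ler_wpM2l // HK //; case: bt.
Qed.

Lemma supp_cvg {T : Type} (F : set_system T) (u : T -> E) z : Filter F -> null z ->
  (\forall t \near F, null (u t)) -> u t @[t --> F] --> z -> supp (u t) @[t --> F] --> supp z.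
Proof.
move=> FF nz nu_ uz; have [C C0 HC] := supp_lip; apply/cvgrPdist_le => e e0.
have e1 : 0 < e / C by rewrite divr_gt0.
move/cvgrPdist_le: uz => /(_ _ e1); apply: filterS2 nu_ => t nt h.
have h1 := HC _ _ nz nt; have h2 := HC _ _ nt nz; rewrite distrC in h2.
have : C * `|z - u t| <= e by rewrite mulrC -ler_pdivlMr.
by rewrite ler_norml; move=> h3; apply/andP; split; move: h1 h2 h3; lra.
Qed.

(** A unique maximiser over a compact set depends continuously on the data. Off a neighbourhood of
    [touch z] the values of - <., z> stay below [supp z] by 2 g, and a perturbation that changes
    values by less than g cannot make up for this. *)
Lemma touch_cvg {T : Type} (F : set_system T) (u : T -> E) z : Filter F -> null z ->
  (\forall t \near F, null (u t)) -> u t @[t --> F] --> z -> touch (u t) @[t --> F] --> touch z.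
Proof.
move=> FF nz nu_ uz W; rewrite nbhsE => -[U [oU Uz] UW].
have cK : compact (closure Omega `&` ~` U).
  apply: (subclosed_compact _ closure_compact) => [|x []//].
  by apply: closedI; [exact: closed_closure|exact: open_closedC].
have [K0|/set0P K0] := eqVneq (closure Omega `&` ~` U) set0.
  apply: filterS nu_ => t nt; apply: UW; apply: contrapT => nU.
  have : (closure Omega `&` ~` U) (touch (u t)) by split => //; have [] := touch_bnd nt.
  by rewrite K0.
have [q [cq nUq] qmax] : exists2 q, (closure Omega `&` ~` U) q &
    forall x, (closure Omega `&` ~` U) x -> - lor x z <= - lor q z.
  apply: compact_max cK _ => // x _; have h : lor y z @[y --> x] --> lor x z.
    by under eq_fun do rewrite lorC; rewrite lorC; exact: lor_continuous.
  exact: (cvgN h).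
have qs : - lor q z < supp z.
  rewrite lt_neqAle (supp_ge nz cq) andbT; apply: contra_notN nUq => /eqP h.
  by rewrite -(touch_unique nz cq) // h.
have sc := supp_cvg FF nz nu_ uz.
have [B [B0 HB]] := Omega_bounded.
pose g := (supp z + lor q z) / 2; have g0 : 0 < g by rewrite divr_gt0 //; move: qs; lra.
have e1 : 0 < g / (n.+2%:R * B) by rewrite divr_gt0 // mulr_gt0 ?ltr0n.
have s1 : \forall t \near F, supp z - g < supp (u t) by apply: (cvgr_gt _ sc); move: g0; lra.
move/cvgrPdist_lt: uz => /(_ _ e1); apply: filterS3 nu_ s1 => t nt st ut.
apply: UW; apply: contrapT => nU; have ct := (touch_bnd nt).1.
have h1 := qmax _ (conj ct nU).
have : supp (u t) <= - lor (touch (u t)) z + g.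
  have -> : supp (u t) = - lor (touch (u t)) z + lor (touch (u t)) (z - u t).
    by rewrite /supp lorDr lorNr; ring.
  rewrite lerD2l (le_trans (ler_norm _)) // (le_trans (lor_bound _ _)) //.
  rewrite (@le_trans _ _ (n.+2%:R * B * `|z - u t|)) //.
    by rewrite ler_wpM2r // ler_wpM2l // HB.
  by rewrite mulrC -ler_pdivlMr ?mulr_gt0 ?ltr0n // ltW.
by move: h1 st; rewrite /g; lra.
Qed.

Definition frame_data p (e : 'I_n -> E) (kappa : 'I_n -> R) :=
  [/\ is_frame p (nu p) e, principal_curvatures nu p kappa,
    forall i j, lor (vdir nu (e i) p) (e j) = kappa i * (i == j)%:R,
    forall i j : 'I_n, (i <= j)%N -> kappa i <= kappa j &
    exists2 eps : R, 0 < eps & forall i, 1 + eps <= kappa i].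

Lemma frame_data_exists p : bnd Omega p -> exists e kappa, frame_data p e kappa.
Proof.
move=> bp; have [e [kappa [h1 h2 h3 h4]]] := eigenframe bp; exists e, kappa; split => //.
by have [eps eps0 Heps] := Hhc; exists eps => // i; exact: Heps bp h2 i.
Qed.

(** The coefficient of t^2 in [supp] along z + t v + t^2 u, apart from the term - <touch z, u>. *)
Definition supp_hess (e : 'I_n -> E) (kappa : 'I_n -> R) (S : R) v : R :=
  (2 * S)^-1 * \sum_i lor (e i) v ^+ 2 / (kappa i - 1).

Lemma supp_upper z v u e kappa (eta : R) : null z -> frame_data (touch z) e kappa -> 0 < eta ->
  (\forall t \near at0, null (z + t *: v + t ^+ 2 *: u)) ->
  \forall t \near at0, supp (z + t *: v + t ^+ 2 *: u) <=
    - lor (touch z) (z + t *: v + t ^+ 2 *: u) + t ^+ 2 * (supp_hess e kappa (supp z) v + eta).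
Proof.
move=> nz [ef _ ev _ ek] eta0 nc; have [bp zE _] := touchP nz.
apply: (support_upper bp ef ev ek (supp_gt0 nz) zE eta0).
  apply: (touch_cvg _ nz nc).
  have c0 := @at0_cvg0 R.
  have L : z + t *: v + t ^+ 2 *: u @[t --> at0] --> z + (0 : R) *: v + (0 : R) ^+ 2 *: u.
    apply: cvgD; first (apply: cvgD; first exact: cvg_cst).
      by apply: cvgZ => //; exact: cvg_cst.
    by apply: cvgZ; [rewrite !expr2; apply: cvgM|exact: cvg_cst].
  by move: L; rewrite expr0n !scale0r !addr0.
apply: filterS nc => t nt; split; first exact: touch_bnd.
by rewrite -lerN2; exact: (supp_ge nt bp.1).
Qed.

Lemma supp_lower z v u e kappa (eta : R) : null z -> frame_data (touch z) e kappa -> 0 < eta ->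
  (\forall t \near at0, null (z + t *: v + t ^+ 2 *: u)) ->
  \forall t \near at0,
    - lor (touch z) (z + t *: v + t ^+ 2 *: u) + t ^+ 2 * (supp_hess e kappa (supp z) v - eta) <=
    supp (z + t *: v + t ^+ 2 *: u).
Proof.
move=> nz [ef _ ev _ [eps eps0 ek]] eta0 nc; have [bp zE _] := touchP nz.
have k1 i : 1 < kappa i by apply: lt_le_trans (ek i); rewrite ltrDl.
apply: filterS2 nc (support_lower v u bp ef ev k1 (supp_gt0 nz) zE eta0) => t nt [q bq h].
by apply: le_trans h _; exact: (supp_ge nt bq.1).
Qed.

(** * Comparison of the support function with its mirror image *)

Section Reflection.
Variable m : E.
Hypothesis mm : 0 < lor m m.

(* supp o refl m is the support function of the reflected domain, and - gap the gradient of diff. *)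
Definition diff z : R := supp z - supp (refl m z).
Definition gap z : E := touch z - refl m (touch (refl m z)).

Lemma diff_gap z : diff z = - lor (gap z) z.
Proof. by rewrite /diff /gap /supp lorDl lorNl refl_lorC; ring. Qed.

Lemma diff_upper z v u e kappa e' kappa' (eta : R) : null z ->
  frame_data (touch z) e kappa -> frame_data (touch (refl m z)) e' kappa' -> 0 < eta ->
  (\forall t \near at0, null (z + t *: v + t ^+ 2 *: u)) ->
  \forall t \near at0, diff (z + t *: v + t ^+ 2 *: u) <=
    diff z - t * lor (gap z) v - t ^+ 2 * lor (gap z) u +
    t ^+ 2 * (supp_hess e kappa (supp z) v - supp_hess e' kappa' (supp (refl m z)) (refl m v) + eta).
Proof.
move=> nz d1 d2 eta0 nc; have nz' := refl_null mm nz.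
have rc t : refl m (z + t *: v + t ^+ 2 *: u) = refl m z + t *: refl m v + t ^+ 2 *: refl m u.
  by rewrite !reflD !reflZ.
have nc' : \forall t \near at0, null (refl m z + t *: refl m v + t ^+ 2 *: refl m u).
  by apply: filterS nc => t; rewrite -rc; exact: refl_null.
have eta2 : 0 < eta / 2 by rewrite divr_gt0.
apply: filterS2 (supp_upper nz d1 eta2 nc) (supp_lower nz' d2 eta2 nc') => t.
have g x : lor (gap z) x = lor (touch z) x - lor (touch (refl m z)) (refl m x).
  by rewrite /gap lorDl lorNl refl_lorC.
have dE : diff (z + t *: v + t ^+ 2 *: u) = supp (z + t *: v + t ^+ 2 *: u) -
  supp (refl m z + t *: refl m v + t ^+ 2 *: refl m u) by rewrite /diff rc.
have A1 : lor (touch z) (z + t *: v + t ^+ 2 *: u) =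
  lor (touch z) z + t * lor (touch z) v + t ^+ 2 * lor (touch z) u by exact: lor_quad.
have A2 : lor (touch (refl m z)) (refl m z + t *: refl m v + t ^+ 2 *: refl m u) =
  lor (touch (refl m z)) (refl m z) + t * lor (touch (refl m z)) (refl m v) +
  t ^+ 2 * lor (touch (refl m z)) (refl m u) by exact: lor_quad.
rewrite dE diff_gap !g A1 A2.
move: (supp (_ + _)) (supp (_ + _)) (supp_hess _ _ _ _) (supp_hess _ _ _ _) => s1 s2 q1 q2.
move: (lor (touch z) z) (lor (touch z) v) (lor (touch z) u) => x1 x2 x3.
move: (lor (touch _) (refl m z)) (lor (touch _) (refl m v)) (lor (touch _) (refl m u)) => y1 y2 y3; lra.
Qed.

Lemma cvg_le_small (a A : R) : (\forall t \near at0, t * a <= t ^+ 2 * A) -> a <= 0.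
Proof.
move=> h; have c : t * A @[t --> at0] --> (0 : R) * A by apply: cvgM; [exact: at0_cvg0|exact: cvg_cst].
rewrite -(mul0r A); apply: (ler_cvg_to (cvg_cst a) c); near=> t.
have t0 : 0 < t by [].
by rewrite -(ler_pM2l t0) mulrA -expr2; near: t.
Unshelve. all: by end_near. Qed.

(** A lower bound of slope [B1] is played against the upper expansion [diff_upper] as t -> 0+, in
    place of a derivative of [diff]. *)
Lemma diff_first z v u (B1 B2 : R) : null z ->
  (\forall t \near at0, null (z + t *: v + t ^+ 2 *: u)) ->
  (\forall t \near at0, diff z + t * B1 + t ^+ 2 * B2 <= diff (z + t *: v + t ^+ 2 *: u)) ->
  B1 <= - lor (gap z) v.
Proof.
move=> nz nc low.
have [e [kappa d1]] := frame_data_exists (touch_bnd nz).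
have [e' [kappa' d2]] := frame_data_exists (touch_bnd (refl_null mm nz)).
have up := diff_upper nz d1 d2 ltr01 nc.
rewrite -subr_le0.
apply: (@cvg_le_small _ (- lor (gap z) u + (supp_hess e kappa (supp z) v -
   supp_hess e' kappa' (supp (refl m z)) (refl m v) + 1) - B2)).
by apply: filterS2 low up => t; lra.
Qed.

(** The curves for [v] and [-v] share the acceleration [u]. Applied to both, the first-order
    argument gives an equality; adding the two expansions cancels the first-order terms and isolates
    those of order t^2. *)
Lemma diff_second z v u (B1 B2 : R) e kappa e' kappa' : null z ->
  frame_data (touch z) e kappa -> frame_data (touch (refl m z)) e' kappa' ->
  (\forall t \near at0, null (z + t *: v + t ^+ 2 *: u)) ->
  (\forall t \near at0, null (z + t *: (- v) + t ^+ 2 *: u)) ->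
  (forall eta, 0 < eta -> \forall t \near at0,
     diff z + t * B1 + t ^+ 2 * (B2 - eta) <= diff (z + t *: v + t ^+ 2 *: u)) ->
  (forall eta, 0 < eta -> \forall t \near at0,
     diff z - t * B1 + t ^+ 2 * (B2 - eta) <= diff (z + t *: (- v) + t ^+ 2 *: u)) ->
  lor (gap z) v = - B1 /\
  B2 + lor (gap z) u <= supp_hess e kappa (supp z) v -
    supp_hess e' kappa' (supp (refl m z)) (refl m v).
Proof.
move=> nz d1 d2 nc nc' low low'; split.
  have := diff_first nz nc (low _ ltr01).
  have : - B1 <= - lor (gap z) (- v).
    by apply: (@diff_first z (- v) u (- B1) (B2 - 1) nz nc'); apply: filterS (low' _ ltr01) => t; rewrite mulrN.
  by rewrite lorNr; lra.
have sN (f0 : 'I_n -> E) k S w : supp_hess f0 k S (- w) = supp_hess f0 k S w.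
  by congr (_ * _); apply: eq_bigr => i _; rewrite lorNr sqrrN.
apply/ler_addgt0Pr => eta eta0; have eta2 : 0 < eta / 2 by rewrite divr_gt0.
have up := diff_upper nz d1 d2 eta2 nc; have up' := diff_upper nz d1 d2 eta2 nc'.
have [t [[[h1 h2] [h3 h4]] /andP[t0 _]]] := filter_ex (filterI (filterI
  (filterI (low _ eta2) up) (filterI (low' _ eta2) up')) (near_at0 (@ltr01 R))).
have rN : refl m (- v) = - refl m v by rewrite -scaleN1r reflZ scaleN1r.
rewrite rN !sN lorNr in h4.
have := le_trans h1 h2; have := le_trans h3 h4.
move=> a1 a2; rewrite -(ler_pM2l (exprn_gt0 2 t0)).
move: (supp_hess _ _ _ _) (supp_hess _ _ _ _) (lor _ u) (diff z) a1 a2 => A B c d; lra.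
Qed.

End Reflection.

Lemma slice_null (a z : E) : hyp a -> lor z z = 0 -> lor a z = -1 -> null z.
Proof.
move=> ha zz az; split => //.
by have [] // := @causal_future _ _ a z ha; rewrite ?zz ?az.
Qed.

(** The slice <a, .> = -1 of the null cone is a compact sphere, and homogeneity lets every estimate
    be made on it with uniform constants. The lower bound on [supp] holds because [supp z] controls
    |z|, while <a, z> = -1 keeps |z| away from 0. *)
Lemma slice_bounds (a : E) : hyp a -> exists2 C : R, 1 <= C & forall z, null z -> lor a z = -1 ->
  [/\ `|z| <= C, supp z <= C & 1 <= C * supp z].
Proof.
move=> ha; have [K [K0 HK]] := Omega_bounded.
have a1 := hyp_ge1 ha; pose N := n.+2%:R : R; have N0 : 0 < N by rewrite ltr0n.
have na : 0 < `|a| by rewrite normr_gt0; apply: contraTneq a1 => ->; rewrite mxE -ltNge.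
have p1 : 0 < 2 * a 0 0 by rewrite mulr_gt0 // (lt_le_trans _ a1).
exists (1 + 2 * a 0 0 + N * K * (2 * a 0 0) + 2 * K * (N * `|a|)).
  by rewrite -!addrA lerDl !addr_ge0 // ?mulr_ge0 // ?(ltW N0) ?(ltW K0) // ltW // (lt_le_trans _ a1).
move=> z nz az; have bt := touch_bnd nz; have ht := bnd_hyp bt.
have zb : `|z| <= 2 * a 0 0.
  by have := causal_norm ha (null_causal nz); rewrite az opprK mulr1.
have t0 := ltW K0; have n0 := ltW N0; have q0 := ltW p1; have m0 := ltW na.
have x1 : 0 <= N * K * (2 * a 0 0) := mulr_ge0 (mulr_ge0 n0 t0) q0.
have x2 : 0 <= 2 * K * (N * `|a|) := mulr_ge0 (mulr_ge0 (ler0n R 2) t0) (mulr_ge0 n0 m0).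
have tK : `|touch z| <= K by apply: HK; case: bt.
split.
- by move: zb x1 x2; lra.
- have : supp z <= N * K * (2 * a 0 0).
    rewrite (le_trans (ler_norm _)) // normrN (le_trans (lor_bound _ _)) // -/N.
    by rewrite ler_pM ?mulr_ge0 // ler_wpM2l.
  by move: q0 x2; lra.
- have s0 := supp_gt0 nz.
  have h1 : `|z| <= 2 * K * supp z.
    apply: le_trans (causal_norm ht (null_causal nz)) _.
    rewrite -/(supp z) ler_wpM2r ?(ltW s0) // ler_wpM2l // (le_trans (ler_norm _)) //.
    exact: le_trans (rV_norm_coord _ _) tK.
  have h2 : 1 <= N * `|a| * `|z|.
    by have := lor_bound a z; rewrite az normrN normr1.
  apply: (@le_trans _ _ (2 * K * (N * `|a|) * supp z)).
    by apply: le_trans h2 _; rewrite [X in _ <= X]mulrAC mulrC ler_wpM2r // mulr_ge0.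
  by rewrite ler_wpM2r ?(ltW s0) //; move: q0 x1; lra.
Qed.

(** A vector orthogonal to z = P (p - nu p) has equal products with [p] and [nu p], so these two
    contributions cancel in the frame expansion. Two orthonormal families that differ modulo [z] are
    thus related by an orthogonal matrix. *)
Lemma frame_orth z p (e f : 'I_n -> E) : null z -> bnd Omega p -> z = - lor p z *: horo p ->
  is_frame p (nu p) e -> (forall j, lor (f j) z = 0) ->
  (forall i j, lor (f i) (f j) = (i == j)%:R) ->
  let U := (\matrix_(i, j) lor (e i) (f j) : 'M[R]_n) in U *m U^T = 1%:M.
Proof.
move=> nz bp zE [pe ne ee ex] fz ff U; apply: mulmx1C; apply/matrixP => j k; rewrite !mxE -ff.
have pf i : lor p (f i) = lor (nu p) (f i).
  have := fz i; rewrite zE horoE lorZr lorDr lorNr !(lorC (f i)) => /eqP.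
  rewrite mulf_eq0 oppr_eq0 (lt_eqF (causal_lt0 (bnd_hyp bp) (null_causal nz))) /=.
  by rewrite subr_eq0 => /eqP.
rewrite (ex (f j)) !lorDl !lorZl !pf lor_suml mulNr addNr add0r.
by apply: eq_bigr => i _; rewrite !mxE lorZl.
Qed.

(** * Uniform bounds from the curvature equation *)

Variables (o : E) (k : nat) (chi : R -> R).
Hypothesis ho : hyp o.
Hypothesis hk : (1 <= k <= n)%N.
Hypothesis chi_smooth : @smooth_on R R^o R^o [set t : R | 0 < t] chi.
Hypothesis chi_mono : forall s t : R, 0 < s -> s <= t -> chi s <= chi t.
Hypothesis Hcurv : forall p (kappa : 'I_n -> R), bnd Omega p ->
  principal_curvatures nu p kappa -> Ek k (shifted kappa) = chi (- lor o (horo p)).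

Lemma weight_continuous p : bnd Omega p -> {for p, continuous (fun p => - lor o (horo p))}.
Proof.
move=> bp; have h : lor o (horo y) @[y --> p] --> lor o (horo p).
  exact: (lor_cvg (nbhs_filter p) (cvg_cst o) (horo_continuous bp)).
exact: (cvgN h).
Qed.

Lemma weight_range : exists w1 w2 : R, 0 < w1 /\ forall p, bnd Omega p -> w1 <= - lor o (horo p) <= w2.
Proof.
have [[p0 bp0]|nb] := pselect (exists p, bnd Omega p); last first.
  by exists 1, 1; split => // p bp; case: nb; exists p.
have [p2 bp2 max2] := compact_max (ex_intro _ p0 bp0) bnd_compact weight_continuous.
have [p1 bp1 max1] : exists2 p1, bnd Omega p1 & forall p, bnd Omega p ->
   - - lor o (horo p) <= - - lor o (horo p1).
  apply: (compact_max (ex_intro _ p0 bp0) bnd_compact) => p bp; exact: (cvgN (weight_continuous bp)).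
exists (- lor o (horo p1)), (- lor o (horo p2)); split.
  by rewrite oppr_gt0; apply: (causal_lt0 ho); apply: null_causal; have [] := horo_null bp1.
by move=> p bp; rewrite max2 // andbT -lerN2 max1.
Qed.

Lemma chi_lip (a b : R) : 0 < a -> exists2 L : R, 0 <= L & forall s t, a <= s -> s <= t -> t <= b ->
  chi t - chi s <= L * (t - s).
Proof.
move=> a0; have [ba|ab] := ltP b a.
  by exists 0 => // s t as_ st tb; have := le_lt_trans (le_trans as_ (le_trans st tb)) ba; rewrite ltxx.
have [_ /(_ 1) [der [dc _]]] := chi_smooth 1.
have pos (x : R) : `[a, b]%classic x -> 0 < x by rewrite /= in_itv /= => /andP[ax _]; apply: lt_le_trans ax.
have [c cab cmax] : exists2 c, `[a, b]%classic c & forall x : R, `[a, b]%classic x ->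
   'D_1 (chi : R^o -> R^o) x <= 'D_1 (chi : R^o -> R^o) c.
  apply: compact_max (@segment_compact R a b) _; first by exists a; rewrite /= in_itv /= lexx.
  by move=> x /pos /dc.
exists `|'D_1 (chi : R^o -> R^o) c| => // s t as_ st tb.
have [->|sn] := eqVneq s t; first by rewrite !subrr mulr0.
have slt : s < t by rewrite lt_neqAle sn.
have drv (x : R) : x \in `]s, t[ -> is_derive (x : R^o) (1 : R^o) (chi : R^o -> R^o) ('D_1 (chi : R^o -> R^o) x).
  rewrite in_itv /= => /andP[sx _]; apply: DeriveDef => //; apply: der => /=.
  exact: lt_trans (lt_le_trans a0 as_) sx.
have cont : {within `[s, t], continuous chi}.
  apply: continuous_in_subspaceT => x; rewrite inE /= in_itv /= => /andP[sx _].
  have [h _] := chi_smooth 0; apply: h => /=.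
  exact: lt_le_trans (lt_le_trans a0 as_) sx.
have [x xst ->] := MVT slt drv cont.
rewrite ler_wpM2r ?subr_ge0 //; apply: le_trans (ler_norm _); apply: cmax.
move: xst; rewrite /= !in_itv /= => /andP[sx xt].
by rewrite (le_trans as_ (ltW sx)) (le_trans (ltW xt) tb).
Qed.

(** The lower bound is h-convexity. For the upper one, [Ek_diff_ge] makes E_k grow at least linearly
    in each curvature above the constant tuple [l], whereas the equation and monotonicity bound E_k
    by [chi w2]. *)
Lemma curvature_range : exists l K : R, [/\ 0 < l, l <= 1, 1 <= K &
  forall p e kappa, bnd Omega p -> frame_data p e kappa -> forall i, l <= kappa i - 1 <= K].
Proof.
have [eps eps0 Heps] := Hhc; have [w1 [w2 [w10 wr]]] := weight_range.
pose l := Num.min 1 eps; have l0 : 0 < l by rewrite lt_min ltr01.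
have l1 : l <= 1 by rewrite ge_min lexx.
pose c := l ^+ k / ('C(n, k))%:R.
have c0 : 0 < c by rewrite divr_gt0 ?exprn_gt0 // ltr0n bin_gt0; case/andP: hk.
pose M := `|chi w2 - Ek k (fun _ : 'I_n => l)|.
exists l, (1 + M / c); split => //; first by rewrite lerDl; exact: divr_ge0 (normr_ge0 _) (ltW c0).
move=> p e kappa bp [_ pk _ _ _] i.
have lk j : l <= kappa j - 1.
  have := Heps p kappa bp pk j; have : l <= eps by rewrite ge_min lexx orbT.
  by lra.
rewrite lk /=; have := Ek_diff_ge hk l0 l1 (fun _ => lexx l) lk.
rewrite -/c -/(shifted kappa) (_ : Ek k (fun i => kappa i - 1) = chi (- lor o (horo p))); last first.
  exact: Hcurv.
have /andP[a1 a2] := wr p bp.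
have := chi_mono (lt_le_trans w10 a1) a2.
have : kappa i - 1 - l <= \sum_j (kappa j - 1 - l).
  by rewrite (bigD1 i) //= lerDl sumr_ge0 // => j _; rewrite subr_ge0.
have := ler_norm (chi w2 - Ek k (fun _ : 'I_n => l)); rewrite -/M.
move: (\sum_j _) => S h1 h2 h3 h4.
have : c * (kappa i - 1 - l) <= M.
  by apply: (@le_trans _ _ (c * S)); [rewrite ler_pM2l|move: h1 h3 h4; lra].
by rewrite mulrC -ler_pdivlMr //; move: l1; lra.
Qed.

(** * Hopf's lemma *)

Lemma refl_norm (m : E) : 0 < lor m m -> exists2 C, 0 < C & forall x, `|refl m x| <= C * `|x|.
Proof.
move=> mm; pose N := n.+2%:R : R; have N0 : 0 < N by rewrite ltr0n.
have h0 : 0 <= 2 * (N * `|m|) / lor m m * `|m|.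
  by rewrite mulr_ge0 // divr_ge0 ?(ltW mm) // mulr_ge0 // mulr_ge0 // ltW.
exists (1 + 2 * (N * `|m|) / lor m m * `|m|); first by rewrite ltr_pwDl.
move=> x; rewrite mulrDl mul1r (le_trans (ler_normB _ _)) // lerD2l normrZ.
have -> : 2 * (N * `|m|) / lor m m * `|m| * `|x| = 2 * (N * `|m| * `|x|) / lor m m * `|m| by ring.
rewrite ler_wpM2r // normrM normfV (gtr0_norm mm) ler_wpM2r ?invr_ge0 ?(ltW mm) //.
by rewrite normrM ger0_norm // ler_wpM2l // lor_bound.
Qed.

Lemma lor_quad2 (x y w : E) (t : R) :
  lor (x + t *: y + t ^+ 2 *: w) (x + t *: y + t ^+ 2 *: w) = lor x x + 2 * t * lor x y +
  t ^+ 2 * (lor y y + 2 * lor x w) + 2 * t ^+ 3 * lor y w + t ^+ 4 * lor w w.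
Proof.
rewrite lor_quad !(lorDl, lorZl) (lorC y x) (lorC w x) (lorC w y); ring.
Qed.

Section Parabola.
Variables (a z v : E).
Hypothesis ha : hyp a.
Hypothesis nz : null z.
Hypothesis az : lor a z = -1.
Hypothesis av : lor a v = 0.
Hypothesis zv : lor z v = 0.

(* The acceleration that keeps [z + t v + t^2 u] on the null cone. *)
Definition parab_acc : E := (lor v v / 4) *: (2 *: a - z).

Lemma parab_null t : null (z + t *: v + t ^+ 2 *: parab_acc).
Proof.
have vv := tangent_ge0 ha av.
have h1 : lor a (z + t *: v + t ^+ 2 *: parab_acc) = -1 - t ^+ 2 * (lor v v / 4).
  by rewrite lor_quad az av /parab_acc lorZr lorDr lorNr lorZr ha.1 az; ring.
have h0 : lor (z + t *: v + t ^+ 2 *: parab_acc) (z + t *: v + t ^+ 2 *: parab_acc) = 0.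
  have zu : lor z parab_acc = - (lor v v / 2).
    by rewrite /parab_acc lorZr lorDr lorNr lorZr nz.1 (lorC z a) az; field.
  have vu : lor v parab_acc = 0.
    by rewrite /parab_acc lorZr lorDr lorNr lorZr (lorC v a) av (lorC v z) zv; ring.
  have uu : lor parab_acc parab_acc = 0.
    rewrite {1}/parab_acc lorZl lorDl lorNl lorZl zu.
    by rewrite /parab_acc lorZr lorDr lorNr lorZr ha.1 az; field.
  by rewrite lor_quad2 zu vu uu nz.1 zv; field.
split => //; have [] // := @causal_future _ _ a (z + t *: v + t ^+ 2 *: parab_acc) ha.
  by rewrite h0.
rewrite h1; have : 0 <= t ^+ 2 * (lor v v / 4) by rewrite mulr_ge0 ?sqr_ge0 // divr_ge0.
by lra.
Qed.

Lemma parab_pole t : lor a (z + t *: v + t ^+ 2 *: parab_acc) = - (1 + t ^+ 2 * (lor v v / 4)).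
Proof. by rewrite lor_quad az av /parab_acc lorZr lorDr lorNr lorZr ha.1 az; ring. Qed.

Lemma parab_perp b t : lor a b = 0 -> lor b (z + t *: v + t ^+ 2 *: parab_acc) =
  lor b z + t * lor b v - t ^+ 2 * (lor v v / 4) * lor b z.
Proof. by move=> ab; rewrite lor_quad /parab_acc lorZr lorDr lorNr lorZr (lorC b a) ab; ring. Qed.

End Parabola.

(** Second-order lower expansion of the square of L = <b, .> along the parabola, with L0 = <b, z>,
    L1 = <b, v> and g = <v, v> / 4. The factor 1 - t^2 g bounds the renormalisation to the slice
    from below, and [r] dominates the coefficients of the error of order t^3. *)
Lemma barrier_poly (c L0 L1 g eta : R) : 0 <= c -> 0 <= g -> 0 < eta ->
  \forall t \near at0, c * (L0 ^+ 2 + 2 * t * L0 * L1 + t ^+ 2 * (L1 ^+ 2 - 3 * g * L0 ^+ 2)) - t ^+ 2 * eta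
    <= c * ((L0 + t * L1 - t ^+ 2 * g * L0) ^+ 2 * (1 - t ^+ 2 * g)).
Proof.
move=> c0 g0 eta0; pose r := c * (4 * g * `|L0 * L1| + g * L1 ^+ 2) + g + 1.
have A0 : 0 <= c * (4 * g * `|L0 * L1| + g * L1 ^+ 2).
  by rewrite mulr_ge0 // addr_ge0 // mulr_ge0 ?sqr_ge0 // mulr_ge0.
have r0 : 0 < r by rewrite ltr_wpDl // addr_ge0.
have d0 : 0 < Num.min r^-1 (eta / r) by rewrite lt_min invr_gt0 r0 divr_gt0.
have d1 : 0 < Num.min 1 (Num.min r^-1 (eta / r)) by rewrite lt_min ltr01.
apply: filterS (near_at0 d1) => t /andP[t0]; rewrite !lt_min => /andP[t1 /andP[tr tr2]].
have tg : t ^+ 2 * g <= 1.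
  have : t * g <= 1.
    apply: (@le_trans _ _ (t * r)); last by rewrite mulrC -ler_pdivlMl // mulr1 ltW.
    by rewrite ler_pM2l // /r; move: A0; lra.
  have tt : t * (t * g) <= t * g by rewrite ler_piMl ?mulr_ge0 // ltW.
  by rewrite expr2 -mulrA => h; apply: le_trans tt h.
have s0 : 0 <= t ^+ 2 * g by rewrite mulr_ge0 ?sqr_ge0.
have err : c * (t * (4 * g * `|L0 * L1| + t * (g * L1 ^+ 2))) <= eta.
  have : t * r <= eta by rewrite -ler_pdivlMr // ltW.
  apply: le_trans; rewrite mulrCA ler_pM2l // /r.
  have : c * (4 * g * `|L0 * L1| + t * (g * L1 ^+ 2)) <= c * (4 * g * `|L0 * L1| + g * L1 ^+ 2).
    have gL : 0 <= g * L1 ^+ 2 by rewrite mulr_ge0 ?sqr_ge0.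
    by rewrite ler_wpM2l // lerD2l ler_piMl // ltW.
  by move: g0; lra.
have T0 : 0 <= t ^+ 2 by rewrite sqr_ge0.
have := ler_wpM2l T0 err.
set s := t ^+ 2 * g in tg s0 *.
have -> : t ^+ 2 * g * L0 = s * L0 by [].
have X : L0 ^+ 2 + 2 * t * L0 * L1 + t ^+ 2 * (L1 ^+ 2 - 3 * g * L0 ^+ 2)
   - t ^+ 2 * (t * (4 * g * `|L0 * L1| + t * (g * L1 ^+ 2))) <=
   (L0 + t * L1 - s * L0) ^+ 2 * (1 - s).
  have e1 : (L0 + t * L1 - s * L0) ^+ 2 * (1 - s) = L0 ^+ 2 * (1 - s) ^+ 3 + 2 * t * (L0 * L1) * (1 - s) ^+ 2
    + t ^+ 2 * L1 ^+ 2 * (1 - s) by ring.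
  have e2 : L0 ^+ 2 * (1 - 3 * s) <= L0 ^+ 2 * (1 - s) ^+ 3.
    by rewrite ler_wpM2l ?sqr_ge0 //; move: s0 tg; nra.
  have e3 : 2 * t * (L0 * L1) - 4 * t * s * `|L0 * L1| <= 2 * t * (L0 * L1) * (1 - s) ^+ 2.
    have : `|2 * t * (L0 * L1) * (2 * s - s ^+ 2)| <= 4 * t * s * `|L0 * L1|.
      have B0 : 0 <= 2 * s - s ^+ 2 by rewrite expr2 -mulrBl mulr_ge0 //; move: tg; lra.
      have T1 : 0 <= 2 * t by rewrite mulr_ge0 // ltW.
      rewrite [leLHS]normrM (ger0_norm B0) [`|2 * t * _|]normrM (ger0_norm T1).
      have := normr_ge0 (L0 * L1); move: (`|L0 * L1|) => x x0.
      have : 0 <= t * x * s ^+ 2 by rewrite !mulr_ge0 ?sqr_ge0 // ltW.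
      by lra.
    by rewrite ler_norml => /andP[_]; rewrite -subr_ge0 => h; move: h; lra.
  rewrite e1; have -> : t ^+ 2 * (t * (4 * g * `|L0 * L1| + t * (g * L1 ^+ 2))) =
    4 * t * s * `|L0 * L1| + t ^+ 2 * s * L1 ^+ 2 by rewrite /s; ring.
  have -> : t ^+ 2 * (L1 ^+ 2 - 3 * g * L0 ^+ 2) = t ^+ 2 * L1 ^+ 2 - 3 * s * L0 ^+ 2 by rewrite /s; ring.
  by move: e2 e3; lra.
by have := ler_wpM2l c0 X; move: (`|_|) => ?; lra.
Qed.

Section Barrier.
Variables (m a : E).
Hypothesis mm : 0 < lor m m.
Hypothesis ha : hyp a.

(** The gap is a difference of two points of H, hence orthogonal to their sum [q]. In the frame this
    is a linear relation in which the component along 2 a - z has the coefficient supp z + supp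
    (refl m z), so that it is controlled by [diff] and the other components. The direction 2 a - z
    matters because the acceleration of the parabola is a multiple of it. *)
Lemma gap_bound : exists2 C : R, 0 < C & forall z (f : 'I_n -> E), null z -> lor a z = -1 ->
  is_frame a (z - a) f -> 0 <= diff m z ->
  `|lor (gap m z) (2 *: a - z)| <= C * (diff m z + \sum_j `|lor (gap m z) (f j)|).
Proof.
have [C C1 HC] := slice_bounds ha; have [K [K0 HK]] := Omega_bounded.
have [C2 C20 HC2] := refl_norm mm; pose N := n.+2%:R : R; have N0 : 0 < N by rewrite ltr0n.
have a0 : 0 < a 0 0 by case: ha.
pose Kq := K + C2 * K; have Kq0 : 0 < Kq by rewrite addr_gt0 ?mulr_gt0.
pose M := N * (2 * `|a| + C + 2 * a 0 0) * Kq.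
have C0 : 0 < C := lt_le_trans ltr01 C1.
have M0 : 0 < M by rewrite !mulr_gt0 // ltr_wpDl ?mulr_gt0 // addr_ge0 ?mulr_ge0 // ltW.
exists (C * M) => [|z f nz az [af vf ff ex] d0]; first by rewrite mulr_gt0.
have nz' := refl_null mm nz.
have [zC sC s1] := HC z nz az; have S'0 := supp_gt0 nz'.
set D := gap m z.
have [p' p'E] : exists p', p' = refl m (touch (refl m z)) by exists (refl m (touch (refl m z))).
pose q := touch z + p'.
have hp := bnd_hyp (touch_bnd nz); have hp' : hyp p' by rewrite p'E; exact: refl_hyp mm (bnd_hyp (touch_bnd nz')).
have Dq : lor D q = 0.
  by rewrite /D /gap -p'E /q lorDl lorNl !lorDr hp.1 hp'.1 (lorC p'); ring.
have zD : lor z D = - diff m z by rewrite diff_gap opprK lorC.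
have zq : lor z q = - (supp z + supp (refl m z)).
  by rewrite /q lorDr (lorC z p') p'E refl_lorC (lorC z) /supp; ring.
pose X := lor (2 *: a - z) D.
have main : X * (supp z + supp (refl m z)) =
  - (diff m z * lor (2 *: a - z) q) - 2 * \sum_j lor D (f j) * lor (f j) q.
  have : lor D q = - lor a D * lor a q + lor (z - a) D * lor (z - a) q + \sum_j lor D (f j) * lor (f j) q.
    rewrite {1}(ex D) [LHS]lorDl [lor (_ *: a + _) q]lorDl !lorZl lor_suml; congr (_ + _).
    by apply: eq_bigr => j _; rewrite lorZl (lorC D).
  rewrite Dq => /esym.
  move: (\sum_j _) => Sm; rewrite /X !lorDl !lorNl !lorZl zD zq; lra.
have qb : `|q| <= Kq.
  rewrite (le_trans (ler_normD _ _)) // lerD //; first by apply: HK; case: (touch_bnd nz).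
  rewrite p'E (le_trans (HC2 _)) // ler_wpM2l ?(ltW C20) //; apply: HK; by case: (touch_bnd nz').
have b1 : `|lor (2 *: a - z) q| <= M.
  rewrite (le_trans (lor_bound _ _)) // -/N /M ler_pM ?mulr_ge0 ?(ltW N0) // ler_wpM2l ?(ltW N0) //.
  rewrite (le_trans (ler_normB _ _)) // normrZ ger0_norm //.
  by have := zC; move: (ltW a0); lra.
have b2 j : `|lor (f j) q| <= M / 2.
  have fb : `|f j| <= a 0 0.
    rewrite -(@ler_pXn2r _ 2) ?nnegrE ?(ltW a0) //.
    by have := tangent_norm ha (af j); rewrite ff eqxx mulr1.
  rewrite (le_trans (lor_bound _ _)) // -/N.
  have -> : M / 2 = N * (`|a| + C / 2 + a 0 0) * Kq by rewrite /M; field.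
  rewrite ler_pM ?mulr_ge0 ?(ltW N0) // ler_wpM2l ?(ltW N0) //.
  by rewrite (le_trans fb) // lerDr addr_ge0 // divr_ge0 // ltW.
have XS : `|X| * supp z <= M * (diff m z + \sum_j `|lor D (f j)|).
  apply: (@le_trans _ _ (`|X * (supp z + supp (refl m z))|)).
    rewrite normrM ler_wpM2l // (le_trans _ (ler_norm _)) // lerDl ltW //.
  rewrite main (le_trans (ler_normB _ _)) // [M * _]mulrDr lerD //.
    by rewrite normrN normrM (ger0_norm d0) mulrC ler_wpM2r.
  rewrite normrM ger0_norm // mulr_sumr.
  apply: (@le_trans _ _ (2 * \sum_j `|lor D (f j) * lor (f j) q|)).
    by rewrite ler_wpM2l // ler_norm_sum.
  rewrite mulr_sumr; apply: ler_sum => j _; rewrite normrM.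
  have := b2 j; have := normr_ge0 (lor D (f j)); move: (`|lor D _|) (`|lor _ q|) => x y x0 yM.
  by have := ler_wpM2l x0 yM; lra.
rewrite -/D lorC -/X.
apply: (@le_trans _ _ (C * (`|X| * supp z))).
  rewrite mulrCA ler_peMr //.
by rewrite -mulrA ler_pM2l.
Qed.

(** With S, S' the two support values, the arguments of [chi] are - <o, z> / S and - <o, refl m z> /
    S'. On this side of the mirror <o, z> <= <o, refl m z>, so the second exceeds the first by at
    most - <o, z> (S - S') / (S S'). Monotonicity and the Lipschitz bound of [chi] conclude. *)
Lemma weight_compare : lor m o <= 0 -> exists2 C : R, 0 < C & forall z, null z -> lor a z = -1 ->
  0 <= lor m z -> 0 <= diff m z ->
  chi (- lor o (horo (touch (refl m z)))) - chi (- lor o (horo (touch z))) <= C * diff m z.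
Proof.
move=> mo; have [C C1 HC] := slice_bounds ha.
have [C' C'1 HC'] := slice_bounds (refl_hyp mm ha).
have [w1 [w2 [w10 wr]]] := weight_range; have [L L0 HL] := chi_lip w2 w10.
pose N := n.+2%:R : R; have N0 : 0 < N by rewrite ltr0n.
have C0 : 0 < C := lt_le_trans ltr01 C1; have C'0 : 0 < C' := lt_le_trans ltr01 C'1.
have B0 : 0 <= N * `|o| * C * C * C' by rewrite !mulr_ge0 // ltW.
exists (L * (N * `|o| * C * C * C') + 1); first by rewrite ltr_wpDl // mulr_ge0.
move=> z nz az mz d0; have nz' := refl_null mm nz.
have [zC _ s1] := HC z nz az.
have az' : lor (refl m a) (refl m z) = -1 by rewrite refl_lor.
have [_ _ s1'] := HC' _ nz' az'.
have S0 := supp_gt0 nz; have S0' := supp_gt0 nz'.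
have [b1 E1 _] := touchP nz; have [b2 E2 _] := touchP nz'.
set p := touch z in b1 E1 *; set p' := touch (refl m z) in b2 E2 *.
have W1 : lor o z = supp z * lor o (horo p) by rewrite {1}E1 lorZr.
have W2 : lor o (refl m z) = supp (refl m z) * lor o (horo p') by rewrite {1}E2 lorZr.
have oz : lor o z <= lor o (refl m z).
  rewrite /refl lorDr lorNr lorZr lerDl oppr_ge0 (lorC o m) mulr_ge0_le0 //.
  by rewrite divr_ge0 ?mulr_ge0 // ltW.
have ozb : - lor o z <= N * `|o| * C.
  by rewrite (le_trans (ler_norm _)) // normrN (le_trans (lor_bound _ _)) // ler_wpM2l // mulr_ge0 // ltW.
have key : - lor o (horo p') - - lor o (horo p) <= N * `|o| * C * C * C' * diff m z.
  rewrite -(ler_pM2l (mulr_gt0 S0 S0')).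
  apply: (@le_trans _ _ (- lor o z * diff m z)).
    have := ler_wpM2l (ltW S0) oz; rewrite /diff W1 W2; lra.
  have h1 : - lor o z * diff m z <= N * `|o| * C * diff m z by rewrite ler_wpM2r.
  apply: le_trans h1 _.
  have -> : supp z * supp (refl m z) * (N * `|o| * C * C * C' * diff m z) =
    N * `|o| * C * diff m z * ((C * supp z) * (C' * supp (refl m z))) by ring.
  by rewrite ler_peMr ?mulr_ge0 ?(ltW N0) ?(ltW C0) // mulr_ege1.
have /andP[x1 x2] := wr _ b1; have /andP[y1 y2] := wr _ b2.
have D1 : 0 <= L * (N * `|o| * C * C * C') * diff m z by rewrite !mulr_ge0 // ltW.
rewrite mulrDl mul1r.
case: (leP (- lor o (horo p')) (- lor o (horo p))) => [le|lt].
  by have := chi_mono (lt_le_trans w10 y1) le; move: D1 d0; lra.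
have := HL _ _ x1 (ltW lt) y2; have := ler_wpM2l L0 key; rewrite mulrA.
by move: d0; lra.
Qed.

Lemma diffZ z (r : R) : null z -> 0 < r -> diff m (r *: z) = r * diff m z.
Proof. by move=> nz r0; rewrite /diff reflZ !suppZ ?mulrBr //; exact: refl_null. Qed.

Variable b : E.
Hypothesis ab : lor a b = 0.
Hypothesis bb : lor b b = 1.

(* The parabola leaves the slice <a, .> = -1; homogeneity of diff brings it back, and
   [1 / A >= 1 - t^2 <v, v> / 4] for A = - <a, .> keeps the lower bound polynomial in t. *)
Lemma barrier_below (c N : R) z v : 0 < c -> 0 < N -> null z -> lor a z = -1 ->
  0 < lor b z -> lor b z < N^-1 ->
  (forall z', null z' -> lor a z' = -1 -> 0 <= lor b z' <= N^-1 ->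
    diff m z - c * (lor b z + N * lor b z ^+ 2) <= diff m z' - c * (lor b z' + N * lor b z' ^+ 2)) ->
  lor a v = 0 -> lor z v = 0 -> forall eta, 0 < eta -> \forall t \near at0,
    diff m z + t * (c * (1 + 2 * N * lor b z) * lor b v) +
    t ^+ 2 * ((diff m z - c * (lor b z + N * lor b z ^+ 2)) * (lor v v / 4) - c * (lor v v / 4) * lor b z +
      c * N * (lor b v ^+ 2 - 3 * (lor v v / 4) * lor b z ^+ 2) - eta) <=
    diff m (z + t *: v + t ^+ 2 *: parab_acc a z v).
Proof.
move=> c0 N0 nz az L0 LN minz av zv eta eta0.
set f0 := diff m z - _; have g0 : 0 <= lor v v / 4 by rewrite divr_ge0 // (tangent_ge0 ha av).
set g := lor v v / 4 in g0 *.
have bL : lor b z + t * lor b v - t ^+ 2 * g * lor b z @[t --> at0] --> lor b z.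
  rewrite -[X in _ --> X]subr0 -[X in _ --> X - _]addr0.
  have -> : lor b z + 0 - 0 = lor b z + (0 : R) * lor b v - (0 : R) ^+ 2 * g * lor b z by ring.
  have c1 := @at0_cvg0 R; apply: cvgB.
    by apply: cvgD; [exact: cvg_cst|apply: cvgM => //; exact: cvg_cst].
  apply: cvgM; last exact: cvg_cst.
  by apply: cvgM; [rewrite !expr2; apply: cvgM|exact: cvg_cst].
have bp := barrier_poly (lor b z) (lor b v) (ltW (mulr_gt0 c0 N0)) g0 eta0.
near=> t.
have t0 : 0 < t by [].
have l1 : 0 < lor b z + t * lor b v - t ^+ 2 * g * lor b z by near: t; exact: cvgr_gt bL _ L0.
have l2 : lor b z + t * lor b v - t ^+ 2 * g * lor b z < N^-1 by near: t; exact: cvgr_lt bL _ LN.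
have s0 : 0 <= t ^+ 2 * g by rewrite mulr_ge0 // sqr_ge0.
have A0 : 0 < 1 + t ^+ 2 * g by rewrite ltr_pwDl.
have nt := parab_null ha nz az av zv t.
have pt := parab_pole ha az av t; have qt := parab_perp z v t ab.
rewrite -/g in pt qt.
have low : c * N * (lor b z ^+ 2 + 2 * t * lor b z * lor b v +
    t ^+ 2 * (lor b v ^+ 2 - 3 * g * lor b z ^+ 2)) - t ^+ 2 * eta <=
    c * N * ((lor b z + t * lor b v - t ^+ 2 * g * lor b z) ^+ 2 * (1 - t ^+ 2 * g)) by near: t.
have := minz ((1 + t ^+ 2 * g)^-1 *: (z + t *: v + t ^+ 2 *: parab_acc a z v)).
rewrite !lorZr pt qt diffZ ?invr_gt0 // mulrN mulVf ?gt_eqF // -/f0.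
have nZ := @nullZ (1 + t ^+ 2 * g)^-1 _ _ nt; rewrite invr_gt0 in nZ.
move/(_ (nZ A0) erefl); rewrite {nZ}.
set X := lor b z + t * lor b v - t ^+ 2 * g * lor b z in l1 l2 low *.
have Xr : 0 <= (1 + t ^+ 2 * g)^-1 * X <= N^-1.
  rewrite mulr_ge0 ?invr_ge0 ?(ltW A0) ?(ltW l1) //= (le_trans _ (ltW l2)) // ger_pMl //.
  by rewrite invf_le1 // lerDl.
move/(_ Xr); set Dt := diff m (z + _ + _).
rewrite -(ler_pM2l A0).
have -> : (1 + t ^+ 2 * g) * ((1 + t ^+ 2 * g)^-1 * Dt - c * ((1 + t ^+ 2 * g)^-1 * X +
   N * ((1 + t ^+ 2 * g)^-1 * X) ^+ 2)) = Dt - c * X - c * N * (X ^+ 2 * (1 + t ^+ 2 * g)^-1).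
  by field; rewrite gt_eqF.
have inv : c * N * (X ^+ 2 * (1 - t ^+ 2 * g)) <= c * N * (X ^+ 2 * (1 + t ^+ 2 * g)^-1).
  rewrite ler_pM2l ?mulr_gt0 // ler_wpM2l ?sqr_ge0 // -(ler_pM2r A0) mulVf ?gt_eqF //.
  by have := sqr_ge0 (t ^+ 2 * g); lra.
have dE : diff m z = f0 + c * (lor b z + N * lor b z ^+ 2) by rewrite /f0 subrK.
rewrite dE; move: low inv; move: (X ^+ 2 / _) => Y; move: (X ^+ 2 * _) => Z.
by rewrite /X; lra.
Unshelve. all: by end_near. Qed.

(** Both forms are pulled back to the Euclidean space orthogonal to [a] and [z], where [frame_orth]
    makes each eigenframe orthonormal and [Ek_compare] applies. The projection of [b] to this space
    has squared length 1 - <b, z>^2, hence the hypothesis with 1 / 2. *)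
Lemma hess_compare : exists ca cb : R, [/\ 0 < ca, 0 <= cb &
  forall z e kappa e' kappa' (A B : R), null z -> lor a z = -1 ->
  frame_data (touch z) e kappa -> frame_data (touch (refl m z)) e' kappa' -> 0 <= A -> 0 <= B ->
  lor b z ^+ 2 <= 1 / 2 ->
  (forall v, lor a v = 0 -> lor z v = 0 ->
    \sum_i lor (e' i) (refl m v) ^+ 2 / (kappa' i - 1) + A * lor b v ^+ 2 <=
    \sum_i lor (e i) v ^+ 2 / (kappa i - 1) + B * lor v v) ->
  ca * A - cb * B <= chi (- lor o (horo (touch (refl m z)))) - chi (- lor o (horo (touch z)))].
Proof.
have [l [K [l0 l1 K1 lK]]] := curvature_range.
have K0 : 0 < K := lt_le_trans ltr01 K1.
pose ck := l ^+ k / ('C(n, k))%:R.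
have ck0 : 0 < ck by rewrite divr_gt0 ?exprn_gt0 // ltr0n bin_gt0; case/andP: hk.
have Kk0 : 0 < ck + K ^+ k by rewrite addr_gt0 // exprn_gt0.
exists (ck * l ^+ 2 / 2), ((ck + K ^+ k) * (n%:R * K ^+ 2)); split.
- by rewrite divr_gt0 // mulr_gt0 // exprn_gt0.
- by rewrite mulr_ge0 ?(ltW Kk0) // mulr_ge0 // sqr_ge0.
move=> z e kappa e' kappa' A B nz az D1 D2 A0 B0 bz form.
have nz' := refl_null mm nz.
have [b1 E1 _] := touchP nz; have [b2 E2 _] := touchP nz'.
have azv : lor a (z - a) = 0 by rewrite lorDr lorNr az ha.1; ring.
have vv1 : lor (z - a) (z - a) = 1.
  by rewrite lorDl !lorDr !lorNl !lorNr nz.1 ha.1 az (lorC z a) az; ring.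
have [f [af vf fo fx]] := frame_exists ha azv vv1.
have zf j : lor z (f j) = 0 by have := vf j; rewrite lorDl lorNl af subr0.
pose U : 'M[R]_n := \matrix_(i, j) lor (e i) (f j).
pose W : 'M[R]_n := \matrix_(i, j) lor (e' i) (refl m (f j)).
have UU : U *m U^T = 1%:M.
  have [ef _ _ _ _] := D1; apply: (frame_orth nz b1 E1 ef) => // j; by rewrite lorC.
have WW : W *m W^T = 1%:M.
  have [ef _ _ _ _] := D2; apply: (frame_orth nz' b2 E2 ef) => [j|i j]; rewrite refl_lor //.
  by rewrite lorC.
pose bv : 'rV[R]_n := \row_j lor b (f j).
pose vec (u : 'rV[R]_n) := \sum_j u 0 j *: f j : E.
have vecb u x : lor x (vec u) = \sum_j u 0 j * lor x (f j).
  by rewrite /vec lor_sumr; apply: eq_bigr => j _; rewrite lorZr.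
have avec u : lor a (vec u) = 0 by rewrite vecb big1 // => j _; rewrite af mulr0.
have zvec u : lor z (vec u) = 0 by rewrite vecb big1 // => j _; rewrite zf mulr0.
have bvec u : lor b (vec u) = dot u bv by rewrite vecb; apply: eq_bigr => j _; rewrite mxE.
have vvec u : lor (vec u) (vec u) = dot u u.
  rewrite vecb; apply: eq_bigr => j _; congr (_ * _); rewrite lorC vecb (bigD1 j) //= fo eqxx mulr1.
  by rewrite big1 ?addr0 // => i ij; rewrite fo eq_sym (negbTE ij) mulr0.
have Uvec u i : dot u (row i U) = lor (e i) (vec u).
  by rewrite vecb; apply: eq_bigr => j _; rewrite !mxE.
have Wvec u i : dot u (row i W) = lor (e' i) (refl m (vec u)).
  rewrite -refl_lorC vecb; apply: eq_bigr => j _; by rewrite !mxE refl_lorC.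
have bbv : dot bv bv = 1 - lor b z ^+ 2.
  have bf : \sum_j lor b (f j) ^+ 2 = dot bv bv by apply: eq_bigr => j _; rewrite !mxE expr2.
  have := congr1 (fun x => lor x b) (fx b).
  rewrite bb ab oppr0 scale0r add0r [lor (_ + \sum_i _) b]lorDl lorZl lor_suml lorDl lorNl ab subr0 (lorC z b) -bf => ->.
  rewrite expr2 addrAC subrr add0r; apply: eq_bigr => j _; by rewrite lorZl (lorC b) expr2.
have bb2 : 1 / 2 <= dot bv bv by rewrite bbv; move: bz; lra.
have [_ pk _ ks _] := D1; have [_ pk' _ ks' _] := D2.
have form' u : \sum_i dot u (row i W) ^+ 2 / shifted kappa' i + A * dot u bv ^+ 2 <=
     \sum_i dot u (row i U) ^+ 2 / shifted kappa i + B * dot u u.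
  under eq_bigr => i _ do rewrite Wvec; under [in leRHS]eq_bigr => i _ do rewrite Uvec.
  by rewrite -bvec -vvec; exact: form (avec u) (zvec u).
have := Ek_compare hk l0 l1 K1 A0 B0 (lK _ _ _ b1 D1) (lK _ _ _ b2 D2)
  (fun i j ij => lerB (ks i j ij) (lexx 1)) (fun i j ij => lerB (ks' i j ij) (lexx 1)) UU WW bb2 form'.
rewrite (Hcurv b1 pk) (Hcurv b2 pk') -/ck; apply: le_trans.
by rewrite le_eqVlt; apply/orP; left; apply/eqP; field.
Qed.

(** At such a minimum the barrier contributes a gain proportional to c N in the direction [b]. All
    losses (curvature of the slice, gap term, change of the argument of [chi]) are O(c) with
    constants independent of [N], because [diff m z] itself is below the barrier. A large [N] is
    therefore contradictory. *)
Lemma hopf_interior : lor m o <= 0 -> exists2 N : R, 2 <= N & forall (c : R) z, 0 < c -> null z ->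
  lor a z = -1 -> 0 < lor b z -> lor b z < N^-1 -> 0 <= lor m z -> 0 <= diff m z ->
  diff m z < c * (lor b z + N * lor b z ^+ 2) ->
  (forall z', null z' -> lor a z' = -1 -> 0 <= lor b z' <= N^-1 ->
    diff m z - c * (lor b z + N * lor b z ^+ 2) <= diff m z' - c * (lor b z' + N * lor b z' ^+ 2)) ->
  False.
Proof.
move=> mo; have [C C1 HC] := slice_bounds ha; have [ca [cb [ca0 cb0 Hab]]] := hess_compare.
have [Cg Cg0 HCg] := gap_bound; have [Cw Cw0 HCw] := weight_compare mo.
have C0 : 0 < C := lt_le_trans ltr01 C1.
(* The 2 pays for the negative minimum and for the linear part of the barrier. The rest is the bound
   Cg (c + 3 c n) of the gap term, with the factor 1 / 4 of [parab_acc]. *)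
pose CB := 2 + Cg * (1 + 3 * n%:R) / 4.
have CB0 : 0 < CB by rewrite ltr_pwDl // divr_ge0 // mulr_ge0 ?(ltW Cg0) // addr_ge0 // mulr_ge0.
pose R0 := cb * CB + C * (Cw + 1).
have R00 : 0 <= R0.
  exact: addr_ge0 (mulr_ge0 cb0 (ltW CB0)) (mulr_ge0 (ltW C0) (addr_ge0 (ltW Cw0) ler01)).
(* The gain ca N exceeds all losses, collected in [R0], by 2 ca; N >= 2 also keeps <b, z> below 1 /
   2. *)
pose N := R0 / ca + 2.
have N2 : 2 <= N by rewrite lerDr divr_ge0 // ltW.
exists N => // c z c0 nz az L0 LN mz d0 neg minz.
have N0 : 0 < N by apply: lt_le_trans N2.
have LN1 : N * lor b z < 1 by rewrite mulrC -ltr_pdivlMr ?mul1r.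
have L2 : lor b z < 1 / 2.
  by apply: lt_le_trans LN _; rewrite -div1r ler_pM2l ?ltr01 // lef_pV2 ?posrE.
have nz' := refl_null mm nz.
have [_ _ s1] := HC z nz az; have S0 := supp_gt0 nz; have S0' := supp_gt0 nz'.
have [b1 E1 _] := touchP nz; have [b2 E2 _] := touchP nz'.
have [e [kappa D1]] := frame_data_exists b1; have [e' [kappa' D2]] := frame_data_exists b2.
have azv : lor a (z - a) = 0 by rewrite lorDr lorNr az ha.1; ring.
have vv1 : lor (z - a) (z - a) = 1.
  by rewrite lorDl !lorDr !lorNl !lorNr nz.1 ha.1 az (lorC z a) az; ring.
have [f ff] := frame_exists ha azv vv1; have [af vf fo fx] := ff.
have zf j : lor z (f j) = 0 by have := vf j; rewrite lorDl lorNl af subr0.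
set f0 := diff m z - c * (lor b z + N * lor b z ^+ 2) in minz.
have f00 : - (c * (lor b z + N * lor b z ^+ 2)) <= f0 by rewrite /f0 lerDr.
have d0c : diff m z <= 2 * c * lor b z.
  apply: (le_trans (ltW neg)); have -> : 2 * c * lor b z = c * (lor b z + 1 * lor b z) by ring.
  by rewrite ler_pM2l // lerD2l expr2 mulrA ler_pM2r // ltW.
have acN v : parab_acc a z (- v) = parab_acc a z v by rewrite /parab_acc lorNl lorNr opprK.
have second v : lor a v = 0 -> lor z v = 0 ->
    lor (gap m z) v = - (c * (1 + 2 * N * lor b z) * lor b v) /\
    (f0 * (lor v v / 4) - c * (lor v v / 4) * lor b z +
      c * N * (lor b v ^+ 2 - 3 * (lor v v / 4) * lor b z ^+ 2)) + lor (gap m z) (parab_acc a z v) <=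
     supp_hess e kappa (supp z) v - supp_hess e' kappa' (supp (refl m z)) (refl m v).
  move=> av zv.
  have avN : lor a (- v) = 0 by rewrite lorNr av oppr0.
  have zvN : lor z (- v) = 0 by rewrite lorNr zv oppr0.
  apply: (diff_second mm nz D1 D2).
  - by apply: nearW => t; exact: parab_null.
  - by apply: nearW => t; have := parab_null ha nz az avN zvN t; rewrite acN.
  - by move=> eta eta0; exact: (barrier_below c0 N0 nz az L0 LN minz av zv eta0).
  - move=> eta eta0; have := barrier_below c0 N0 nz az L0 LN minz avN zvN eta0.
    by rewrite acN lorNl !lorNr opprK sqrrN; apply: filterS => t; rewrite !mulrN.
have bv1 j : `|lor b (f j)| <= 1.
  rewrite -(@ler_pXn2r _ 2) ?nnegrE // expr1n real_normK ?num_real //.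
  by have := tangent_CS ha ab (af j); rewrite fo eqxx bb mulr1.
have gf j : `|lor (gap m z) (f j)| <= 3 * c.
  have azj := lorC (f j) z; have [-> _] := second (f j) (af j) (zf j).
  rewrite normrN normrM -[leRHS]mulr1 ler_pM //.
  rewrite ger0_norm; last by rewrite mulr_ge0 ?(ltW c0) // addr_ge0 // !mulr_ge0 // ltW.
  by rewrite mulrC ler_pM2r //; move: LN1; lra.
have gapz : `|lor (gap m z) (2 *: a - z)| <= c * (4 * (CB - 2)).
  apply: le_trans (HCg z f nz az ff d0) _.
  have -> : c * (4 * (CB - 2)) = Cg * (c + n%:R * (3 * c)) by rewrite /CB; field.
  rewrite ler_pM2l // lerD //.
    exact: le_trans d0c (twice_half_le c0 L2).
  have -> : n%:R * (3 * c) = \sum_(j < n) 3 * c by rewrite sumr_const card_ord mulr_natl.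
  by apply: ler_sum => j _; exact: gf.
have A0 : 0 <= 2 * supp z * c * N by rewrite !mulr_ge0 // ltW.
have B0 : 0 <= 2 * supp z * c * CB by rewrite !mulr_ge0 // ltW.
have bz2 : lor b z ^+ 2 <= 1 / 2 by move: L2 L0; move: (lor b z) => x; nra.
have k1' i : 0 < kappa' i - 1.
  have [_ _ _ _ [eps eps0 ek]] := D2; rewrite subr_gt0; apply: lt_le_trans (ek i).
  by rewrite ltrDl.
have form v : lor a v = 0 -> lor z v = 0 ->
    \sum_i lor (e' i) (refl m v) ^+ 2 / (kappa' i - 1) + 2 * supp z * c * N * lor b v ^+ 2 <=
    \sum_i lor (e i) v ^+ 2 / (kappa i - 1) + 2 * supp z * c * CB * lor v v.
  move=> av zv; have [_] := second _ av zv.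
  rewrite /supp_hess; set Q := \sum_i _; set Q' := \sum_i _.
  have Q'0 : 0 <= Q' by apply: sumr_ge0 => i _; rewrite divr_ge0 ?sqr_ge0 // ltW.
  have du := tangent_ge0 ha av; rewrite /parab_acc lorZr.
  have gz : - (lor v v / 4 * (c * (4 * (CB - 2)))) <= lor v v / 4 * lor (gap m z) (2 *: a - z).
    have h : - (c * (4 * (CB - 2))) <= lor (gap m z) (2 *: a - z) by move: gapz; rewrite ler_norml => /andP[].
    by rewrite -mulrN ler_wpM2l // divr_ge0.
  apply: (barrier_form c0 N0 S0 S0' _ L0 L2 LN1 du Q'0 f00 gz).
  by move: d0; rewrite /diff subr_ge0.
have lowEk := Hab _ _ _ _ _ _ _ nz az D1 D2 A0 B0 bz2 form.
have upEk := HCw z nz az mz d0.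
have dc : Cw * diff m z <= Cw * c by rewrite ler_pM2l // (le_trans d0c) // twice_half_le.
have chain := le_trans lowEk (le_trans upEk dc).
have NE : ca * N = R0 + 2 * ca by rewrite /N mulrDr [X in X + _]mulrC divfK ?gt_eqF // [_ * 2]mulrC.
have : 2 * (c * supp z * (C * (Cw + 1))) <= Cw * c.
  apply: le_trans chain.
  have -> : ca * (2 * supp z * c * N) = 2 * (c * supp z * (ca * N)) by ring.
  rewrite NE /R0; have : 0 <= c * supp z * (2 * ca).
    exact: mulr_ge0 (mulr_ge0 (ltW c0) (ltW S0)) (mulr_ge0 (ler0n R 2) (ltW ca0)).
  by lra.
have : c * (Cw + 1) <= c * supp z * (C * (Cw + 1)).
  have -> : c * supp z * (C * (Cw + 1)) = c * (Cw + 1) * (C * supp z) by ring.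
  by rewrite ler_peMr // mulr_ge0 ?(ltW c0) // addr_ge0 // ltW.
have := mulr_gt0 c0 Cw0; move: c0; lra.
Qed.

Lemma slice_compact (A : set E) : closed A -> compact ([set z | lor z z = 0 /\ lor a z = -1] `&` A).
Proof.
move=> cA; apply: bounded_closed_compact.
  exists (2 * a 0 0); split; first by rewrite num_real.
  move=> M ltM z [[zz az] _] /=; apply: le_trans (ltW ltM).
  have := causal_norm ha (null_causal (slice_null ha zz az)); by rewrite az opprK mulr1.
apply: closedI => //.
have -> : [set z : E | lor z z = 0 /\ lor a z = -1] = [set z : E | lor z z = 0] `&` [set z : E | lor a z = -1] by [].
by apply: closedI; [apply: closed_level_eq => x; exact: lor_sq_continuous|apply: closed_level_eq => x; exact: lor_continuous].
Qed.

Lemma diff_cvg (F : set_system E) z : Filter F -> null z -> (\forall x \near F, null x) ->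
  x @[x --> F] --> z -> diff m x @[x --> F] --> diff m z.
Proof.
move=> FF nz nF Fz; apply: cvgB; first exact: supp_cvg.
apply: supp_cvg; first exact: refl_null.
  by apply: filterS nF => x; exact: refl_null.
rewrite /refl; apply: cvgB => //; apply: cvgZ; last exact: cvg_cst.
apply: cvgM; last exact: cvg_cst.
by apply: cvgM; [exact: cvg_cst|exact: (lor_cvg _ (cvg_cst m) Fz)].
Qed.

Lemma slice_min (A : set E) (h : E -> R) : closed A -> (forall z, {for z, continuous h}) ->
  [set z | lor z z = 0 /\ lor a z = -1] `&` A !=set0 ->
  exists2 z, (null z /\ lor a z = -1) /\ A z & forall z', null z' -> lor a z' = -1 -> A z' ->
    diff m z - h z <= diff m z' - h z'.
Proof.
move=> cA ch K0.
have [z [[zz az] Az] zmin] : exists2 z, ([set z | lor z z = 0 /\ lor a z = -1] `&` A) z &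
   forall x, ([set z | lor z z = 0 /\ lor a z = -1] `&` A) x -> diff m z - h z <= diff m x - h x.
  apply: compact_min_within K0 (slice_compact cA) _ => x [[xx ax] Ax].
  have FF := within_filter ([set z | lor z z = 0 /\ lor a z = -1] `&` A) (nbhs_filter x).
  have cx : y @[y --> within ([set z | lor z z = 0 /\ lor a z = -1] `&` A) (nbhs x)] --> x.
    exact: cvg_within.
  apply: cvgB; last exact: cvg_trans (cvg_app _ cx) (ch x).
  apply: (diff_cvg FF (slice_null ha xx ax) _ cx).
  by apply: filterS (withinT _ (nbhs_filter x)) => y [[yy ay] _]; exact: slice_null ha yy ay.
exists z; first by split => //; split => //; exact: slice_null ha zz az.
by move=> z' [zz' _] az' Az'; apply: zmin.
Qed.

Hypothesis mo : lor m o <= 0.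

(* Hopf's lemma, with barrier [c * (L + N * L^2)] for [L = <b, .>]. *)
Lemma hopf : (forall z, null z -> 0 <= lor b z -> 0 <= lor m z) ->
  (forall z, null z -> 0 <= lor b z -> 0 <= diff m z) ->
  (forall z, null z -> 0 < lor b z -> 0 < diff m z) ->
  exists c d : R, [/\ 0 < c, 0 < d & forall z, null z -> lor a z = -1 -> 0 <= lor b z <= d ->
    c * lor b z <= diff m z].
Proof.
move=> bm d0 dpos; have [N N2 HN] := hopf_interior mo.
have N0 : 0 < N by apply: lt_le_trans N2.
pose hh (c : R) z := c * (lor b z + N * lor b z ^+ 2).
have hc (c : R) z : {for z, continuous (hh c)}.
  have bz : lor b y @[y --> z] --> lor b z by exact: lor_continuous.
  have : c * (lor b y + N * (lor b y * lor b y)) @[y --> z] --> c * (lor b z + N * (lor b z * lor b z)).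
    exact: (@cvgM _ _ (nbhs z) (nbhs_filter z) _ _ _ _ (@cvg_cst _ c _ (nbhs z) (nbhs_filter z))
      (@cvgD _ _ _ (nbhs z) (nbhs_filter z) _ _ _ _ bz (@cvgM _ _ (nbhs z) (nbhs_filter z) _ _ _ _
        (@cvg_cst _ N _ (nbhs z) (nbhs_filter z)) (@cvgM _ _ (nbhs z) (nbhs_filter z) _ _ _ _ bz bz)))).
  exact.
(* Compactness of the face <b, .> = 1 / N, where [diff] is positive, provides a [c] for which the
   barrier lies below [diff] there; if the face is empty, any [c] will do. *)
have [c c0 cm] : exists2 c : R, 0 < c & forall z, null z -> lor a z = -1 -> lor b z = N^-1 ->
    c * (lor b z + N * lor b z ^+ 2) <= diff m z.
  pose A := [set z : E | lor b z = N^-1].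
  have cA : closed A by apply: closed_level_eq => x; exact: lor_continuous.
  have [K0|/set0P K0] := eqVneq ([set z : E | lor z z = 0 /\ lor a z = -1] `&` A) set0.
    exists 1 => // z [zz _] az bz.
    by have : ([set z : E | lor z z = 0 /\ lor a z = -1] `&` A) z by []; rewrite K0.
  have [z0 [[nz0 az0] Az0] zmin] := slice_min cA (hc 0) K0.
  have dz0 : 0 < diff m z0 by apply: dpos; rewrite // Az0 invr_gt0.
  have h0 : 0 < N^-1 + N * N^-1 ^+ 2 by rewrite addr_gt0 ?invr_gt0 // mulr_gt0 ?exprn_gt0 ?invr_gt0.
  exists (diff m z0 / (N^-1 + N * N^-1 ^+ 2)); first exact: divr_gt0.
  move=> z nz az bz; rewrite bz divfK ?gt_eqF //.
  by have := zmin z nz az bz; rewrite /hh !mul0r !subr0.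
exists c, N^-1; split; rewrite ?invr_gt0 // => z nz az bzr.
pose A := [set z : E | 0 <= lor b z] `&` [set z : E | lor b z <= N^-1].
have cA : closed A.
  by apply: closedI; [apply: closed_level_ge => x; exact: lor_continuous|apply: closed_level_le => x; exact: lor_continuous].
have Az : A z by split; move: bzr => /andP[].
have [z0 [[nz0 az0] [b0 bN]] zmin] : exists2 z, (null z /\ lor a z = -1) /\ A z &
  forall z', null z' -> lor a z' = -1 -> A z' -> diff m z - hh c z <= diff m z' - hh c z'.
  by apply: slice_min cA (hc c) _; exists z; split => //; split => //; case: nz.
suff f0 : 0 <= diff m z0 - hh c z0.
  have := le_trans f0 (zmin z nz az Az); rewrite subr_ge0; apply: le_trans.
  by rewrite ler_pM2l // lerDl mulr_ge0 ?sqr_ge0 // ltW.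
rewrite leNgt; apply/negP; rewrite subr_lt0 => neg.
have mz := bm z0 nz0 b0; have dz := d0 z0 nz0 b0.
(* A negative minimum lies on neither face: at <b, .> = 0 the barrier vanishes, and at <b, .> = 1 /
   N the choice of [c] applies. *)
apply: (HN c z0 c0 nz0 az0 _ _ mz dz neg) => [||z' nz' az' /andP[x1 x2]].
- rewrite lt_neqAle [X in _ && X]b0 andbT; apply: contraTneq neg => b00.
  by rewrite -leNgt /hh -b00 expr0n mulr0 addr0 mulr0.
- rewrite lt_neqAle [X in _ && X]bN andbT; apply: contraTneq neg => bNe.
  by rewrite -leNgt; exact: cm.
- exact: zmin.
Qed.

(** After scaling [z] into the slice, which leaves the gap unchanged, the parabola leaving in
    direction [b] meets the linear lower bound of [hopf], and [diff_first] reads off the slope. *)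
Lemma hopf_boundary : (forall z, null z -> 0 <= lor b z -> 0 <= lor m z) ->
  (forall z, null z -> 0 <= lor b z -> 0 <= diff m z) ->
  (forall z, null z -> 0 < lor b z -> 0 < diff m z) ->
  forall z, null z -> lor b z = 0 -> diff m z <= 0 -> lor (gap m z) b < 0.
Proof.
move=> bm d0 dpos z nz bz dz.
have az0 : lor a z < 0 := causal_lt0 ha (null_causal nz).
have [c [d [c0 dp hc]]] := hopf bm d0 dpos; move: bm d0 dpos => _ _ _.
pose r := (- lor a z)^-1; have r0 : 0 < r by rewrite invr_gt0 oppr_gt0.
pose z1 := r *: z; have nz1 : null z1 := nullZ r0 nz.
have az1 : lor a z1 = -1 by rewrite lorZr /r invrN mulNr mulVf // lt_eqF.
have bz1 : lor b z1 = 0 by rewrite lorZr bz mulr0.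
have zb1 : lor z1 b = 0 by rewrite lorC.
have g1 : gap m z1 = gap m z by rewrite /gap reflZ (touchZ nz r0) (touchZ (refl_null mm nz) r0).
have dz1 : diff m z1 <= 0 by rewrite (diffZ nz r0); apply: mulr_ge0_le0 dz; exact: ltW.
rewrite -g1; suff : c <= - lor (gap m z1) b by move: c0; lra.
apply: (@diff_first m mm z1 b (parab_acc a z1 b) c 0 nz1).
  by apply: nearW => t; exact: parab_null.
apply: filterS (near_at0 dp) => t /andP[t0 td].
have nt := parab_null ha nz1 az1 ab zb1 t.
have pt := parab_pole ha az1 ab t; have qt := parab_perp z1 b t ab.
move: nt pt qt; rewrite bb bz1 mulr0 subr0 add0r mulr1.
move: (z1 + _ + _) => y ny ay yb.
have A1 : 1 <= 1 + t ^+ 2 * (1 / 4) by rewrite lerDl mulr_ge0 ?sqr_ge0 // divr_ge0.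
move: (1 + _) A1 ay => A A1 ay.
have A0 : 0 < A := lt_le_trans ltr01 A1.
have Ai : 0 < A^-1 by rewrite invr_gt0.
have q1 : lor a (A^-1 *: y) = -1 by rewrite lorZr ay mulrN (mulVf (lt0r_neq0 A0)).
have q2 : lor b (A^-1 *: y) = A^-1 * t by rewrite lorZr yb.
have tr : 0 <= lor b (A^-1 *: y) <= d.
  rewrite q2 (mulr_ge0 (ltW Ai) (ltW t0)) /=; apply: le_trans (ltW td).
  by rewrite (ger_pMl _ t0) (invf_le1 A0).
have := hc _ (nullZ Ai ny) q1 tr; rewrite q2 (diffZ ny Ai) mulrCA (ler_pM2l Ai) => h.
by apply: le_trans h; move: dz1; lra.
Qed.

End Barrier.

Definition dominates m := forall z, null z -> 0 <= lor m z -> 0 <= diff m z.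

Lemma refl_scale (r : R) (m x : E) : r != 0 -> refl (r *: m) x = refl m x.
Proof.
move=> r0; rewrite /refl !lorZl lorZr scalerA; congr (_ - _ *: _).
have [m0|m0] := eqVneq (lor m m) 0; first by rewrite m0 !mulr0 invr0 !mulr0 mul0r.
by field; rewrite r0 m0.
Qed.

Lemma diff_scale (r : R) (m : E) z : r != 0 -> diff (r *: m) z = diff m z.
Proof. by move=> r0; rewrite /diff refl_scale. Qed.

Lemma diff_perp (m : E) z : lor m z = 0 -> diff m z = 0.
Proof. by move=> h; rewrite /diff refl_perp // subrr. Qed.

Lemma lor_sub3 (x y w : E) : lor (x - y - w) (x - y - w) =
  lor x x + lor y y + lor w w - 2 * lor x y - 2 * lor x w + 2 * lor y w.
Proof.
by rewrite !(lorDl, lorNl) !(lorDr, lorNr) (lorC y x) (lorC w x) (lorC w y); ring.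
Qed.

Section UnitReflection.
Variable m : E.
Hypothesis m1 : lor m m = 1.
Hypothesis mo : lor m o <= 0.
Hypothesis dom : dominates m.

Let mm : 0 < lor m m. Proof. by rewrite m1. Qed.

(** On the mirror [refl m z = z], and the gap reduces to 2 <m, touch z> m; Hopf's lemma with b = m
    then becomes a strict sign. *)
Lemma boundary_slope : (forall z, null z -> 0 < lor m z -> 0 < diff m z) ->
  forall z, null z -> lor m z = 0 -> lor m (touch z) < 0.
Proof.
move=> dpos z nz mz; have [a ha ma] := perp_hyp mm.
have am : lor a m = 0 by rewrite lorC.
have := hopf_boundary mm ha am m1 mo (fun z _ h => h) dom dpos nz mz.
rewrite diff_perp // => /(_ (lexx 0)).
rewrite /gap (refl_perp mz) /refl opprD addrA subrr add0r opprK lorZl m1 mulr1 divr1.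
by rewrite pmulr_rlt0.
Qed.

(** The slice is centred at a = z2 - m, which makes [z2], where [diff] is positive, the pole where
    <m, .> takes its maximum 1. Let [z3] maximise <m, .> over the zeros of [diff]. The cap above
    [z3] has positive [diff] inside, so Hopf's lemma gives a nonzero slope at [z3]; but [z3] is an
    interior minimum of [diff]. *)
Lemma strong_maximum : (exists2 z, null z & 0 < lor m z /\ diff m z != 0) ->
  forall z, null z -> 0 < lor m z -> 0 < diff m z.
Proof.
move=> [z2' nz2' [mz2' dz2']] z1' nz1' mz1'; rewrite ltNge; apply/negP => dz1'.
pose z2 := (lor m z2')^-1 *: z2'.
have i2 : 0 < (lor m z2')^-1 by rewrite invr_gt0.
have nz2 : null z2 by exact: nullZ.
have mz2 : lor m z2 = 1 by rewrite lorZr mulVf // gt_eqF.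
have dz2 : 0 < diff m z2.
  rewrite (diffZ mm nz2' i2); apply: mulr_gt0 => //.
  by rewrite lt_def dz2' (dom nz2') // ltW.
pose a := z2 - m.
have am : lor a m = 0 by rewrite lorDl lorNl (lorC z2) mz2 m1 subrr.
have aa : lor a a = -1.
  by rewrite /a lorDl !lorDr !lorNl !lorNr nz2.1 (lorC z2) mz2 m1; ring.
have ha : hyp a.
  have [p hp mp] := perp_hyp mm; split => //.
  have [] // := @causal_future _ _ p a hp; rewrite ?aa ?lerN10 //.
  by rewrite /a lorDr lorNr (lorC p m) mp subr0; exact: causal_lt0 hp (null_causal nz2).
have az1' : lor a z1' < 0 := causal_lt0 ha (null_causal nz1').
pose K := [set z | lor z z = 0 /\ lor a z = -1] `&` [set z : E | 0 <= lor m z].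
have cm : closed [set z : E | 0 <= lor m z] by apply: closed_level_ge => x; exact: lor_continuous.
have cK : compact K := slice_compact ha cm.
have Kn x : K x -> null x by case=> -[xx ax] _; exact: slice_null ha xx ax.
pose Z := K `&` [set z | diff m z <= 0].
have cZ : compact Z.
  apply: (subclosed_compact _ cK) => [x clx|x []//].
  have Kx : K x.
    have clK : closed K by apply: compact_closed cK; exact: norm_hausdorff.
    by apply: clK; apply: closure_subset clx => y [].
  split => //=; rewrite leNgt; apply/negP => dx.
  have FF := within_filter K (nbhs_filter x).
  have dc : diff m y @[y --> within K (nbhs x)] --> diff m x.
    apply: (diff_cvg mm FF (Kn _ Kx)); last exact: cvg_within.
    by apply: filterS (withinT _ (nbhs_filter x)) => y; exact: Kn.
  have nb := cvgr_gt _ dc _ dx.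
  have [y [[Ky dy] /(_ Ky)]] := clx _ (nb FF).
  by rewrite ltNge dy.
pose z1 := (- lor a z1')^-1 *: z1'.
have i1 : 0 < (- lor a z1')^-1 by rewrite invr_gt0 oppr_gt0.
have mz1 : 0 < lor m z1 by rewrite lorZr mulr_gt0.
have Zz1 : Z z1.
  split; last by rewrite /= (diffZ mm _ i1) //; apply: mulr_ge0_le0 dz1'; exact: ltW.
  split; last by rewrite /= ltW.
  by have [h _] := nullZ i1 nz1'; split => //; rewrite lorZr invrN mulNr mulVf // lt_eqF.
have [z3 [K3 d3] max3] : exists2 z3, Z z3 & forall z, Z z -> lor m z <= lor m z3.
  apply: compact_max cZ _; first by exists z1.
  by move=> x _; exact: lor_continuous.
have [[zz3 az3] mz3] := K3; have nz3 := Kn _ K3.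
set s := lor m z3 in mz3 max3.
have s0 : 0 < s := lt_le_trans mz1 (max3 _ Zz1).
have s1 : s < 1.
  have sle : s <= 1.
    have := null_normal ha nz3 am m1; rewrite az3 opprK lorC -/s.
    by rewrite gtr0_norm.
  rewrite lt_neqAle sle andbT; apply: contraTneq d3 => s1; rewrite -ltNge.
  suff -> : z3 = z2 by [].
  have w0 : z3 - a - m = 0.
    apply: (tangent_eq0 ha); first by rewrite !lorDr !lorNr az3 aa am; ring.
    rewrite lor_sub3 zz3 aa m1 (lorC z3 a) az3 am (lorC z3 m) -/s s1; lra.
  by move/eqP: w0; rewrite subr_eq0 subr_eq => /eqP ->; rewrite /a addrC subrK.
have q0 : 0 < 1 - s ^+ 2 by move: s0 s1; nra.
pose r := (Num.sqrt (1 - s ^+ 2))^-1.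
have r0 : 0 < r by rewrite invr_gt0 sqrtr_gt0.
have r2 : r ^+ 2 * (1 - s ^+ 2) = 1.
  by rewrite exprVn sqr_sqrtr ?(ltW q0) // mulVf // gt_eqF.
(* On the slice of [a] the condition <b, .> >= 0 describes the cap <m, .> >= s; [a'] is a point of H
   orthogonal to [b], as Hopf's lemma demands. *)
pose a' := r *: (a + s *: m); pose b := r *: (m + s *: a).
have lE (x y x' y' : R) : lor (r *: (x *: a + y *: m)) (r *: (x' *: a + y' *: m)) = r ^+ 2 * (y * y' - x * x').
  by rewrite !lorZl !lorZr !lorDl !lorDr !lorZl !lorZr aa m1 am (lorC m) am; ring.
have a'E : a' = r *: (1 *: a + s *: m) by rewrite scale1r.
have bE : b = r *: (s *: a + 1 *: m) by rewrite scale1r addrC.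
have a'a' : lor a' a' = -1 by rewrite a'E lE; move: r2; lra.
have ha' : hyp a'.
  split => //; have [] // := @causal_future _ _ a a' ha; rewrite ?a'a' ?lerN10 //.
  by rewrite /a' lorZr lorDr lorZr aa am; move: r0; lra.
have a'b : lor a' b = 0 by rewrite a'E bE lE; ring.
have b1 : lor b b = 1 by rewrite bE lE; move: r2; lra.
have bz z : lor b z = r * (lor m z + s * lor a z) by rewrite /b lorZl lorDl lorZl.
have bm z : null z -> 0 <= lor b z -> 0 < lor m z.
  move=> nz; rewrite bz pmulr_rge0 //.
  have h : s * lor a z < 0 by rewrite pmulr_rlt0 // (causal_lt0 ha (null_causal nz)).
  by move: h; lra.
have bdpos z : null z -> 0 < lor b z -> 0 < diff m z.
  move=> nz bzp; have mz := bm z nz (ltW bzp).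
  have az : lor a z < 0 := causal_lt0 ha (null_causal nz).
  rewrite ltNge; apply/negP => dz.
  have i : 0 < (- lor a z)^-1 by rewrite invr_gt0 oppr_gt0.
  have Zz : Z ((- lor a z)^-1 *: z).
    split; last by rewrite /= (diffZ mm nz i); apply: mulr_ge0_le0 dz; exact: ltW.
    split; last by rewrite /= lorZr mulr_ge0 // ltW.
    by have [h _] := nullZ i nz; split => //; rewrite lorZr invrN mulNr mulVf // lt_eqF.
  have := max3 _ Zz; rewrite lorZr mulrC ler_pdivrMr ?oppr_gt0 //.
  by move: bzp; rewrite bz pmulr_rgt0 //; lra.
have b3 : lor b z3 = 0 by rewrite bz az3 -/s; ring.
have := hopf_boundary mm ha' a'b b1 mo (fun z nz h => ltW (bm z nz h))
  (fun z nz h => dom nz (ltW (bm z nz h))) bdpos nz3 b3 d3.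
have d30 : diff m z3 = 0 by apply/eqP; rewrite eq_le [X in X && _]d3 dom.
have a'z3 : lor a' z3 < 0 := causal_lt0 ha' (null_causal nz3).
(* in the direction - b the difference stays nonnegative *)
pose i3 := (- lor a' z3)^-1; have i30 : 0 < i3 by rewrite invr_gt0 oppr_gt0.
pose y := i3 *: z3; have ny : null y := nullZ i30 nz3.
have gy : gap m y = gap m z3 by rewrite /gap reflZ (touchZ nz3 i30) (touchZ (refl_null mm nz3) i30).
have a'y : lor a' y = -1 by rewrite lorZr /i3 invrN mulNr (mulVf (ltr0_neq0 a'z3)).
have yb : lor y (- b) = 0 by rewrite lorNr lorC lorZr b3 mulr0 oppr0.
have a'bN : lor a' (- b) = 0 by rewrite lorNr a'b oppr0.
have : 0 <= - lor (gap m y) (- b).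
  apply: (@diff_first m mm y (- b) (parab_acc a' y (- b)) 0 0 ny).
    by apply: nearW => t; exact: parab_null.
  have my : 0 < lor m y by rewrite lorZr mulr_gt0.
  have L : lor m y + t * lor m (- b) + t ^+ 2 * lor m (parab_acc a' y (- b)) @[t --> at0] --> lor m y.
    rewrite -[X in _ --> X]addr0 -[X in _ --> X + _]addr0.
    have -> : lor m y + 0 + 0 = lor m y + (0 : R) * lor m (- b) + (0 : R) ^+ 2 * lor m (parab_acc a' y (- b)) by ring.
    have c1 := @at0_cvg0 R; apply: cvgD.
      by apply: cvgD; [exact: cvg_cst|apply: cvgM; [exact: c1|exact: cvg_cst]].
    by apply: cvgM; [rewrite !expr2; apply: cvgM; exact: c1|exact: cvg_cst].
  near=> t; rewrite (diffZ mm nz3 i30) d30 !mulr0 !addr0; apply: dom; first exact: parab_null.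
  by rewrite lor_quad; apply: ltW; near: t; exact: cvgr_gt L _ my.
by rewrite gy lorNr opprK; lra.
Unshelve. all: by end_near. Qed.

End UnitReflection.

(** * Moving planes *)

Definition symmetric m := forall z, null z -> diff m z = 0.

Lemma refl_involutive_diff (m : E) z : diff m (refl m z) = - diff m z.
Proof. by rewrite /diff reflK opprB. Qed.

Lemma lor_refl_self (m z : E) : 0 < lor m m -> lor m (refl m z) = - lor m z.
Proof. by move=> mm; rewrite /refl lorDr lorNr lorZr divfK ?gt_eqF //; ring. Qed.

(** [diff] is odd under the reflection, so vanishing on the positive side means symmetry; otherwise
    the strong maximum principle holds for the normalised mirror vector. *)
Lemma dominates_dichotomy (m : E) : 0 < lor m m -> lor m o <= 0 -> dominates m ->
  symmetric m \/
  (forall z, null z -> 0 < lor m z -> 0 < diff m z) /\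
  (forall z, null z -> lor m z = 0 -> lor m (touch z) < 0).
Proof.
move=> mm mo dom; pose r := (Num.sqrt (lor m m))^-1.
have r0 : 0 < r by rewrite invr_gt0 sqrtr_gt0.
have rn := lt0r_neq0 r0.
have m1 : lor (r *: m) (r *: m) = 1.
  by rewrite lorZl lorZr mulrA -expr2 exprVn sqr_sqrtr ?(ltW mm) // mulVf // gt_eqF.
have mo1 : lor (r *: m) o <= 0 by rewrite lorZl mulr_ge0_le0 // ltW.
have dom1 : dominates (r *: m).
  by move=> z nz; rewrite lorZl pmulr_rge0 // diff_scale //; exact: dom.
have [ex|nex] := pselect (exists2 z, null z & 0 < lor m z /\ diff m z != 0).
  have ex1 : exists2 z, null z & 0 < lor (r *: m) z /\ diff (r *: m) z != 0.
    by have [z nz [h1 h2]] := ex; exists z; rewrite // lorZl pmulr_rgt0 // diff_scale.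
  have sm := strong_maximum m1 mo1 dom1 ex1; right; split => z nz.
    by have := sm z nz; rewrite lorZl pmulr_rgt0 // diff_scale.
  by have := boundary_slope m1 mo1 dom1 sm nz; rewrite !lorZl pmulr_rlt0 // => h mz; apply: h; rewrite mz mulr0.
left; have pos z : null z -> 0 < lor m z -> diff m z = 0.
  by move=> nz mz; apply: contrapT => /eqP dz; apply: nex; exists z.
move=> z nz; case: (ltgtP (lor m z) 0) => [mz|mz|mz]; [|exact: pos|exact: diff_perp].
apply: oppr_inj; rewrite -refl_involutive_diff oppr0; apply: pos; first exact: refl_null.
by rewrite lor_refl_self // oppr_gt0.
Qed.

(** [supp z] is at least the value at the point that touches in the mirrored direction. Domination
    thus follows wherever that point lies on the negative side of the mirror, even arbitrarily close
    to it. *)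
Lemma diff_lower (m : E) z : 0 < lor m m -> null z ->
  - (2 * lor m z / lor m m * lor m (touch (refl m z))) <= diff m z.
Proof.
move=> mm nz; have nz' := refl_null mm nz; have bt := touch_bnd nz'.
have h := supp_ge nz bt.1.
rewrite /diff; apply: le_trans (lerB h (lexx _)); rewrite /supp.
move: (touch _) => q; rewrite /refl lorDr lorNr lorZr (lorC m q).
by rewrite le_eqVlt; apply/orP; left; apply/eqP; ring.
Qed.

Lemma refl_cvg {T : Type} (F : set_system T) (u v : T -> E) (m z : E) : Filter F -> 0 < lor m m ->
  u t @[t --> F] --> m -> v t @[t --> F] --> z -> refl (u t) (v t) @[t --> F] --> refl m z.
Proof.
move=> FF mm um vz; apply: cvgB => //; apply: cvgZ => //.
apply: cvgM; first by apply: cvgM; [exact: cvg_cst|exact: lor_cvg].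
by apply: cvgV; [rewrite gt_eqF|exact: lor_cvg].
Qed.

Lemma diff_cvg2 {T : Type} (F : set_system T) (u v : T -> E) (m z : E) : Filter F -> 0 < lor m m ->
  null z -> u t @[t --> F] --> m -> v t @[t --> F] --> z -> (\forall t \near F, null (v t)) ->
  diff (u t) (v t) @[t --> F] --> diff m z /\
  touch (refl (u t) (v t)) @[t --> F] --> touch (refl m z).
Proof.
move=> FF mm nz um vz nv; have rc := refl_cvg FF mm um vz.
have uu : lor (u t) (u t) @[t --> F] --> lor m m by exact: lor_cvg.
have nr : \forall t \near F, null (refl (u t) (v t)).
  by apply: filterS2 nv (cvgr_gt _ uu _ mm) => t h1 h2; exact: refl_null.
split; last by apply: touch_cvg => //; exact: refl_null.
by apply: cvgB; apply: supp_cvg => //; exact: refl_null.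
Qed.

Section MovingPlanes.
Variable e : E.
Hypothesis eo : lor e o = 0.
Hypothesis ee : lor e e = 1.

Definition plane (t : R) : E := e + t *: o.

Lemma plane_lor t : lor (plane t) (plane t) = 1 - t ^+ 2.
Proof. by rewrite /plane !lorDl !lorDr !lorZl !lorZr ee eo (lorC o e) eo ho.1; ring. Qed.

Lemma plane_gt0 t : -1 < t -> t < 1 -> 0 < lor (plane t) (plane t).
Proof. by rewrite plane_lor; nra. Qed.

Lemma plane_o t : lor (plane t) o = - t.
Proof. by rewrite /plane lorDl lorZl eo ho.1; ring. Qed.

Lemma plane_cvg {T : Type} (F : set_system T) (u : T -> R) t : Filter F -> u s @[s --> F] --> t ->
  plane (u s) @[s --> F] --> plane t.
Proof. by move=> FF ut; apply: cvgD; [exact: cvg_cst|apply: cvgZ => //; exact: cvg_cst]. Qed.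

(** At t = 1 the mirror vector becomes the null vector o + e, whose products with boundary points
    are uniformly negative. Slightly earlier the whole boundary is still on the negative side, and
    [diff_lower] applies. *)
Lemma plane_start : exists2 t1 : R, 0 <= t1 < 1 & forall t, t1 <= t -> t < 1 -> dominates (plane t).
Proof.
have ne : null (o + e).
  apply: (slice_null ho); last by rewrite lorDr ho.1 lorC eo addr0.
  by rewrite !lorDl !lorDr ho.1 ee eo (lorC o e) eo; ring.
have [K [K0 HK]] := Omega_bounded.
have cont q : {for q, continuous (fun q : E => lor (o + e) q)} by exact: lor_continuous.
have B0 : exists2 B : R, 0 < B & forall q, bnd Omega q -> - lor q o <= B.
  exists (n.+2%:R * K * `|o| + 1).
    by rewrite ltr_wpDl // !mulr_ge0 // ltW.
  move=> q bq; rewrite (le_trans (ler_norm _)) // normrN (le_trans (lor_bound _ _)) //.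
  by rewrite ler_wpDr // ler_wpM2r // ler_wpM2l // HK //; case: bq.
have [B Bp HB] := B0.
have [g g0 Hg] : exists2 g : R, 0 < g & forall q, bnd Omega q -> lor (o + e) q <= - g.
  have [[q0 bq0]|nb] := pselect (exists p, bnd Omega p); last first.
    by exists 1 => // p bp; case: nb; exists p.
  have [q1 bq1 max1] := compact_max (ex_intro _ q0 bq0) bnd_compact (fun x _ => cont x).
  exists (- lor (o + e) q1); last by move=> q bq; rewrite opprK; exact: max1.
  by rewrite oppr_gt0 lorC; exact: causal_lt0 (bnd_hyp bq1) (null_causal ne).
pose s := Num.min 1 (g / (2 * B)).
have s0 : 0 < s by rewrite lt_min ltr01 divr_gt0 // mulr_gt0.
have sB : s * B <= g / 2.
  have -> : g / 2 = g / (2 * B) * B by field; rewrite gt_eqF.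
  by rewrite ler_pM2r // ge_min lexx orbT.
exists (1 - s).
  by rewrite subr_ge0 ge_min lexx /= gtrBl.
move=> t t1 tl z nz mz.
have s1 : s <= 1 by rewrite ge_min lexx.
have mt : 0 < lor (plane t) (plane t) by apply: plane_gt0 => //; move: t1 s1; lra.
apply: le_trans (diff_lower mt nz); rewrite oppr_ge0 mulr_ge0_le0 //.
  by rewrite divr_ge0 ?(ltW mt) // mulr_ge0.
have bt := touch_bnd (refl_null mt nz); have := Hg _ bt; have := HB _ bt.
rewrite /plane !lorDl lorZl (lorC (touch _) o) => h1 h2.
have : (1 - t) * - lor o (touch (refl (plane t) z)) <= s * B.
  by rewrite ler_pM ?subr_ge0 ?(ltW tl) //; [rewrite oppr_ge0 ltW // (causal_lt0 ho) //; exact: hyp_causal (bnd_hyp bt)|move: t1; lra].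
by move: h2 sB g0; rewrite /plane; lra.
Qed.

Lemma plane_closed t : 0 <= t -> t < 1 ->
  (forall d, 0 < d -> exists2 s, `|s - t| < d & dominates (plane s)) -> dominates (plane t).
Proof.
move=> t0 t1 appr z nz mz; have mt : 0 < lor (plane t) (plane t) by apply: plane_gt0 => //; lra.
have [mz0|mzp] := eqVneq (lor (plane t) z) 0; first by rewrite diff_perp.
have {}mz : 0 < lor (plane t) z by rewrite lt_def mzp.
rewrite leNgt; apply/negP => neg.
have ct : plane s @[s --> t] --> plane t by apply: plane_cvg; exact: cvg_id.
have nn : \forall s \near t, null z by exact: (@filterE _ (nbhs t) (nbhs_filter t) (fun _ => null z) (fun _ => nz)).
have [dc _] := diff_cvg2 (nbhs_filter t) mt nz ct (cvg_cst z) nn.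
have lc : lor (plane s) z @[s --> t] --> lor (plane t) z by exact: (lor_cvg _ ct (cvg_cst z)).
have : \forall s \near t, diff (plane s) z < 0 /\ 0 < lor (plane s) z.
  by apply: filterS2 (cvgr_lt _ dc _ neg) (cvgr_gt _ lc _ mz) => s.
move=> /nbhs_ballP [d d0 Hd]; have [s sd ds] := appr d d0.
have [|h1 h2] := Hd s; first by rewrite -ball_normE /= distrC.
by have := ds z nz (ltW h2); rewrite leNgt h1.
Qed.

(** Near a direction strictly inside the positive side, [diff > 0] persists; near one strictly
    outside, the claim is void. Near the mirror, where [diff] vanishes, the strict slope persists
    and [diff_lower] gives the sign. Compactness of the slice makes this uniform. *)
Lemma plane_open t : 0 <= t -> t < 1 -> dominates (plane t) -> ~ symmetric (plane t) ->
  exists2 d, 0 < d & forall s, `|s - t| < d -> dominates (plane s).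
Proof.
move=> t0 t1 dom nsym; have mt : 0 < lor (plane t) (plane t) by apply: plane_gt0 => //; lra.
have mo : lor (plane t) o <= 0 by rewrite plane_o oppr_le0.
have [//|[dpos slope]] := dominates_dichotomy mt mo dom.
pose K := [set z | lor z z = 0 /\ lor o z = -1] `&` [set: E].
have /compact_near_coveringP cov := slice_compact ho closedT.
have near_t : \forall s \near t, K `<=` (fun z => null z -> 0 <= lor (plane s) z -> 0 <= diff (plane s) z).
  apply: (cov _ (nbhs t) (fun s z => null z -> 0 <= lor (plane s) z -> 0 <= diff (plane s) z)).
  move=> z [[zz oz] _]; have nz := slice_null ho zz oz.
  pose G := within [set w : E * R | null w.1] (nbhs (z, t)).
  have FG : Filter G by exact: within_filter.
  have nG : \forall w \near G, null w.1 by exact: withinT.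
  have c1 : w.1 @[w --> G] --> z by apply: cvg_trans (cvg_app _ (cvg_within _)) _; exact: cvg_fst.
  have c2 : w.2 @[w --> G] --> t by apply: cvg_trans (cvg_app _ (cvg_within _)) _; exact: cvg_snd.
  have cp := plane_cvg FG c2.
  have [dc tc] := diff_cvg2 FG mt nz cp c1 nG.
  have lc : lor (plane w.2) w.1 @[w --> G] --> lor (plane t) z by exact: lor_cvg.
  suff : \forall w \near G, 0 <= lor (plane w.2) w.1 -> 0 <= diff (plane w.2) w.1.
    by apply: filterS => w h nw; exact: h.
  case: (ltgtP (lor (plane t) z) 0) => [mz|mz|mz].
  - by apply: filterS (cvgr_lt _ lc _ mz) => w h; rewrite leNgt h.
  - by apply: filterS (cvgr_gt _ dc _ (dpos z nz mz)) => w h _; exact: ltW.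
  have sl := slope z nz mz; rewrite refl_perp // in tc.
  have pc : lor (plane w.2) (touch (refl (plane w.2) w.1)) @[w --> G] --> lor (plane t) (touch z).
    exact: lor_cvg.
  have mc : lor (plane w.2) (plane w.2) @[w --> G] --> lor (plane t) (plane t) by exact: lor_cvg.
  apply: filterS3 nG (cvgr_lt _ pc _ sl) (cvgr_gt _ mc _ mt) => w nw h1 h2 h3.
  apply: le_trans (diff_lower h2 nw); rewrite oppr_ge0 mulr_ge0_le0 ?(ltW h1) //.
  by rewrite divr_ge0 ?(ltW h2) // mulr_ge0.
have /nbhs_ballP [d d0 Hd] := near_t.
exists (Num.min d (1 - t)); first by rewrite lt_min d0 subr_gt0.
move=> s; rewrite lt_min => /andP[sd st] z nz mz.
have ms : 0 < lor (plane s) (plane s).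
  by apply: plane_gt0; move: st; rewrite ltr_norml => /andP[]; lra.
have oz : lor o z < 0 := causal_lt0 ho (null_causal nz).
have i : 0 < (- lor o z)^-1 by rewrite invr_gt0 oppr_gt0.
have /Hd h : ball t d s by rewrite -ball_normE /= distrC.
have : 0 <= diff (plane s) ((- lor o z)^-1 *: z).
  apply: h; [|exact: nullZ|by rewrite lorZr mulr_ge0 // ltW].
  by have [n1 _] := nullZ i nz; split => //; split => //; rewrite lorZr invrN mulNr mulVf // lt_eqF.
by rewrite (diffZ ms nz i) pmulr_rge0.
Qed.

(** At a positive infimum of the dominating positions without symmetry, [plane_open] would push the
    infimum further down. *)
Lemma moving_planes : (exists2 t, 0 < t < 1 & symmetric (plane t)) \/ dominates e.
Proof.
have [ex|nex] := pselect (exists2 t, 0 < t < 1 & symmetric (plane t)); [by left|right].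
have [t1 /andP[t10 t11] Ht1] := plane_start.
pose S := [set s : R | 0 <= s /\ forall t, s <= t -> t < 1 -> dominates (plane t)].
have S1 : S t1 by [].
have Slb : has_lbound S by exists 0 => x [].
have Sinf : has_inf S by split => //; exists t1.
have s0 : 0 <= inf S by apply: lb_le_inf; [exists t1|move=> x []].
have s1 : inf S < 1 by apply: le_lt_trans (ge_inf Slb S1) t11.
have above t : inf S < t -> t < 1 -> dominates (plane t).
  move=> it tl; have d0 : 0 < t - inf S by rewrite subr_gt0.
  have [x [_ Sx] xt] := inf_adherent d0 Sinf; apply: Sx => //.
  by apply: ltW; move: xt; rewrite addrC subrK.
have at_inf : dominates (plane (inf S)).
  apply: plane_closed => // d d0.
  have i1 : 0 < 1 - inf S by rewrite subr_gt0.
  pose s := inf S + Num.min d (1 - inf S) / 2.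
  have m0 : 0 < Num.min d (1 - inf S) by rewrite lt_min d0.
  have md : Num.min d (1 - inf S) <= d by rewrite ge_min lexx.
  have ml : Num.min d (1 - inf S) <= 1 - inf S by rewrite ge_min lexx orbT.
  exists s; first by rewrite /s addrC addKr ger0_norm ?divr_ge0 ?(ltW m0) //; move: m0 md; lra.
  by apply: above; rewrite /s; move: m0 ml; lra.
have [s00|sn] := eqVneq (inf S) 0.
  by move: at_inf; rewrite s00 /plane scale0r addr0.
have sp : 0 < inf S by rewrite lt_def sn.
have [d d0 Hd] := plane_open s0 s1 at_inf (fun h => nex (ex_intro2 _ _ (inf S) (introT andP (conj sp s1)) h)).
pose m := Num.min d (inf S).
have m0 : 0 < m by rewrite lt_min d0.
have md : m <= d by rewrite ge_min lexx.
have ms : m <= inf S by rewrite ge_min lexx orbT.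
have : S (inf S - m / 2).
  split; first by move: ms m0; lra.
  move=> t st tl; have [lt|ge] := ltP (inf S) t; first exact: above.
  by apply: Hd; rewrite ler0_norm ?subr_le0 //; move: st md m0; lra.
by move=> /(ge_inf Slb); move: m0; lra.
Qed.

End MovingPlanes.

(** Opposite mirror vectors define the same reflection, so [diff] is nonnegative on both sides, and
    it is odd. *)
Lemma dominates_both (e : E) : 0 < lor e e -> dominates e -> dominates (- e) -> symmetric e.
Proof.
move=> ee d1 d2 z nz; have nz' := refl_null ee nz.
have dN x : diff (- e) x = diff e x by rewrite -scaleN1r diff_scale ?oppr_eq0 ?oner_eq0.
have both x : null x -> 0 <= diff e x.
  move=> nx; case: (leP 0 (lor e x)) => h; first exact: d1.
  by rewrite -dN; apply: d2 => //; rewrite lorNl oppr_ge0 ltW.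
apply/eqP; rewrite eq_le both // andbT -oppr_ge0 -refl_involutive_diff; exact: both.
Qed.

Lemma symmetric_scale (r : R) (m : E) : r != 0 -> symmetric m -> symmetric (r *: m).
Proof. by move=> r0 sm z nz; rewrite diff_scale // sm. Qed.

Lemma symmetry_exists (e : E) : lor e o = 0 -> lor e e = 1 ->
  exists2 t : R, -1 < t < 1 & symmetric (e + t *: o).
Proof.
move=> eo ee; have eoN : lor (- e) o = 0 by rewrite lorNl eo oppr0.
have eeN : lor (- e) (- e) = 1 by rewrite lorNl lorNr opprK.
have [[t /andP[t0 t1] st]|d1] := moving_planes eo ee.
  by exists t => //; rewrite t1 andbT (lt_trans _ t0) // ltrN10.
have [[t /andP[t0 t1] st]|d2] := moving_planes eoN eeN.
  exists (- t); first by rewrite ltrN2 t1 (lt_trans _ ltr01) // oppr_lt0.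
  have -> : e + (- t) *: o = (-1) *: plane (- e) t by rewrite /plane; apply/rowP => i; rewrite !mxE; ring.
  by apply: symmetric_scale => //; rewrite oppr_eq0 oner_eq0.
exists 0; first by rewrite ltrN10 ltr01.
by rewrite scale0r addr0; apply: dominates_both => //; rewrite ee.
Qed.

(** * Symmetries and spheres *)

(** As [diff] vanishes identically, so do its first variations in the directions tangent to the
    slice. The component of the gap along [z] is - diff, and [gap_bound] controls the last one. *)
Lemma gap_zero (m z : E) : 0 < lor m m -> symmetric m -> null z -> touch z = refl m (touch (refl m z)).
Proof.
move=> mm sm nz'; suff H z0 : null z0 -> lor timevec z0 = -1 -> gap m z0 = 0.
  have tz : lor timevec z < 0 := causal_lt0 (@hyp_time R n) (null_causal nz').
  have r0 : 0 < (- lor timevec z)^-1 by rewrite invr_gt0 oppr_gt0.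
  have t1 : lor timevec ((- lor timevec z)^-1 *: z) = -1.
    by rewrite lorZr invrN mulNr mulVf // lt_eqF.
  have := H _ (nullZ r0 nz') t1 => /eqP.
  rewrite /gap reflZ (touchZ nz' r0) (touchZ (refl_null mm nz') r0) subr_eq0 => /eqP.
  by [].
move=> nz az; set a := timevec in az *.
have ha : hyp a := @hyp_time R n.
have azv : lor a (z0 - a) = 0 by rewrite lorDr lorNr az ha.1; ring.
have vv1 : lor (z0 - a) (z0 - a) = 1.
  by rewrite lorDl !lorDr !lorNl !lorNr nz.1 ha.1 az (lorC z0 a) az; ring.
have [f ff] := frame_exists ha azv vv1; have [af vf fo fx] := ff.
have zf j : lor z0 (f j) = 0 by have := vf j; rewrite lorDl lorNl af subr0.
have diff0 v : lor a v = 0 -> lor z0 v = 0 -> 0 <= - lor (gap m z0) v.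
  move=> av zv; apply: (@diff_first m mm z0 v (parab_acc a z0 v) 0 0 nz).
    by apply: nearW => t; exact: parab_null.
  apply: nearW => t; rewrite (sm _ nz) (sm _ (parab_null ha nz az av zv t)).
  by rewrite !mulr0 !addr0.
have gf j : lor (gap m z0) (f j) = 0.
  have h1 := diff0 (f j) (af j) (zf j).
  have h2 : 0 <= - lor (gap m z0) (- f j) by apply: diff0; rewrite lorNr ?af ?zf oppr0.
  by move: h1 h2; rewrite lorNr; lra.
have [C C0 HC] := gap_bound mm ha.
have gz : lor (gap m z0) z0 = 0 by apply: oppr_inj; rewrite -diff_gap sm // oppr0.
have := HC z0 f nz az ff; rewrite sm // lexx => /(_ isT).
rewrite big1 => [|j _]; last by rewrite gf normr0.
rewrite addr0 mulr0 normr_le0 => /eqP; rewrite lorDr lorNr lorZr gz subr0 => ga2.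
have ga : lor (gap m z0) a = 0 by move: ga2; lra.
rewrite (fx (gap m z0)) lorDl lorNl (lorC a) (lorC z0) ga gz subrr oppr0 !scale0r !add0r.
by apply: big1 => j _; rewrite lorC gf scale0r.
Qed.

Lemma bnd_refl (m p : E) : 0 < lor m m -> symmetric m -> bnd Omega p -> bnd Omega (refl m p).
Proof.
move=> mm sm bp; have [nh _] := horo_null bp.
have := gap_zero mm sm nh; rewrite (touch_horo bp) => {1}->; rewrite reflK.
by apply: touch_bnd; exact: refl_null.
Qed.

Lemma bnd_nonempty : exists p, bnd Omega p.
Proof.
have [z nz] : exists z : E, null z.
  have ha := @hyp_time R n; exists (timevec + spacevec ord0).
  have ts : lor (timevec : E) (spacevec ord0) = 0 by rewrite lor_timel !mxE oppr0.
  have ss : lor (spacevec ord0 : E) (spacevec ord0) = 1 by rewrite lor_spacel !mxE !eqxx.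
  apply: (slice_null ha); last by rewrite lorDr ha.1 ts addr0.
  by rewrite lorDl !lorDr ha.1 ts ss (lorC (spacevec _)) ts; ring.
by exists (touch z); exact: touch_bnd.
Qed.

(* All touching points lie at the same distance from the centre: reflections through the centre
   act transitively on the null directions. *)
Lemma sphere_of_symmetries c : hyp c ->
  (forall b, lor b c = 0 -> lor b b = 1 -> symmetric b) ->
  exists2 C : R, 1 < C & bnd Omega = [set x | hyp x /\ - lor c x = C].
Proof.
move=> hc sym.
have sym' (b : E) : lor b c = 0 -> 0 < lor b b -> symmetric b.
  move=> bc bb; have s0 : 0 < Num.sqrt (lor b b) by rewrite sqrtr_gt0.
  have -> : b = Num.sqrt (lor b b) *: ((Num.sqrt (lor b b))^-1 *: b).
    by rewrite scalerA mulfV ?scale1r // gt_eqF.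
  apply: symmetric_scale; first by rewrite gt_eqF.
  apply: sym; first by rewrite lorZl bc mulr0.
  by rewrite lorZl lorZr mulrA -expr2 exprVn sqr_sqrtr ?(ltW bb) // mulVf // gt_eqF.
have tangent (b : E) : lor b c = 0 -> b != 0 -> 0 < lor b b.
  move=> bc /eqP b0; rewrite ltNge; apply/negP => bb; apply: b0.
  by apply: (tangent_eq0 hc) => //; rewrite lorC.
have const z z' : null z -> null z' -> lor c z = -1 -> lor c z' = -1 ->
    lor c (touch z) = lor c (touch z').
  move=> nz nz' cz cz'; have [->//|zz'] := eqVneq z z'.
  have bc : lor (z - z') c = 0 by rewrite lorC lorDr lorNr cz cz' subrr.
  have bb : 0 < lor (z - z') (z - z') by apply: tangent; rewrite // subr_eq0.
  have sw : refl (z - z') z = z'.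
    by apply: refl_swap; [rewrite nz.1 nz'.1|move=> h; move: bb; rewrite h ltxx].
  rewrite (gap_zero bb (sym' _ bc bb) nz) sw -refl_lorC; congr (lor _ _).
  by apply: refl_perp.
have [p0 bp0] := bnd_nonempty.
have norm p : bnd Omega p -> exists z, [/\ null z, lor c z = -1 & touch z = p].
  move=> bp; have [nh _] := horo_null bp.
  have ch : lor c (horo p) < 0 := causal_lt0 hc (null_causal nh).
  have r0 : 0 < (- lor c (horo p))^-1 by rewrite invr_gt0 oppr_gt0.
  exists ((- lor c (horo p))^-1 *: horo p); split; first exact: nullZ.
    by rewrite lorZr invrN mulNr mulVf // lt_eqF.
  by rewrite (touchZ nh r0) touch_horo.
have same p : bnd Omega p -> - lor c p = - lor c p0.
  move=> bp; have [z [nz cz <-]] := norm p bp; have [z' [nz' cz' <-]] := norm p0 bp0.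
  by rewrite (const z z').
exists (- lor c p0).
  have hp0 := bnd_hyp bp0; rewrite lt_neqAle [X in _ && X]lerNr (hyp_le hc hp0) andbT.
  (* If C were 1, the boundary would be the single point [c]. The null vector c + nu c, opposite to
     [horo c], would then touch there as well, which forces nu c = 0. *)
  apply/negP => /eqP e1.
  have pc p : bnd Omega p -> p = c.
    by move=> bp; apply: (hyp_eq hc (bnd_hyp bp)); rewrite lerNl same // e1.
  have bc : bnd Omega c by rewrite -(pc p0 bp0).
  have [nh chh] := horo_null bc; have [cn nn] := normal_props Hnu bc.
  have nz' : null (2 *: c - horo c).
    apply: (slice_null hc); last by rewrite lorDr lorNr lorZr hc.1 chh; ring.
    rewrite lorDl lorNl lorZl !lorDr !lorNr !lorZr hc.1 chh nh.1 (lorC _ c) chh; ring.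
  have [b1 E1 _] := touchP nz'; rewrite (pc _ b1) in E1.
  have s1 : supp (2 *: c - horo c) = 1.
    have := congr1 (lor c) E1; rewrite lorDr lorNr !lorZr hc.1 chh; lra.
  have nu0 : nu c = 0.
    move: E1; rewrite s1 scale1r horoE => /rowP E1; apply/rowP => i.
    by have := E1 i; rewrite !mxE; lra.
  by move: nn; rewrite nu0 lor0l => /esym /eqP; rewrite oner_eq0.
apply/seteqP; split => x /=; first by move=> bx; split; [exact: bnd_hyp|exact: same].
move=> [hx cx]; have hp0 := bnd_hyp bp0; have [->//|xp] := eqVneq x p0.
have bc : lor (p0 - x) c = 0 by rewrite lorC lorDr lorNr; move: cx; lra.
have bb : 0 < lor (p0 - x) (p0 - x) by apply: tangent; rewrite // subr_eq0 eq_sym.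
have <- : refl (p0 - x) p0 = x.
  by apply: refl_swap; [rewrite hx.1 hp0.1|move=> h; move: bb; rewrite h ltxx].
exact: bnd_refl bb (sym' _ bc bb) bp0.
Qed.

Lemma lip_cvg (G : E -> R) (C : R) : 0 < C -> (forall x y, G x <= G y + C * `|x - y|) ->
  forall (F : set_system E) x, Filter F -> y @[y --> F] --> x -> G y @[y --> F] --> G x.
Proof.
move=> C0 HG F x FF Fx; apply/cvgrPdist_le => e e0.
have e1 : 0 < e / C by rewrite divr_gt0.
move/cvgrPdist_le: Fx => /(_ _ e1); apply: filterS => y; rewrite ler_pdivlMr // mulrC => h.
have h1 := HG x y; have h2 := HG y x; rewrite distrC in h2.
by rewrite ler_norml; apply/andP; split; move: h h1 h2; lra.
Qed.

Lemma farthest_exists c : exists q, bnd Omega q /\ forall q', bnd Omega q' -> - lor q' c <= - lor q c.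
Proof.
have [p0 bp0] := bnd_nonempty.
have [q bq qmax] : exists2 q, bnd Omega q & forall q', bnd Omega q' -> - lor q' c <= - lor q c.
  apply: (compact_max (ex_intro _ p0 bp0) bnd_compact) => x _.
  have h : lor y c @[y --> x] --> lor x c.
    by under eq_fun do rewrite lorC; rewrite lorC; exact: lor_continuous.
  exact: (cvgN h).
by exists q.
Qed.

(* The circumcentre is unique because the circumradius function is strictly convex. *)
Lemma circumcenter : exists2 c, hyp c & forall m, 0 < lor m m -> symmetric m -> lor m c = 0.
Proof.
have [far Hfar] := boolp.choice farthest_exists.
(* For [c] in H this is cosh of the distance to the farthest boundary point. *)
pose G c := - lor (far c) c.
have Gge c q : bnd Omega q -> - lor q c <= G c by move=> bq; exact: (Hfar c).2.
have [K [K0 HK]] := Omega_bounded.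
have C0 : 0 < n.+2%:R * K by rewrite mulr_gt0 ?ltr0n.
have Glip c c' : G c <= G c' + n.+2%:R * K * `|c - c'|.
  have -> : G c = - lor (far c) c' - lor (far c) (c - c') by rewrite /G lorDr lorNr; ring.
  rewrite lerD ?Gge //; first exact: (Hfar c).1.
  rewrite (le_trans (ler_norm _)) // normrN (le_trans (lor_bound _ _)) //.
  by rewrite ler_wpM2r // ler_wpM2l // HK //; case: (Hfar c) => -[].
have Gc c : {for c, continuous (fun c => - G c)}.
  have h : G y @[y --> c] --> G c.
    exact: (lip_cvg C0 Glip (nbhs_filter c) cvg_id).
  exact: (cvgN h).
have [p0 bp0] := bnd_nonempty; have hp0 := bnd_hyp bp0.
(* Outside [A] the distance to [p0] alone makes [G] exceed [G o], so minimising over the compact set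
   [A] is enough. *)
pose A := @hyp R n `&` [set c | - lor p0 c <= G o].
have cA : compact A.
  apply: bounded_closed_compact.
    exists (2 * p0 0 0 * G o); split; first by rewrite num_real.
    move=> M ltM c [hc cG] /=; apply: le_trans (ltW ltM).
    apply: le_trans (causal_norm hp0 (hyp_causal hc)) _.
    by rewrite ler_wpM2l // mulr_ge0 // ltW //; case: hp0.
  apply: closedI; first exact: hyp_closed.
  have -> : [set c : E | - lor p0 c <= G o] = [set c : E | - G o <= lor p0 c].
    by apply/seteqP; split => x /=; rewrite lerNl.
  by apply: closed_level_ge => x; exact: lor_continuous.
have [c [hc Ac] cmin] : exists2 c, A c & forall x, A x -> - G x <= - G c.
  by apply: (compact_max _ cA) => [|x _]; [exists o; split => //; exact: Gge|exact: Gc].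
have gmin x : hyp x -> G c <= G x.
  move=> hx; have [Ax|Ax] := leP (- lor p0 x) (G o).
    by rewrite -lerN2; exact: cmin.
  have Ao : A o by split => //; exact: Gge.
  apply: (@le_trans _ _ (G o)); first by rewrite -lerN2; exact: cmin.
  by apply: le_trans (ltW Ax) _; exact: Gge.
have Gpos x : hyp x -> 0 < G x.
  by move=> hx; rewrite oppr_gt0; apply: causal_lt0 (bnd_hyp (Hfar x).1) (hyp_causal hx).
have uniq x : hyp x -> G x <= G c -> x = c.
  move=> hx Gx; apply: contrapT => xc.
  have cx : lor c x < -1 by rewrite ltNge; apply/negP => h; exact: xc (hyp_eq hc hx h).
  have ll : lor (c + x) (c + x) = - 2 + 2 * lor c x.
    by rewrite lorDl !lorDr hc.1 hx.1 (lorC x); ring.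
  have l0 : lor (c + x) (c + x) < 0 by rewrite ll; lra.
  (* This is the strict convexity: the midpoint of two distinct points is (c + x) / tlen (c + x),
     and dividing by more than 2 makes [G] smaller there than the average of its values. *)
  have t2 : 2 < tlen (c + x).
    have t0 := tlen_gt0 l0; rewrite -(@ltr_pXn2r _ 2) ?nnegrE ?(ltW t0) //.
    by rewrite tlen_sqr // ll; lra.
  have hm : hyp (nrm (c + x)).
    by apply: nrm_hyp; rewrite ?mxE ?addr_gt0 //; [case: hc|case: hx].
  have := gmin _ hm; rewrite {2}/G lorC nrm_lor lorDl.
  set q := far _; have bq : bnd Omega q := (Hfar _).1.
  have h1 := Gge c q bq; have h2 := Gge x q bq; rewrite (lorC q) in h1; rewrite (lorC q) in h2.
  have t0 : 0 < tlen (c + x) by apply: lt_trans t2.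
  rewrite -mulNr ler_pdivlMr // => h.
  have g0 := Gpos c hc; have : G c * 2 < G c * tlen (c + x) by rewrite ltr_pM2l.
  by lra.
exists c => // m mm sm.
have Rc : refl m c = c.
  apply: uniq; first exact: refl_hyp.
  rewrite {1}/G -refl_lorC; apply: Gge; apply: (bnd_refl mm sm); exact: (Hfar _).1.
have := lor_refl_self c mm; rewrite Rc; lra.
Qed.

(** A unit vector [b] orthogonal to the circumcentre is a multiple of a mirror vector. Moving planes
    along the normalised part [e] of [b] orthogonal to [o] yields a symmetry e + t o that
    annihilates [c]; since <o, c> is nonzero, this condition determines t, and [b] satisfies it
    too. *)
Lemma bnd_sphere : exists c, hyp c /\ exists2 C : R, 1 < C & bnd Omega = [set x | hyp x /\ - lor c x = C].
Proof.
have [c hc cfix] := circumcenter; exists c; split => //; apply: sphere_of_symmetries => // b bc bb.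
pose e' := b + lor b o *: o.
have eo' : lor e' o = 0 by rewrite /e' lorDl lorZl ho.1; ring.
have ee' : 0 < lor e' e'.
  rewrite /e' lorDl !lorDr !lorZl !lorZr ho.1 bb (lorC o b).
  by have := sqr_ge0 (lor b o); lra.
pose r := Num.sqrt (lor e' e'); have r0 : 0 < r by rewrite sqrtr_gt0.
pose e := r^-1 *: e'.
have eo : lor e o = 0 by rewrite lorZl eo' mulr0.
have ee : lor e e = 1.
  by rewrite lorZl lorZr mulrA -expr2 exprVn sqr_sqrtr ?(ltW ee') // mulVf // gt_eqF.
have [t /andP[t0 t1] st] := symmetry_exists eo ee.
have mm : 0 < lor (e + t *: o) (e + t *: o) by exact: plane_gt0.
have mc := cfix _ mm st.
have bE : b = r *: e - lor b o *: o by rewrite /e scalerA mulfV ?gt_eqF // scale1r /e' addrK.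
have oc : lor o c < 0 := causal_lt0 ho (hyp_causal hc).
have bt : lor b o = - r * t.
  move: bc; rewrite {1}bE lorDl lorNl (lorZl r) (lorZl (lor b o)).
  move: mc; rewrite lorDl (lorZl t) => mc bc.
  have : (r * t + lor b o) * lor o c = 0.
    by have := congr1 ( *%R r) mc; move: bc; lra.
  by move/eqP; rewrite mulf_eq0 (lt_eqF oc) orbF => /eqP; lra.
have -> : b = r *: (e + t *: o).
  have gen (x y : E) : r *: x - (- r * t) *: y = r *: (x + t *: y).
    by apply/rowP => i; rewrite !mxE; ring.
  by rewrite {1}bE bt gen.
by apply: symmetric_scale => //; rewrite gt_eqF.
Qed.

Hypothesis chi_strict : forall s t : R, 0 < s -> s < t -> chi s < chi t.
Hypothesis hn : (2 <= n)%N.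

(* For a reflection symmetry the second-order data at z and at its mirror image agree, while the
   weight <o, .> differs unless o lies on the mirror. *)
Lemma symmetric_through_origin (m : E) : lor m m = 1 -> lor m o <= 0 -> symmetric m -> lor m o = 0.
Proof.
move=> m1 mo sm; have mm : 0 < lor m m by rewrite m1.
apply/eqP; rewrite eq_le mo /= leNgt; apply/negP => neg.
have [a ha ma] := perp_hyp mm; have am : lor a m = 0 by rewrite lorC.
pose z := a + m.
have az : lor a z = -1 by rewrite /z lorDr ha.1 am addr0.
have mz : lor m z = 1 by rewrite /z lorDr ma m1 add0r.
have nz : null z.
  by apply: (slice_null ha _ az); rewrite /z lorDl !lorDr ha.1 am ma m1; ring.
have nz' := refl_null mm nz.
have [b1 E1 _] := touchP nz; have [b2 E2 _] := touchP nz'.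
have [e [kappa D1]] := frame_data_exists b1; have [e' [kappa' D2]] := frame_data_exists b2.
have [f [af vf fo fx]] := frame_exists ha am m1.
have i0 : 'I_n := Ordinal (ltnW hn).
have fii : lor (f i0) (f i0) = 1 by rewrite fo eqxx.
(* Gain and loss are both 0 here, so any unit vector orthogonal to [a] with <b, z>^2 <= 1 / 2 can
   serve as [b]. The conclusion bounds [chi] at z by [chi] at the mirror image, whereas the argument
   of [chi] strictly drops. *)
have [ca [cb [_ _ Hab]]] := hess_compare mm ha (af i0) fii.
have fz2 : lor (f i0) z ^+ 2 <= 1 / 2.
  by rewrite /z lorDr (lorC _ a) af (lorC _ m) vf addr0 expr0n divr_ge0.
have S0 := supp_gt0 nz.
have SS : supp (refl m z) = supp z by apply/esym/eqP; rewrite -subr_eq0; apply/eqP; exact: sm.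
have g0 : gap m z = 0 by rewrite /gap -(gap_zero mm sm nz) subrr.
have form v : lor a v = 0 -> lor z v = 0 ->
    \sum_i lor (e' i) (refl m v) ^+ 2 / (kappa' i - 1) + 0 * lor (f i0) v ^+ 2 <=
    \sum_i lor (e i) v ^+ 2 / (kappa i - 1) + 0 * lor v v.
  move=> av zv; have avN : lor a (- v) = 0 by rewrite lorNr av oppr0.
  have zvN : lor z (- v) = 0 by rewrite lorNr zv oppr0.
  have acN : parab_acc a z (- v) = parab_acc a z v by rewrite /parab_acc lorNl lorNr opprK.
  have nc t := parab_null ha nz az av zv t.
  have nc' t : null (z + t *: (- v) + t ^+ 2 *: parab_acc a z v).
    by have := parab_null ha nz az avN zvN t; rewrite acN.
  have low (w : R -> E) eta : 0 < eta -> (forall t, null (w t)) ->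
      \forall t \near at0, diff m z + t * 0 + t ^+ 2 * (0 - eta) <= diff m (w t).
    move=> eta0 nw; apply: nearW => t; rewrite (sm _ nz) (sm _ (nw t)) mulr0 !add0r.
    by rewrite mulrN oppr_le0 mulr_ge0 ?sqr_ge0 // ltW.
  have low' eta : 0 < eta -> \forall t \near at0, diff m z - t * 0 + t ^+ 2 * (0 - eta) <=
      diff m (z + t *: (- v) + t ^+ 2 *: parab_acc a z v).
    by move=> eta0; apply: filterS (low _ _ eta0 nc') => t; rewrite mulr0 oppr0.
  have [_] := @diff_second m mm z v (parab_acc a z v) 0 0 e kappa e' kappa' nz D1 D2
    (nearW _ nc) (nearW _ nc') (fun eta eta0 => low _ eta eta0 nc) low'.
  rewrite g0 lor0l addr0 /supp_hess SS subr_ge0 ler_pM2l ?invr_gt0 ?mulr_gt0 //.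
  by rewrite !mul0r !addr0.
have := Hab _ _ _ _ _ _ _ nz az D1 D2 (lexx 0) (lexx 0) fz2 form.
rewrite !mulr0 subr0 subr_ge0 leNgt => /negP; apply.
have [nh _] := horo_null b2.
apply: chi_strict; first by rewrite oppr_gt0; exact: causal_lt0 ho (null_causal nh).
rewrite -(ltr_pM2l S0).
have -> : supp z * - lor o (horo (touch z)) = - lor o z by rewrite mulrN -lorZr -E1.
have -> : supp z * - lor o (horo (touch (refl m z))) = - lor o (refl m z) by rewrite mulrN -lorZr -SS -E2.
by rewrite ltrN2 /refl lorDr lorNr lorZr mz m1 (lorC o m); lra.
Qed.

Lemma bnd_sphere_strict : exists2 C : R, 1 < C & bnd Omega = [set x | hyp x /\ - lor o x = C].
Proof.
apply: (sphere_of_symmetries ho) => e eo ee.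
have dom (e0 : E) : lor e0 o = 0 -> lor e0 e0 = 1 -> dominates e0.
  move=> eo0 ee0; have [[t /andP[t0 t1] st]|//] := moving_planes eo0 ee0; exfalso.
  have mm : 0 < lor (plane e0 t) (plane e0 t).
    by apply: plane_gt0 => //; apply: lt_trans t0; rewrite ltrN10.
  pose r := (Num.sqrt (lor (plane e0 t) (plane e0 t)))^-1.
  have r0 : 0 < r by rewrite invr_gt0 sqrtr_gt0.
  have m1 : lor (r *: plane e0 t) (r *: plane e0 t) = 1.
    by rewrite lorZl lorZr mulrA -expr2 exprVn sqr_sqrtr ?(ltW mm) // mulVf // gt_eqF.
  have mo : lor (r *: plane e0 t) o = - (r * t) by rewrite lorZl plane_o // mulrN.
  have rt : 0 < r * t by rewrite mulr_gt0.
  have := symmetric_through_origin m1 _ (symmetric_scale (lt0r_neq0 r0) st).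
  by rewrite mo oppr_le0 (ltW rt) => /(_ isT); lra.
apply: dominates_both; first by rewrite ee.
  exact: dom.
by apply: dom; rewrite ?lorNl ?lorNr ?opprK ?eo ?oppr0.
Qed.

End Domain.

(** * Distance and the function V in the hyperboloid model *)

Section HyperbolicDistance.
Context {R : realType} {n : nat}.
Local Notation E := 'rV[R]_n.+2.

Lemma cosh_arcosh (t : R) : 1 <= t -> cosh (arcosh t) = t.
Proof.
move=> t1; have s0 : 0 <= t ^+ 2 - 1 by rewrite subr_ge0 expr2 mulr_ege1.
rewrite /cosh /arcosh; set s := Num.sqrt _.
have s2 : s ^+ 2 = t ^+ 2 - 1 by rewrite sqr_sqrtr.
have sp : 0 <= s by rewrite sqrtr_ge0.
have ts : 0 < t + s by rewrite ltr_pwDl // (lt_le_trans ltr01).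
rewrite expRN lnK ?posrE //.
have -> : (t + s)^-1 = t - s.
  by apply: (mulfI (lt0r_neq0 ts)); rewrite mulfV ?gt_eqF //; move: s2; lra.
by field.
Qed.

Lemma arcosh_gt0 (t : R) : 1 < t -> 0 < arcosh t.
Proof. by move=> t1; rewrite ln_gt0 // ltr_wpDr // sqrtr_ge0. Qed.

Lemma geodesic_sphere_lor (c : E) (S : set E) (C : R) : hyp c -> 1 < C ->
  S = [set x | hyp x /\ - lor c x = C] -> geodesic_sphere c S.
Proof.
move=> hc C1 ->; exists (arcosh C); first exact: arcosh_gt0.
apply/seteqP; split => x [hx /= h]; split => //; first by rewrite /hdist h.
rewrite -[LHS]cosh_arcosh; first by rewrite -/(hdist c x) h cosh_arcosh // ltW.
by rewrite lerNr; exact: hyp_le.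
Qed.

Lemma V_lor (o x : E) : 1 <= - lor o x -> V o x = - lor o x.
Proof. exact: cosh_arcosh. Qed.

(** The formula V = - <o, .> is valid where - <o, .> is at least 1. Along p + h nu p this holds for
    small h if p differs from [o], by strictness at [p]; for p = o the product is constantly -1, as
    the normal is orthogonal to [o]. *)
Lemma Vnu_lor (o p : E) (nu : E -> E) : hyp o -> hyp p -> lor p (nu p) = 0 ->
  Vnu o nu p = - lor o (nu p).
Proof.
move=> ho hp pn; rewrite /Vnu /derive; apply: cvg_lim; first exact: norm_hausdorff.
have lE (h : R) : lor o (h *: nu p + p) = h * lor o (nu p) + lor o p by rewrite lorDr lorZr.
have near1 : \forall h \near (0 : R)^', 1 <= - lor o (h *: nu p + p).
  have [po|op] := eqVneq p o.
    by apply: filterE => h; rewrite lE -po pn hp.1 mulr0 add0r opprK.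
  have o1 : 1 < - lor o p.
    rewrite lt_neqAle [X in _ && X]lerNr (hyp_le ho hp) andbT.
    apply: contraNneq op => h; apply/eqP; apply: (hyp_eq ho hp); by rewrite lerNl -h.
  have L : - lor o (h *: nu p + p) @[h --> (0 : R)^'] --> - lor o p.
    have -> : - lor o p = - ((0 : R) * lor o (nu p) + lor o p) by rewrite mul0r add0r.
    under eq_fun do rewrite lE; apply: cvgN; apply: cvgD; last exact: cvg_cst.
    apply: cvgM; last exact: cvg_cst.
    exact: (cvg_trans (cvg_app _ (@nbhs_dnbhs _ (0 : R))) cvg_id).
  near=> h; apply: ltW; near: h; exact: (cvgr_gt _ L _ o1).
have FF := dnbhs_filter (0 : R).
apply: (cvg_trans _ (@cvg_cst _ (- lor o (nu p) : R^o) _ ((0 : R)^') FF)); apply: near_eq_cvg.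
near=> h; have h0 : h != 0 by near: h; exact: (nbhs_dnbhs_neq (0 : R)).
have h1 : 1 <= - lor o (h *: nu p + p) by near: h.
rewrite /= (V_lor h1) V_lor ?lE; last by rewrite lerNr; exact: hyp_le.
by rewrite /GRing.scale /=; field.
Unshelve. all: by end_near. Qed.

End HyperbolicDistance.

Unset Implicit Arguments.

Theorem theorem1p3 (R : realType) (n : nat) (hn : (2 <= n)%N)
    (o : 'rV[R]_n.+2) (ho : hyp o)
    (chi : R -> R)
    (chi_smooth : @smooth_on R R^o R^o [set t : R | 0 < t] chi)
    (chi_pos : forall t : R, 0 < t -> 0 < chi t)
    (chi_mono : forall s t : R, 0 < s -> s <= t -> chi s <= chi t)
    (Omega : set 'rV[R]_n.+2) (nu : 'rV[R]_n.+2 -> 'rV[R]_n.+2)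
    (Omega_dom : bounded_domain Omega)
    (Omega_smooth : smooth_boundary Omega)
    (nu_normal : unit_outward_normal Omega nu)
    (Omega_hconvex : uniformly_hconvex Omega nu)
    (k : nat) (hk : (1 <= k <= n)%N)
    (curv_eq : forall (p : 'rV[R]_n.+2) (kappa : 'I_n -> R),
      bnd Omega p -> principal_curvatures nu p kappa ->
      Ek k (shifted kappa) = chi (V o p - Vnu o nu p)) :
  (exists2 c, hyp c & geodesic_sphere c (bnd Omega)) /\
  ((forall s t : R, 0 < s -> s < t -> chi s < chi t) ->
   geodesic_sphere o (bnd Omega)).
Proof.
have Hcurv p (kappa : 'I_n -> R) : bnd Omega p -> principal_curvatures nu p kappa ->
    Ek k (shifted kappa) = chi (- lor o (horo nu p)).
  move=> bp pk; have hp := bnd_hyp Omega_dom bp; have [pn _] := normal_props nu_normal bp.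
  rewrite (curv_eq p kappa bp pk) V_lor; last by rewrite lerNr; exact: hyp_le.
  by rewrite (Vnu_lor ho hp pn) horoE lorDr lorNr; congr chi; ring.
split.
  have [c [hc [C C1 bE]]] := bnd_sphere Omega_dom Omega_smooth nu_normal Omega_hconvex ho hk
    chi_smooth chi_mono Hcurv.
  by exists c => //; exact: geodesic_sphere_lor hc C1 bE.
move=> chi_strict.
have [C C1 bE] := bnd_sphere_strict Omega_dom Omega_smooth nu_normal Omega_hconvex ho hk
    chi_smooth chi_mono Hcurv chi_strict hn.
exact: geodesic_sphere_lor ho C1 bE.
Qed.
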